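(* Let $X$ be a compact complex manifold, let $G$ be a complex reductive Lie group with Lie algebra $\mathfrak{g}$, and let $\{p_i,\ i\in E\}$ be homogeneous generators of $\mathbb{C}[\mathfrak{g}]^G$, $\deg p_i=d_i$. Let $(\mathbf{P},\theta)$ be a $G$-Higgs bundle on $X$, and let $\mathscr{C}^\bullet=\bigoplus_{p+q=\bullet}A^{0,p}(\mathrm{ad}\,\mathbf{P}\otimes\Omega^q_X)$ be its controlling differential graded Lie algebra. Then the obstruction space $O_{\mathrm{Def}_{\mathscr{C}^\bullet}}\subset H^2(\mathscr{C}^\bullet)$ is contained in the kernel of the map $$H^2(\mathscr{C}^\bullet)\longrightarrow\bigoplus_{i\in E}H^1(X,S^{d_i}\Omega^1_X),\qquad [s^{2,0},s^{1,1},s^{0,2}]\longmapsto\bigoplus_{i\in E}(\partial p_i)(s^{1,1}\otimes\theta^{d_i-1}),$$ where $s^{p,q}\in A^{0,q}(\mathrm{ad}\,\mathbf{P}\otimes\Omega^p_X)$ and $\partial p_i$ denotes the differential of $p_i$, thought of as an element of $\mathfrak{g}^\vee\otimes S^{d_i-1}(\mathfrak{g}^\vee)$.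
   Context: A $G$-Higgs bundle on $X$ is a pair $(\mathbf{P},\theta)$ consisting of a holomorphic principal $G$-bundle $\mathbf{P}\to X$ and a section $\theta\in H^0(X,\mathrm{ad}\,\mathbf{P}\otimes\Omega^1_X)$ with $\theta\wedge\theta=0$. Here $\mathrm{ad}\,\mathbf{P}=\mathbf{P}\times_{\mathrm{ad}}\mathfrak{g}$, $\Omega^q_X$ is the sheaf of holomorphic $q$-forms, and $A^{0,p}(F)$ denotes global smooth $(0,p)$-forms with values in a holomorphic bundle $F$. The controlling dgla $\mathscr{C}^\bullet$: an element of $A^{0,p}(\mathrm{ad}\,\mathbf{P}\otimes\Omega^q_X)$ is regarded as an $\mathrm{ad}\,\mathbf{P}$-valued $(q,p)$-form (locally $\alpha\otimes\omega\otimes Y\leftrightarrow(\alpha\wedge\omega)\otimes Y$, with $\alpha$ a $(0,p)$-form, $\omega$ a holomorphic $q$-form); the bracket is induced by the wedge product of forms and the Lie bracket of $\mathfrak{g}$; the differential is $\bar\partial_{\mathbf{P}}+\mathrm{ad}\,\theta$, with $\mathrm{ad}\,\theta=[\theta,\cdot\,]$. Notation $\partial p$: for a homogeneous polynomial $p$ of degree $d$ on $\mathfrak{g}$, $(\partial p)(Y\otimes v^{d-1})=\frac{d}{dt}p(v+tY)|_{t=0}$. For $p$ $G$-invariant this extends to forms with values in $\mathrm{ad}\,\mathbf{P}\otimes\Omega^1_X$ by multilinearity: $(0,q)$-form parts are wedged and holomorphic one-forms are multiplied in the symmetric algebra $S^\bullet\Omega^1_X$; thus for $s\in A^{0,q}(\mathrm{ad}\,\mathbf{P}\otimes\Omega^1_X)$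 one gets $(\partial p)(s\otimes\theta^{d-1})\in A^{0,q}(S^d\Omega^1_X)$. Its class is taken in Dolbeault cohomology $H^q(X,S^d\Omega^1_X)$. Deformation functors: $\mathrm{Art}_{\mathbb{C}}$ is the category of local Artin $\mathbb{C}$-algebras with residue field $\mathbb{C}$, $\mathfrak{m}_A$ the maximal ideal of $A$. For a dgla $L$, $\mathrm{MC}_L(A)=\{u\in L^1\otimes\mathfrak{m}_A : du+\frac12[u,u]=0\}$ and $\mathrm{Def}_L(A)=\mathrm{MC}_L(A)/\exp(L^0\otimes\mathfrak{m}_A)$ for the gauge action $\exp(\lambda):u\mapsto\exp(\mathrm{ad}\lambda)(u)+\frac{I-\exp(\mathrm{ad}\lambda)}{\mathrm{ad}\lambda}(d\lambda)$. Obstruction space: for a small extension $e:0\to M\to B\to A\to 0$ in $\mathrm{Art}_{\mathbb{C}}$ (i.e. $\mathfrak{m}_B M=0$) and $x\in\mathrm{MC}_L(A)$, choose a lift $\tilde{x}\in L^1\otimes\mathfrak{m}_B$ of $x$ and set $v_e(x)=[d\tilde{x}+\frac12[\tilde{x},\tilde{x}]]\in H^2(L)\otimes M$ (independent of the lift). This gives a complete obstruction theory $(H^2(L),v)$ for $\mathrm{MC}_L$, and $\mathrm{MC}_L$ and $\mathrm{Def}_L$ have isomorphic obstruction theories. The (universal) obstruction space $O_{\mathrm{Def}_L}\subset H^2(L)$ is the linear subspace generated by all $v_e(x)$, where $e$ ranges over principal small extensions ($M=\mathbb{C}$) and $x\in\mathrm{MC}_L(A)$. *)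

(* Defs.v *)
(* Built on MathComp-Analysis; the complex numbers are R[i] for an arbitrary R : realType. *)
From HB Require Import structures.
From mathcomp Require Import all_boot all_order all_algebra all_field.
From mathcomp Require Import complex.
From mathcomp Require Import -(notations) mpoly.
From mathcomp Require Import all_classical all_reals all_analysis.

Set Implicit Arguments.
Unset Strict Implicit.
Unset Printing Implicit Defensive.

Import Order.TTheory GRing.Theory Num.Theory.
Import numFieldNormedType.Exports.

Local Open Scope classical_set_scope.
Local Open Scope ring_scope.

(* R[i] carries no topology in the library: topology and differentiation on
   C^n = 'rV[R[i]]_n are those of R^(2n), through z |-> (Re z, Im z). *)
Definition c2r (R : realType) (n : nat) (z : 'rV[R[i]]_n) : 'rV[R]_(n + n) :=
  row_mx (map_mx (@complex.Re R) z) (map_mx (@complex.Im R) z).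

Definition r2c (R : realType) (n : nat) (r : 'rV[R]_(n + n)) : 'rV[R[i]]_n :=
  \row_k (r 0 (lshift n k) +i* r 0 (rshift n k))%C.

Definition copen (R : realType) (n : nat) (U : set 'rV[R[i]]_n) : Prop :=
  open (@r2c R n @^-1` U).

Definition re_part (R : realType) (n : nat) (f : 'rV[R[i]]_n -> R[i])
  (r : 'rV[R]_(n + n)) : R := complex.Re (f (r2c r)).

Definition im_part (R : realType) (n : nat) (f : 'rV[R[i]]_n -> R[i])
  (r : 'rV[R]_(n + n)) : R := complex.Im (f (r2c r)).

(* All iterated partial derivatives of order <= k exist and are continuous at
   every point of U, which is open in every use. *)
Fixpoint Ck (R : realType) (N : nat) (k : nat) (U : set 'rV[R]_N)
    (F : 'rV[R]_N -> R) : Prop :=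
  (forall x, U x -> F @ x --> F x) /\
  match k with
  | 0%N => True
  | k'.+1 => forall j : 'I_N,
      (forall x, U x -> derivable F x (delta_mx 0 j)) /\
      Ck k' U (fun x => 'D_(delta_mx 0 j) F x)
  end.

Definition smooth_on (R : realType) (n : nat) (U : set 'rV[R[i]]_n)
    (f : 'rV[R[i]]_n -> R[i]) : Prop :=
  forall k, Ck k (@r2c R n @^-1` U) (re_part f) /\
            Ck k (@r2c R n @^-1` U) (im_part f).

Definition rderiv (R : realType) (n : nat) (h : 'rV[R]_(n + n))
    (f : 'rV[R[i]]_n -> R[i]) (z : 'rV[R[i]]_n) : R[i] :=
  ('D_h (re_part f) (c2r z) +i* 'D_h (im_part f) (c2r z))%C.

Definition dz (R : realType) (n : nat) (k : 'I_n)
    (f : 'rV[R[i]]_n -> R[i]) (z : 'rV[R[i]]_n) : R[i] :=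
  2%:R^-1 * (rderiv (delta_mx 0 (lshift n k)) f z
             - 'i%C * rderiv (delta_mx 0 (rshift n k)) f z).

Definition dzbar (R : realType) (n : nat) (k : 'I_n)
    (f : 'rV[R[i]]_n -> R[i]) (z : 'rV[R[i]]_n) : R[i] :=
  2%:R^-1 * (rderiv (delta_mx 0 (lshift n k)) f z
             + 'i%C * rderiv (delta_mx 0 (rshift n k)) f z).

Definition holo_on (R : realType) (n m : nat) (U : set 'rV[R[i]]_n)
    (f : 'rV[R[i]]_n -> 'rV[R[i]]_m) : Prop :=
  forall k : 'I_m, smooth_on U (fun z => f z 0 k) /\
    forall (z : 'rV[R[i]]_n) (l : 'I_n), U z -> dzbar l (fun z => f z 0 k) z = 0.

(* Tangent vectors are rows: the complex differential of f at z is v |-> v *m jac f z. *)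
Definition jac (R : realType) (n m : nat) (f : 'rV[R[i]]_n -> 'rV[R[i]]_m)
    (z : 'rV[R[i]]_n) : 'M[R[i]]_(n, m) :=
  \matrix_(l < n, k < m) dz l (fun z => f z 0 k) z.

Record complexManifold (R : realType) (n : nat) := ComplexManifold {
  mpoint :> topologicalType;
  mhausdorff : hausdorff_space mpoint;
  mcountable : @second_countable mpoint;
  chart_index : Type;
  chart_dom : chart_index -> set mpoint;
  chart : chart_index -> mpoint -> 'rV[R[i]]_n;
  chart_inv : chart_index -> 'rV[R[i]]_n -> mpoint;
  chart_open : forall i, open (chart_dom i);
  chart_cover : forall x, exists i, chart_dom i x;
  chartK : forall i x, chart_dom i x -> chart_inv i (chart i x) = x;
  chart_homeo : forall i (A : set mpoint), A `<=` chart_dom i ->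
    (open A <-> copen (chart i @` A));
  chart_trans : forall i j, holo_on (chart i @` (chart_dom i `&` chart_dom j))
    (fun z => chart j (chart_inv i z))
}.
Arguments chart_dom {R n} c _ _.
Arguments chart {R n} c _ _.
Arguments chart_inv {R n} c _ _.
Arguments chart_cover {R n} c _.

(* A is the open set on which f is holomorphic. *)
Definition holomorphic (R : realType) (n1 n2 : nat)
    (M : complexManifold R n1) (N : complexManifold R n2)
    (A : set M) (f : M -> N) : Prop :=
  (forall x, A x -> f @ x --> f x) /\
  forall (i : chart_index M) (k : chart_index N),
    holo_on (chart M i @` (chart_dom M i `&` A `&` f @^-1` chart_dom N k))
      (fun z => chart N k (f (chart_inv M i z))).

(* f is holomorphic on the open subset A x N of the product manifold M x N. *)
Definition holomorphic2 (R : realType) (n1 n2 n3 : nat)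
    (M : complexManifold R n1) (N : complexManifold R n2)
    (L : complexManifold R n3) (A : set M) (f : M -> N -> L) : Prop :=
  (forall (x : M) (y : N), A x ->
     (fun xy : M * N => f xy.1 xy.2) @ (x, y) --> f x y) /\
  forall (i : chart_index M) (j : chart_index N) (k : chart_index L),
    holo_on
      [set z | exists (x : M) (y : N),
         [/\ A x, chart_dom M i x, chart_dom N j y, chart_dom L k (f x y)
           & z = row_mx (chart M i x) (chart N j y)]]
      (fun z : 'rV[R[i]]_(n1 + n2) =>
         chart L k (f (chart_inv M i (lsubmx z)) (chart_inv N j (rsubmx z)))).

Record complexLieGroup (R : realType) (m : nat) := ComplexLieGroup {
  gman :> complexManifold R m;
  gone : gman;
  gmul : gman -> gman -> gman;
  ginv : gman -> gman;
  gmulA : forall x y z, gmul x (gmul y z) = gmul (gmul x y) z;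
  gmul1 : forall x, gmul x gone = x;
  g1mul : forall x, gmul gone x = x;
  gmulV : forall x, gmul x (ginv x) = gone;
  gVmul : forall x, gmul (ginv x) x = gone;
  gmul_holo : holomorphic2 setT gmul;
  ginv_holo : holomorphic setT ginv
}.
Arguments gone {R m} c.
Arguments gmul {R m} c _ _.
Arguments ginv {R m} c _.

(* The Lie algebra is T_eG, identified with 'rV[R[i]]_m by one fixed chart at e. *)
Definition echart (R : realType) (m : nat) (G : complexLieGroup R m) :
  chart_index G := sval (cid (chart_cover G (gone G))).

Definition Ad (R : realType) (m : nat) (G : complexLieGroup R m) (g : G)
    (Y : 'rV[R[i]]_m) : 'rV[R[i]]_m :=
  Y *m jac (fun z => chart G (echart G)
                (gmul G (gmul G g (chart_inv G (echart G) z)) (ginv G g)))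
           (chart G (echart G) (gone G)).

(* [Y, Z] = ad(Y)(Z), where ad is the differential of Ad at e. *)
Definition lie (R : realType) (m : nat) (G : complexLieGroup R m)
    (Y Z : 'rV[R[i]]_m) : 'rV[R[i]]_m :=
  Y *m jac (fun z => Ad (chart_inv G (echart G) z) Z)
           (chart G (echart G) (gone G)).

(* G is reductive: it is the complexification of a compact Lie group K, i.e.
   every Lie group morphism from K to a complex Lie group H extends uniquely
   to a holomorphic morphism from G.  A compact subgroup of G is a Lie group,
   and Lie group morphisms are the continuous ones. *)
Definition reductive (R : realType) (m : nat) (G : complexLieGroup R m) : Prop :=
  exists K : set G,
    [/\ compact K, K (gone G),
        forall x y, K x -> K y -> K (gmul G x y),
        forall x, K x -> K (ginv G x)
      & forall (m' : nat) (H : complexLieGroup R m') (f : G -> H),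
          {within K, continuous f} ->
          (forall x y, K x -> K y -> f (gmul G x y) = gmul H (f x) (f y)) ->
          exists! F : G -> H,
            [/\ holomorphic setT F,
                forall x y, F (gmul G x y) = gmul H (F x) (F y)
              & forall x, K x -> F x = f x]].

Definition invariant_poly (R : realType) (m : nat) (G : complexLieGroup R m)
    (p : mpoly m R[i]) : Prop :=
  forall (g : G) (Y : 'rV[R[i]]_m), meval (Ad g Y 0) p = meval (Y 0) p.

Definition homogeneous_generators (R : realType) (m : nat)
    (G : complexLieGroup R m) (E : Type) (d : E -> nat)
    (p : E -> mpoly m R[i]) : Prop :=
  [/\ forall i, p i \is ishomog1 (d i) mdeg,
      forall i, invariant_poly G (p i)
    & forall S : set (mpoly m R[i]),
        (forall i, S (p i)) -> (forall c : R[i], S (mpolyC m c)) ->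
        (forall q r, S q -> S r -> S (q + r)) ->
        (forall q r, S q -> S r -> S (q * r)) ->
        forall q, invariant_poly G q -> S q].

(* (\partial p)(Y (x) v^(d-1)) = d/dt p(v + t Y) at t = 0. *)
Definition dpoly (R : realType) (m : nat) (p : mpoly m R[i])
    (Y v : 'rV[R[i]]_m) : R[i] :=
  \sum_(j < m) Y 0 j * meval (v 0) (mderiv j p).

(* [triv j] is the fibre coordinate of an equivariant local trivialisation
   over [triv_dom j], and [triv_inv j] is the inverse map (x, g) |-> y. *)
Record principalBundle (R : realType) (n m : nat) (X : complexManifold R n)
    (G : complexLieGroup R m) := PrincipalBundle {
  ptotal :> complexManifold R (n + m);
  pproj : ptotal -> X;
  pact : ptotal -> G -> ptotal;
  pproj_holo : holomorphic setT pproj;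
  pact_holo : holomorphic2 setT pact;
  pact1 : forall y, pact y (gone G) = y;
  pactM : forall y g h, pact (pact y g) h = pact y (gmul G g h);
  pproj_act : forall y g, pproj (pact y g) = pproj y;
  triv_index : Type;
  triv_dom : triv_index -> set X;
  triv : triv_index -> ptotal -> G;
  triv_inv : triv_index -> X -> G -> ptotal;
  triv_open : forall j, open (triv_dom j);
  triv_cover : forall x, exists j, triv_dom j x;
  triv_holo : forall j, holomorphic (pproj @^-1` triv_dom j) (triv j);
  triv_inv_holo : forall j, holomorphic2 (triv_dom j) (triv_inv j);
  pproj_triv_inv : forall j x g, triv_dom j x -> pproj (triv_inv j x g) = x;
  triv_invK : forall j x g, triv_dom j x -> triv j (triv_inv j x g) = g;
  trivK : forall j y, triv_dom j (pproj y) ->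
    triv_inv j (pproj y) (triv j y) = y;
  triv_act : forall j y g, triv_dom j (pproj y) ->
    triv j (pact y g) = gmul G (triv j y) g
}.
Arguments triv_index {R n m X G} p.
Arguments triv_dom {R n m X G} p _ _.
Arguments triv {R n m X G} p _ _.
Arguments triv_inv {R n m X G} p _ _ _.
Arguments triv_cover {R n m X G} p _.

(* g_{j'j} : with s_j(x) = triv_inv j x e one has s_j = s_{j'} . g_{j'j}. *)
Definition transition (R : realType) (n m : nat) (X : complexManifold R n)
    (G : complexLieGroup R m) (P : principalBundle X G)
    (j' j : triv_index P) (x : X) : G :=
  triv P j' (triv_inv P j x (gone G)).

(* A form is given by its expressions Phi i j x w v in the chart i of X and
   the trivialisation j of P: the value at x, in g, on the list w of tangent
   vectors of type (0,1), in which it is antilinear, and on the list v of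
   those of type (1,0).  In the correspondence with multilinear maps the (0,.)
   factors come first, (alpha ^ omega)(w; v) = alpha(w) omega(v), and wedge
   products are sums over shuffles, (alpha ^ beta)(w1, w2)
   = alpha(w1) beta(w2) - alpha(w2) beta(w1) for 1-forms.
   The type holds forms of all bidegrees at once: the component of type (p, q)
   is the restriction to lists v of length p and w of length q.  Expressions
   are set to 0 outside the domain of (i, j), so that equal forms are equal
   functions. *)
Definition adform (R : realType) (n m : nat) (X : complexManifold R n)
    (G : complexLieGroup R m) (P : principalBundle X G) : lmodType R[i] :=
  chart_index X -> triv_index P -> X ->
  seq 'rV[R[i]]_n -> seq 'rV[R[i]]_n -> 'rV[R[i]]_m.

Definition multilinear (K : nzRingType) (V W : lmodType K) (s : K -> K)
    (f : seq V -> W) : Prop :=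
  forall (l1 l2 : seq V) (a : K) (x y : V),
    f (l1 ++ (a *: x + y) :: l2) = s a *: f (l1 ++ x :: l2) + f (l1 ++ y :: l2).

Definition alternating (K : nzRingType) (V W : lmodType K) (f : seq V -> W) : Prop :=
  forall (l1 l2 l3 : seq V) (x : V), f (l1 ++ x :: l2 ++ x :: l3) = 0.

Definition transfer (R : realType) (n : nat) (X : complexManifold R n)
    (i i' : chart_index X) (x : X) (v : 'rV[R[i]]_n) : 'rV[R[i]]_n :=
  v *m jac (fun z => chart X i' (chart_inv X i z)) (chart X i x).

(* [A0 P p q Phi] : Phi is in A^{0,q}(ad P (x) Omega^p). *)
Record A0 (R : realType) (n m : nat) (X : complexManifold R n)
    (G : complexLieGroup R m) (P : principalBundle X G) (p q : nat)
    (Phi : adform P) : Prop := IsA0 {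
  A0_supp : forall i j x w v,
    ~ [/\ chart_dom X i x, triv_dom P j x, size w = q & size v = p] ->
    Phi i j x w v = 0;
  A0_antilinear : forall i j x v, multilinear (@conjc R) (fun w => Phi i j x w v);
  A0_linear : forall i j x w, multilinear id (Phi i j x w);
  A0_alt_bar : forall i j x v, alternating (fun w => Phi i j x w v);
  A0_alt : forall i j x w, alternating (Phi i j x w);
  A0_smooth : forall i j w v (c : 'I_m),
    smooth_on (chart X i @` (chart_dom X i `&` triv_dom P j))
      (fun z => Phi i j (chart_inv X i z) w v 0 c);
  A0_glue : forall i i' j j' x w v,
    chart_dom X i x -> chart_dom X i' x -> triv_dom P j x -> triv_dom P j' x ->
    Phi i' j' x (map (transfer i i' x) w) (map (transfer i i' x) v)
    = Ad (transition j' j x) (Phi i j x w v)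
}.

Definition component (R : realType) (n m : nat) (X : complexManifold R n)
    (G : complexLieGroup R m) (P : principalBundle X G) (p q : nat)
    (Phi : adform P) : adform P :=
  fun i j x w v => if (size w == q) && (size v == p) then Phi i j x w v else 0.

Definition remove_nth (T : Type) (l : nat) (w : seq T) : seq T :=
  take l w ++ drop l.+1 w.

Definition dbar_dir (R : realType) (n : nat) (u : 'rV[R[i]]_n)
    (f : 'rV[R[i]]_n -> R[i]) (z : 'rV[R[i]]_n) : R[i] :=
  \sum_(k < n) conjc (u 0 k) * dzbar k f z.

Definition dbar (R : realType) (n m : nat) (X : complexManifold R n)
    (G : complexLieGroup R m) (P : principalBundle X G) (Phi : adform P) :
    adform P :=
  fun i j x w v =>
    if `[< chart_dom X i x /\ triv_dom P j x >] then
      \row_c \sum_(l < size w) (-1) ^+ l *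
        dbar_dir (nth 0 w l)
          (fun z => Phi i j (chart_inv X i z) (remove_nth l w) v 0 c)
          (chart X i x)
    else 0.

(* Number of inversions of the shuffle moving the entries selected by b to the front. *)
Fixpoint shuffle_inv (b : bitseq) : nat :=
  if b is b0 :: b' then ((if b0 then 0 else count id b') + shuffle_inv b')%N
  else 0%N.

(* (alpha1 ^ omega1) ^ (alpha2 ^ omega2)
   = (-1)^(deg omega1 * deg alpha2) (alpha1 ^ alpha2) ^ (omega1 ^ omega2). *)
Definition form_bracket (R : realType) (n m : nat) (X : complexManifold R n)
    (G : complexLieGroup R m) (P : principalBundle X G) (Phi Psi : adform P) :
    adform P :=
  fun i j x w v =>
    \sum_(a : (size w).-tuple bool) \sum_(b : (size v).-tuple bool)
      (-1) ^+ (shuffle_inv a + shuffle_inv b + count id b * count negb a) *: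
      lie G (Phi i j x (mask a w) (mask b v))
            (Psi i j x (mask (map negb a) w) (mask (map negb b) v)).

Definition higgs_field (R : realType) (n m : nat) (X : complexManifold R n)
    (G : complexLieGroup R m) (P : principalBundle X G) (theta : adform P) : Prop :=
  [/\ A0 1 0 theta, dbar theta = 0 & form_bracket theta theta = 0].

(* [deg k] is the space of cochains of degree k, inside an ambient space on
   which the operations are defined. *)
Record cochain_data (K : fieldType) := CochainData {
  cochain :> lmodType K;
  deg : nat -> set cochain;
  diff : cochain -> cochain
}.

Definition cocycle (K : fieldType) (L : cochain_data K) (k : nat) : set L :=
  [set z | deg k z /\ diff z = 0].
Arguments cocycle {K} L k _.

Definition coboundary (K : fieldType) (L : cochain_data K) (k : nat) : set L :=
  [set b | match k with
           | 0%N => b = 0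
           | k'.+1 => exists2 u, deg k' u & b = diff u
           end].
Arguments coboundary {K} L k _.

(* An element of H^k(L) is a coset of the coboundaries. *)
Definition coh_class (K : fieldType) (L : cochain_data K) (k : nat) (z : L) : set L :=
  [set z' | cocycle L k z' /\ coboundary L k (z' - z)].
Arguments coh_class {K} L k z _.

(* The data of a differential graded Lie algebra: the definitions of MC_L and
   of O_{Def_L} involve only these. *)
Record dgla_data (K : fieldType) := DglaData {
  dg_cochain :> cochain_data K;
  dg_bracket : dg_cochain -> dg_cochain -> dg_cochain
}.

Definition max_ideal (K : fieldType) (A : falgType K) : set A :=
  [set a | a \isn't a GRing.unit].
Arguments max_ideal {K} A _.

(* A falgType is finite dimensional; local Artin K-algebras with residue field
   K are. *)
Record local_artin (K : fieldType) (A : falgType K) : Prop := LocalArtin {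
  art_comm : forall a b : A, a * b = b * a;
  art_local : forall a b : A,
    max_ideal A a -> max_ideal A b -> max_ideal A (a + b);
  art_residue : forall a : A, exists c : K, max_ideal A (a - c%:A)
}.

(* L (x) A, in coordinates with respect to a basis of A. *)
Definition tensor (K : fieldType) (L : lmodType K) (A : falgType K) : lmodType K :=
  {ffun 'I_(\dim {:A}) -> L}.

Definition pure (K : fieldType) (L : lmodType K) (A : falgType K)
    (l : L) (a : A) : tensor L A :=
  [ffun k => coord (vbasis {:A}) k a *: l].

Definition tensor_diff (K : fieldType) (L : cochain_data K) (A : falgType K)
    (u : tensor L A) : tensor L A :=
  [ffun k => diff (u k)].

Definition tensor_bracket (K : fieldType) (L : dgla_data K) (A : falgType K)
    (u v : tensor L A) : tensor L A :=
  \sum_(k < \dim {:A}) \sum_(l < \dim {:A})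
    pure (dg_bracket (u k) (v l)) ((vbasis {:A})`_k * (vbasis {:A})`_l).

Definition tensor_map (K : fieldType) (L : lmodType K) (B A : falgType K)
    (f : B -> A) (u : tensor L B) : tensor L A :=
  \sum_(k < \dim {:B}) pure (u k) (f (vbasis {:B})`_k).

(* L^k (x) m_A *)
Definition tensor_max (K : fieldType) (L : cochain_data K) (A : falgType K)
    (k : nat) : set (tensor L A) :=
  [set u | exists (r : nat) (l : 'I_r -> L) (a : 'I_r -> A),
     (forall s, deg k (l s) /\ max_ideal A (a s)) /\
     u = \sum_(s < r) pure (l s) (a s)].

Definition curvature (K : fieldType) (L : dgla_data K) (A : falgType K)
    (u : tensor L A) : tensor L A :=
  tensor_diff u + 2%:R^-1 *: tensor_bracket u u.

Definition MC (K : fieldType) (L : dgla_data K) (A : falgType K) : set (tensor L A) :=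
  [set u | tensor_max 1 u /\ curvature u = 0].

(* 0 -> K eps -> B -> A -> 0 *)
Record principal_small_extension (K : fieldType) (B A : falgType K)
    (f : {lrmorphism B -> A}) (eps : B) : Prop := PrincipalSmallExtension {
  pse_surj : forall a, exists b, f b = a;
  pse_ker : forall b, f b = 0 <-> exists c : K, b = c *: eps;
  pse_neq0 : eps != 0;
  pse_small : forall b, max_ideal B b -> b * eps = 0
}.

(* The cocycle o represents v_e(x) for some principal small extension e and
   some x in MC_L(A). *)
Definition obstruction_cocycle (K : fieldType) (L : dgla_data K) : set L :=
  [set o | cocycle L 2 o /\
     exists (B A : falgType K) (f : {lrmorphism B -> A}) (eps : B)
            (x : tensor L A) (x' : tensor L B),
       [/\ local_artin B /\ local_artin A, principal_small_extension f eps,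
           MC x, tensor_max 1 x' /\ tensor_map f x' = x
         & curvature x' = pure o eps]].

Definition obstruction_space (K : fieldType) (L : dgla_data K) : set (set L) :=
  [set c | exists (r : nat) (a : 'I_r -> K) (o : 'I_r -> L),
     (forall s, obstruction_cocycle (o s)) /\
     c = coh_class L 2 (\sum_(s < r) a s *: o s)].
Arguments obstruction_space {K} L _.

Definition higgs_deg (R : realType) (n m : nat) (X : complexManifold R n)
    (G : complexLieGroup R m) (P : principalBundle X G) (k : nat) : set (adform P) :=
  [set Phi | exists s : nat -> adform P,
     (forall p, (p <= k)%N -> A0 p (k - p) (s p)) /\
     Phi = \sum_(p < k.+1) s p].

Definition higgs_dgla (R : realType) (n m : nat) (X : complexManifold R n)
    (G : complexLieGroup R m) (P : principalBundle X G) (theta : adform P) :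
    dgla_data R[i] :=
  @DglaData _ (@CochainData _ (adform P) (@higgs_deg R n m X G P)
      (fun Phi => dbar Phi + form_bracket theta Phi))
    (@form_bracket R n m X G P).

(* An element of S^d of the cotangent space is viewed as a homogeneous
   polynomial function of degree d on the tangent space, the symmetric product
   being the pointwise product: tau i x w v is the value at x, in the chart i,
   on the (0,1)-vectors w of the form tau, as a function of v. *)
Definition symform (R : realType) (n : nat) (X : complexManifold R n) :
    lmodType R[i] :=
  chart_index X -> X -> seq 'rV[R[i]]_n -> 'rV[R[i]]_n -> (R[i])^o.

(* [A0_sym d q tau] : tau is in A^{0,q}(S^d Omega^1). *)
Record A0_sym (R : realType) (n : nat) (X : complexManifold R n) (d q : nat)
    (tau : symform X) : Prop := IsA0Sym {
  A0s_supp : forall i x w v, ~ (chart_dom X i x /\ size w = q) -> tau i x w v = 0;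
  A0s_antilinear : forall i x v, multilinear (@conjc R) (fun w => tau i x w v);
  A0s_alt_bar : forall i x v, alternating (fun w => tau i x w v);
  A0s_poly : forall i x w, exists2 p : mpoly n R[i],
    p \is ishomog1 d mdeg & forall v, tau i x w v = meval (v 0) p;
  A0s_smooth : forall i w v,
    smooth_on (chart X i @` chart_dom X i) (fun z => tau i (chart_inv X i z) w v);
  A0s_glue : forall i i' x w v, chart_dom X i x -> chart_dom X i' x ->
    tau i' x (map (transfer i i' x) w) (transfer i i' x v) = tau i x w v
}.

Definition sym_dbar (R : realType) (n : nat) (X : complexManifold R n)
    (tau : symform X) : symform X :=
  fun i x w v =>
    if `[< chart_dom X i x >] then
      \sum_(l < size w) (-1) ^+ l *
        dbar_dir (nth 0 w l)
          (fun z => tau i (chart_inv X i z) (remove_nth l w) v) (chart X i x)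
    else 0.

Definition dolbeault (R : realType) (n : nat) (X : complexManifold R n) (d : nat) :
    cochain_data R[i] :=
  @CochainData _ (symform X) (@A0_sym R n X d) (@sym_dbar R n X).

Definition triv_at (R : realType) (n m : nat) (X : complexManifold R n)
    (G : complexLieGroup R m) (P : principalBundle X G) (x : X) : triv_index P :=
  sval (cid (triv_cover P x)).

(* (\partial p)(s (x) theta^(d-1)), for s with values in ad P (x) Omega^1; for
   invariant p the trivialisation used at x is irrelevant. *)
Definition dpoly_form (R : realType) (n m : nat) (X : complexManifold R n)
    (G : complexLieGroup R m) (P : principalBundle X G) (theta : adform P)
    (p : mpoly m R[i]) (s : adform P) : symform X :=
  fun i x w v =>
    let j := triv_at P x in
    dpoly p (s i j x w [:: v]) (theta i j x [::] [:: v]).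

(* Main.v *)
(** Let x' in L^1 (x) m_B lift a Maurer-Cartan element over A = B / (eps), with
    curvature o (x) eps, and let Theta = theta + x'^{1,0}, a B-valued (1,0)-form.
    Since dbar theta = 0, the (1,1)-part of the curvature equation reads
    dbar Theta = o^{1,1} eps - [x'^{0,1}, Theta].  For an invariant polynomial p the
    bracket is annihilated by (d p)(- (x) Theta^(d-1)), so
    dbar (p(Theta)) = (d p)(o^{1,1} (x) Theta^(d-1)) eps
                    = (d p)(o^{1,1} (x) theta^(d-1)) eps,
    the last step because m_B eps = 0.  A linear functional lam on B with
    lam(eps) = 1 gives (d p)(o^{1,1} (x) theta^(d-1)) = dbar (lam(p(Theta))). *)

Require Import Defs.
From HB Require Import structures.
From mathcomp Require Import all_boot all_order all_algebra all_field.
From mathcomp Require Import complex.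
From mathcomp Require Import -(notations) mpoly.
From mathcomp Require Import all_classical all_reals all_analysis.
From mathcomp Require Import ring.

Set Implicit Arguments.
Unset Strict Implicit.
Unset Printing Implicit Defensive.

Import Order.TTheory GRing.Theory Num.Theory.
Import numFieldNormedType.Exports.

Local Open Scope classical_set_scope.
Local Open Scope ring_scope.

(** The obstacle is that invariance of p is an identity at points of the Lie algebra, whereas it is
    applied to Theta, whose coordinates lie in B. Its two consequences, p o Ad(g) = p and the
    vanishing of (d p)([v, Y] (x) v^(d-1)), are therefore turned into identities between scalar
    polynomials: over an infinite field these may be checked at points and then evaluated in any
    commutative algebra. B-valued forms are finite sums of scalar forms with coefficients in B, so
    that all differentiation stays scalar. The bracket is only given as the differential of Ad in
    one chart, which makes it linear in its first argument. Antisymmetry has to be derived: the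
    structure constants are differences of mixed second derivatives of the multiplication, and
    Schwarz's theorem applies. It is used twice: differentiating p(Ad(g) v) = p(v) yields brackets
    [Y, v], while [Theta, -] occurs in the curvature; and it identifies the two mixed terms of
    [x', x']. As smoothness is expressed by iterated partial derivatives, both Schwarz's theorem and
    the chain rule are obtained from the mean value theorem. *)

Lemma differentiable_linear_approx (K : numFieldType) (V W : normedModType K)
    (f : V -> W) (L : {linear V -> W}) (x : V) : continuous L ->
  (forall e : K, 0 < e -> exists2 d : K, 0 < d & forall h : V, `|h| < d ->
    `|f (x + h) - f x - L h| <= e * `|h|) ->
  differentiable f x /\ 'd f x = L :> (V -> W).
Proof.
move=> Lc fL.
have fLo : f \o shift x = cst (f x) + L +o_ 0 id.
  apply/eqaddoP => e e0; have [d d0 xd] := fL e e0.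
  apply/nbhs_ballP; exists d => //= h.
  rewrite -ball_normE/= sub0r normrN => /xd.
  rewrite -![(_ + _ : _ -> _) _]/(_ + _) -![(- _ : _ -> _) _]/(- _).
  by rewrite opprD addrA /= [h + x]addrC.
have dE := diff_unique Lc fLo.
by split => //; apply/diff_locallyP; rewrite dE.
Qed.

(** * Calculus on R^N and on C^n *)

Section RealCalculus.
Variables (R : realType) (N : nat).
Local Notation V := 'rV[R]_N.
Implicit Types (U : set V) (F G : V -> R).

Lemma Ck_continuous k U F x : Ck k U F -> U x -> F @ x --> F x.
Proof. by case: k => [|k] [cF _]; exact: cF. Qed.

Lemma cvg_dist F (x : V) (e : R) : F @ x --> F x -> 0 < e ->
  \forall y \near x, `|F y - F x| < e.
Proof.
move=> /cvgrPdist_lt cF e0; have := cF e e0.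
by apply: filterS => y; rewrite distrC.
Qed.

Lemma Ck_derivable k U F x j :
  Ck k.+1 U F -> U x -> derivable F x (delta_mx 0 j).
Proof. by move=> [_ /(_ j)[dF _]]; exact: dF. Qed.

Lemma Ck_derive k U F j : Ck k.+1 U F -> Ck k U (fun x => 'D_(delta_mx 0 j) F x).
Proof. by move=> [_ /(_ j)[]]. Qed.

Lemma open_near_eq U F G x : open U -> {in U, F =1 G} -> U x ->
  \forall y \near x, F y = G y.
Proof.
move=> oU FG Ux; have : nbhs x U by exact: open_nbhs_nbhs.
by apply: filterS => y Uy; apply: FG; rewrite inE.
Qed.

Lemma cvg_near_eq U F G x : open U -> {in U, F =1 G} -> U x ->
  F @ x --> F x -> G @ x --> G x.
Proof.
move=> oU FG Ux cF; rewrite -(FG x) ?inE//.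
apply: cvg_trans cF; apply: (near_eq_cvg (F := nbhs x)).
by apply: (open_near_eq oU) => // y yU; rewrite FG.
Qed.

Lemma Ck_ext k U F G : open U -> {in U, F =1 G} -> Ck k U F -> Ck k U G.
Proof.
move=> oU; elim: k F G => [|k IH] F G FG [cF dF].
  by split => // x Ux; apply: (cvg_near_eq oU FG) => //; exact: cF.
split=> [x Ux|j]; first by apply: (cvg_near_eq oU FG) => //; exact: cF.
have [dFj CF] := dF j; split.
  by move=> x Ux; apply: near_eq_derivable (dFj x Ux); exact: open_near_eq Ux.
apply: IH CF => x; rewrite inE => Ux.
by apply: near_eq_derive; exact: open_near_eq Ux.
Qed.

Lemma Ck_local k U F :
  (forall x, U x -> exists W : set V, [/\ open W, W x & Ck k W F]) -> Ck k U F.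
Proof.
elim: k F => [|k IH] F loc.
  by split=> // x /loc[W [_ Wx CF]]; exact: (Ck_continuous CF).
split=> [x /loc[W [_ Wx CF]]|j]; first exact: (Ck_continuous CF).
split=> [x /loc[W [_ Wx CF]]|]; first exact: (Ck_derivable CF Wx).
by apply: IH => x /loc[W [oW Wx CF]]; exists W; split => //; exact: Ck_derive.
Qed.

Lemma CkS k U F : Ck k.+1 U F -> Ck k U F.
Proof.
elim: k F => [|k IH] F [cF dF]; split => // j.
by have [dFj CF] := dF j; split => //; exact: IH.
Qed.

Lemma Ck_cst k U (c : R) : Ck k U (fun=> c).
Proof.
elim: k c => [|k IH] c.
  split => //.
  by move=> x _; apply: cst_continuous.
split=> [x _|j]; first exact: cst_continuous.
split=> [x _|]; first exact: derivable_cst.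
have -> : (fun x => 'D_(delta_mx 0 j) (fun=> c) x) = (fun=> 0) :> (V -> R).
  by apply/funext => x; exact: derive_cst.
exact: IH.
Qed.

Lemma CkD k U F G : open U -> Ck k U F -> Ck k U G -> Ck k U (fun x => F x + G x).
Proof.
move=> oU; elim: k F G => [|k IH] F G [cF dF] [cG dG].
  by split=> // x Ux; exact: (cvgD (cF x Ux) (cG x Ux)).
split=> [x Ux|j]; first by exact: (cvgD (cF x Ux) (cG x Ux)).
have [dFj CF] := dF j; have [dGj CG] := dG j; split.
  by move=> x Ux; apply: derivableD; [exact: dFj|exact: dGj].
apply: (@Ck_ext _ _ (fun x => 'D_(delta_mx 0 j) F x + 'D_(delta_mx 0 j) G x)) => //.
  by move=> x; rewrite inE => Ux; rewrite deriveD//; [exact: dFj|exact: dGj].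
exact: IH.
Qed.

Lemma CkM k U F G : open U -> Ck k U F -> Ck k U G -> Ck k U (fun x => F x * G x).
Proof.
move=> oU; elim: k F G => [|k IH] F G [cF dF] [cG dG].
  by split=> // x Ux; exact: (cvgM (cF x Ux) (cG x Ux)).
split=> [x Ux|j]; first by exact: (cvgM (cF x Ux) (cG x Ux)).
have [dFj CF] := dF j; have [dGj CG] := dG j; split.
  by move=> x Ux; apply: derivableM; [exact: dFj|exact: dGj].
apply: (@Ck_ext _ _ (fun x => F x * 'D_(delta_mx 0 j) G x
                              + G x * 'D_(delta_mx 0 j) F x)) => //.
  by move=> x; rewrite inE => Ux; rewrite deriveM//; [exact: dFj|exact: dGj].
by apply: CkD => //; apply: IH => //; exact: CkS.
Qed.

Lemma is_derive_line F (x h : V) (s : R) : derivable F (x + s *: h) h ->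
  is_derive s 1 (fun t => F (x + t *: h)) ('D_h F (x + s *: h)).
Proof.
have E : (fun t => t^-1 *: (((fun t => F (x + t *: h)) \o shift s) (t *: 1)
                            - F (x + s *: h)))
       = (fun t => t^-1 *: ((F \o shift (x + s *: h)) (t *: h) - F (x + s *: h))).
  apply/funext => t /=; congr (_ *: (F _ - _)).
  by rewrite -[t%:A]/(t * 1) mulr1 scalerDl addrCA.
by move=> dF; split; rewrite /derivable /derive E.
Qed.

(** The intermediate point is located only by |t| <= |s|, which covers both signs of s and is all
    that estimates near x require. *)
Lemma line_MVT F (x h : V) (s : R) :
  (forall t : R, `|t| <= `|s| -> derivable F (x + t *: h) h) ->
  exists2 t : R, `|t| <= `|s| & F (x + s *: h) - F x = 'D_h F (x + t *: h) * s.
Proof.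
move=> dF.
have dl (t : R) : `|t| <= `|s| ->
    is_derive t 1 (fun t => F (x + t *: h)) ('D_h F (x + t *: h)).
  by move=> ts; apply: is_derive_line; exact: dF.
have cont (a b : R) : (forall t, t \in `[a, b] -> `|t| <= `|s|) ->
    {within `[a, b], continuous (fun t => F (x + t *: h))}.
  move=> ab; apply: derivable_within_continuous => t tab.
  by have := dl t (ab t tab) => -[].
have F0 : F x = F (x + 0 *: h) by rewrite scale0r addr0.
have [s0|s0] := leP 0 s.
- have ab t : t \in `[0, s] -> `|t| <= `|s|.
    by rewrite in_itv/= => /andP[t0 ts]; rewrite !ger0_norm// (le_trans t0).
  have [t tab|c cs E] := @MVT_segment R (fun t => F (x + t *: h))
      (fun t => 'D_h F (x + t *: h)) 0 s s0 _ (cont _ _ ab).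
    by apply: dl; apply: ab; exact: subset_itv_oo_cc tab.
  by exists c; [exact: ab|rewrite F0 E subr0].
- have ab t : t \in `[s, 0] -> `|t| <= `|s|.
    by rewrite in_itv/= => /andP[st t0]; rewrite !ler0_norm ?lerN2// (le_trans st).
  have [t tab|c cs E] := @MVT_segment R (fun t => F (x + t *: h))
      (fun t => 'D_h F (x + t *: h)) s 0 (ltW s0) _ (cont _ _ ab).
    by apply: dl; apply: ab; exact: subset_itv_oo_cc tab.
  by exists c; [exact: ab|rewrite F0 -opprB E sub0r mulrN opprK].
Qed.

Lemma mx_norm_leP (h : V) (e : R) : 0 <= e ->
  (forall j, `|h 0 j| <= e) -> `|h| <= e.
Proof.
move=> e0 he; rewrite [leLHS]/Num.Def.normr/= mx_normrE.
by apply: bigmax_le => // -[i j] _ /=; rewrite (ord1 i).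
Qed.

Lemma mx_norm_coord (h : V) j : `|h 0 j| <= `|h|.
Proof.
rewrite [leRHS]/Num.Def.normr/= mx_normrE.
exact: (le_bigmax _ (fun k : 'I_1 * 'I_N => `|h k.1 k.2|) (0, j)).
Qed.

Lemma near_ball (x : V) (P : V -> Prop) : (\forall y \near x, P y) ->
  exists2 e : R, 0 < e & forall h : V, `|h| < e -> P (x + h).
Proof.
move=> /nbhs_ballP[e /= e0 xe]; exists e => // h he; apply: xe.
by rewrite -ball_normE /= opprD addrA subrr sub0r normrN.
Qed.

(** Pass from x to x + h one coordinate at a time: on each segment the mean value theorem turns the
    increment into a partial derivative at a nearby point, which is close to the one at x by
    continuity. *)
Lemma C1_differential U F x : open U -> Ck 1 U F -> U x ->
  forall e : R, 0 < e -> exists2 d : R, 0 < d & forall h : V, `|h| < d ->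
    `|F (x + h) - F x - \sum_j h 0 j * 'D_(delta_mx 0 j) F x| <= e * `|h|.
Proof.
move=> oU C1 Ux e e0.
(* Each of the N increments contributes an error of at most e' |h|; N + 1 keeps the quotient
   meaningful for N = 0. *)
pose e' := e / N.+1%:R.
have e'0 : 0 < e' by rewrite divr_gt0.
have : \forall y \near x, U y /\ forall j,
    `|'D_(delta_mx 0 j) F y - 'D_(delta_mx 0 j) F x| < e'.
  have nU : \forall y \near x, U y by exact: open_nbhs_nbhs.
  apply: filterI nU _; apply: (filter_forall (F := nbhs x)) => j.
  exact: cvg_dist (Ck_continuous (Ck_derive j C1) Ux) e'0.
move=> /near_ball[d d0 xd]; exists d => // h hd.
(* [tr l] keeps the first l coordinates of h; in the sup norm it is no longer than h, so the whole
   path stays in the ball around x. *)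
pose tr l : V := \row_j (if (j < l)%N then h 0 j else 0).
have trS (l : 'I_N) : tr l.+1 = tr l + h 0 l *: delta_mx 0 l.
  apply/rowP => j; rewrite !mxE eqxx/= ltnS leq_eqVlt.
  have [->|jl] := eqVneq j l; first by rewrite eqxx ltnn add0r mulr1.
  by rewrite (negPf (_ : (j != l :> nat))) //= mulr0 addr0.
have tele : F (x + h) - F x = \sum_(l < N) (F (x + tr l.+1) - F (x + tr l)).
  rewrite -(big_mkord predT (fun l => F (x + tr l.+1) - F (x + tr l))) telescope_sumr//.
  congr (F (_ + _) - F _); first by apply/rowP => j; rewrite mxE ltn_ord.
  by rewrite -[LHS]addr0; congr (_ + _); apply/rowP => j; rewrite !mxE ltn0.
rewrite tele -sumrB.
apply: (@le_trans _ _ (\sum_(l < N) e' * `|h|)); last first.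
  rewrite sumr_const card_ord -[leLHS]mulr_natr mulrAC ler_wpM2r//.
  rewrite /e' mulrAC ler_pdivrMr//.
  by apply: ler_wpM2l; [exact: ltW|rewrite ler_nat].
apply: le_trans (ler_norm_sum _ _ _) _; apply: ler_sum => l _.
have small t : `|t| <= `|h 0 l| -> `|tr l + t *: delta_mx 0 l| < d.
  move=> tl; apply: le_lt_trans hd; apply: mx_norm_leP => // j.
  rewrite !mxE eqxx/=; have [->|jl] := eqVneq j l.
    by rewrite ltnn add0r mulr1 (le_trans tl)// mx_norm_coord.
  by rewrite mulr0 addr0; case: ifP => _; rewrite ?normr0// mx_norm_coord.
have [|t tl] := @line_MVT F (x + tr l) (delta_mx 0 l) (h 0 l).
  move=> t tl; apply: (Ck_derivable C1).
  by rewrite -addrA; have [] := xd _ (small t tl).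
rewrite trS addrA => ->; rewrite mulrC -mulrBr normrM mulrC.
apply: ler_pM => //; last exact: mx_norm_coord.
by rewrite -addrA ltW//; have [_] := xd _ (small t tl); exact.
Unshelve. all: by end_near. Qed.

(** [Ck] only speaks of partial derivatives; the chain rule rests on the total differential obtained
    here. *)
Lemma C1_differentiable U F x : open U -> Ck 1 U F -> U x ->
  differentiable F x /\
  forall v, 'D_v F x = \sum_j v 0 j * 'D_(delta_mx 0 j) F x.
Proof.
move=> oU C1 Ux.
pose L (v : V) : R := \sum_j v 0 j * 'D_(delta_mx 0 j) F x.
have Llin : linear L.
  move=> a u v; rewrite /L scaler_sumr -big_split/=; apply: eq_bigr => j _.
  by rewrite !mxE mulrDl -mulrA.
pose Lm : {linear V -> R^o} := HB.pack (L : V -> R^o)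
  (GRing.isLinear.Build _ _ _ _ (L : V -> R^o) Llin).
have Lc : continuous Lm.
  move=> v; rewrite /Lm/=.
  have -> : L = \sum_j ('D_(delta_mx 0 j) F x *: (fun v : V => v 0 j)).
    by apply/funext => w; rewrite fct_sumE; apply: eq_bigr => j _; rewrite mulrC.
  apply: differentiable_continuous; apply: differentiable_sum => j.
  exact/differentiableZ/differentiable_coord.
have [dF dE] := @differentiable_linear_approx R V R^o F Lm x Lc
  (fun e e0 => C1_differential oU C1 Ux e0).
by split => // v; rewrite deriveE// dE.
Qed.

(** The mean value theorem, applied to y |-> F(y + s e_j) - F(y) in direction i and then to the i-th
    derivative of F in direction j, makes the second difference equal to s * s times the mixed
    derivative at a point near x. *)
Lemma Ck_second_difference U F x i j (e : R) : open U -> Ck 2 U F -> U x ->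
  0 < e -> \forall s \near (0 : R)^'+,
   `|'D_(delta_mx 0 j) (fun y => 'D_(delta_mx 0 i) F y) x * (s * s) -
    (F (x + s *: delta_mx 0 i + s *: delta_mx 0 j) - F (x + s *: delta_mx 0 i)
      - (F (x + s *: delta_mx 0 j) - F x))| <= e * (s * s).
Proof.
move=> oU C2 Ux e0.
have : \forall y \near x, U y /\
    `|'D_(delta_mx 0 j) (fun y => 'D_(delta_mx 0 i) F y) y
     - 'D_(delta_mx 0 j) (fun y => 'D_(delta_mx 0 i) F y) x| < e.
  have nU : \forall y \near x, U y by exact: open_nbhs_nbhs.
  exact: filterI nU (cvg_dist (Ck_continuous (Ck_derive j (Ck_derive i C2)) Ux) e0).
move=> /near_ball[d d0 xd].
near=> s.
have s0 : 0 < s by [].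
(* Intermediate points are displaced from x by two vectors, each of norm at most s. *)
have sd : s < d / 2 by near: s; apply: nbhs_right_lt; rewrite divr_gt0.
have small (a b : R) : `|a| <= `|s| -> `|b| <= `|s| ->
    `|a *: delta_mx 0 i + b *: delta_mx 0 j : V| < d.
  move=> sa sb.
  have D (c : R) k : `|c| <= `|s| -> `|c *: delta_mx 0 k : V| <= s.
    rewrite (gtr0_norm s0) => cs; apply: mx_norm_leP; rewrite ?ltW// => l.
    by rewrite !mxE eqxx/=; case: eqP => _; rewrite ?mulr1// mulr0 normr0 ltW.
  apply: le_lt_trans (ler_normD _ _) _; rewrite (splitr d).
  by apply: ltr_leD; [exact: le_lt_trans (D _ _ sa) sd|
                      exact: le_trans (D _ _ sb) (ltW sd)].
pose H y := F (y + s *: delta_mx 0 j) - F y.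
have dH (t : R) : `|t| <= `|s| ->
    is_derive (x + t *: delta_mx 0 i) (delta_mx 0 i) H
     ('D_(delta_mx 0 i) F (x + t *: delta_mx 0 i + s *: delta_mx 0 j)
      - 'D_(delta_mx 0 i) F (x + t *: delta_mx 0 i)).
  move=> ts.
  have sU b : `|b| <= `|s| -> U (x + t *: delta_mx 0 i + b *: delta_mx 0 j).
    by move=> bs; rewrite -addrA; have [] := xd _ (small _ _ ts bs).
  apply: is_deriveB; last first.
    apply/derivableP/(Ck_derivable C2).
    by have := sU 0; rewrite scale0r addr0 normr0; exact.
  have dF : derivable F (x + t *: delta_mx 0 i + s *: delta_mx 0 j) (delta_mx 0 i).
    by apply: (Ck_derivable C2); exact: sU.
  have E : (fun r => r^-1 *: (((fun y => F (y + s *: delta_mx 0 j)) \o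
        shift (x + t *: delta_mx 0 i)) (r *: delta_mx 0 i)
        - F (x + t *: delta_mx 0 i + s *: delta_mx 0 j)))
     = (fun r => r^-1 *: ((F \o shift (x + t *: delta_mx 0 i + s *: delta_mx 0 j))
            (r *: delta_mx 0 i)
        - F (x + t *: delta_mx 0 i + s *: delta_mx 0 j))).
    by apply/funext => r /=; rewrite !addrA.
  by split; rewrite /derivable /derive E.
have [|t ts E] := @line_MVT H x (delta_mx 0 i) s.
  by move=> t ts; have [] := dH t ts.
have [|t' ts' E'] := @line_MVT ('D_(delta_mx 0 i) F) (x + t *: delta_mx 0 i)
    (delta_mx 0 j) s.
  move=> t' ts'; apply: (Ck_derivable (Ck_derive i C2)).
  by rewrite -addrA; have [] := xd _ (small _ _ ts ts').
have [_ dHt] := dH t ts.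
have -> : F (x + s *: delta_mx 0 i + s *: delta_mx 0 j) - F (x + s *: delta_mx 0 i)
   - (F (x + s *: delta_mx 0 j) - F x) = H (x + s *: delta_mx 0 i) - H x by [].
rewrite E dHt E' -mulrA -mulrBl normrM (ger0_norm (mulr_ge0 (ltW s0) (ltW s0))).
rewrite ler_pM2r ?mulr_gt0// distrC ltW// -addrA.
by have [_] := xd _ (small _ _ ts ts').
Unshelve. all: by end_near. Qed.

(* Divided by s * s, the second difference of F in the directions i and j tends to
   both mixed derivatives. *)
Lemma Ck_schwarz U F x i j : open U -> Ck 2 U F -> U x ->
  'D_(delta_mx 0 i) (fun y => 'D_(delta_mx 0 j) F y) x
  = 'D_(delta_mx 0 j) (fun y => 'D_(delta_mx 0 i) F y) x.
Proof.
move=> oU C2 Ux.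
apply/eqP; rewrite -subr_eq0 -normr_eq0 eq_le normr_ge0 andbT.
apply/ler_addgt0Pl => e e0; rewrite addr0.
have e20 : 0 < e / 2 by rewrite divr_gt0.
have E (a b p q r t : R) :
  a - b = a - (p - q - (r - t)) + (p - r - (q - t) - b) by ring.
near (0 : R)^'+ => s.
have s0 : 0 < s by [].
have ss0 : 0 < s * s by rewrite mulr_gt0.
have H1 : `|'D_(delta_mx 0 j) (fun y => 'D_(delta_mx 0 i) F y) x * (s * s)
    - (F (x + s *: delta_mx 0 i + s *: delta_mx 0 j) - F (x + s *: delta_mx 0 i)
       - (F (x + s *: delta_mx 0 j) - F x))|
    <= e / 2 * (s * s).
  near: s; exact: (@Ck_second_difference U F x i j _ oU C2 Ux e20).
have H2 : `|'D_(delta_mx 0 i) (fun y => 'D_(delta_mx 0 j) F y) x * (s * s)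
    - (F (x + s *: delta_mx 0 j + s *: delta_mx 0 i) - F (x + s *: delta_mx 0 j)
       - (F (x + s *: delta_mx 0 i) - F x))|
    <= e / 2 * (s * s).
  near: s; exact: (@Ck_second_difference U F x j i _ oU C2 Ux e20).
rewrite -(ler_pM2r ss0) -{1}(ger0_norm (ltW ss0)) -normrM mulrBl.
rewrite [e in leRHS](splitr e) mulrDl; apply: le_trans (lerD H2 H1).
rewrite [X in _ <= _ + X]distrC; apply: le_trans (ler_normD _ _).
rewrite [x + s *: delta_mx 0 j + _]addrAC le_eqVlt; apply/orP; left; apply/eqP.
by congr (`| _ |); exact: E.
Unshelve. all: by end_near. Qed.

Lemma is_derive_add F G (x h : V) (a b : R) :
  is_derive x h F a -> is_derive x h G b ->
  is_derive x h (fun y => F y + G y) (a + b).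
Proof. by move=> dF dG; exact: is_deriveD. Qed.

Lemma is_derive_mul F G (x h : V) (a b : R) :
  is_derive x h F a -> is_derive x h G b ->
  is_derive x h (fun y => F y * G y) (F x * b + G x * a).
Proof. by move=> dF dG; exact: is_deriveM. Qed.

End RealCalculus.

(** * Complex-valued functions and their real partial derivatives *)

Section ComplexCalculus.
Variables (R : realType) (n : nat).
Local Notation C := R[i].
Implicit Types (f g : 'rV[C]_n -> C) (U : set 'rV[C]_n) (z : 'rV[C]_n).

Lemma c2rK : cancel (@c2r R n) (@r2c R n).
Proof.
by move=> z; apply/rowP => k; rewrite !mxE (unsplitK (inl _)) (unsplitK (inr _)) !mxE;
   case: (z 0 k).
Qed.

Lemma r2cK : cancel (@r2c R n) (@c2r R n).
Proof.
move=> r; apply/rowP => k; rewrite mxE; case: splitP => j kj; rewrite !mxE /=.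
  by congr (r _ _); apply/val_inj.
by congr (r _ _); apply/val_inj.
Qed.

Lemma re_partD f g : re_part (fun z => f z + g z) = (fun r => re_part f r + re_part g r).
Proof.
by apply/funext => r; rewrite /re_part; case: (f _) => a b; case: (g _).
Qed.

Lemma im_partD f g : im_part (fun z => f z + g z) = (fun r => im_part f r + im_part g r).
Proof.
by apply/funext => r; rewrite /im_part; case: (f _) => a b; case: (g _).
Qed.

Lemma re_partM f g : re_part (fun z => f z * g z)
  = (fun r => re_part f r * re_part g r + (-1) * (im_part f r * im_part g r)).
Proof.
apply/funext => r; rewrite /re_part /im_part; case: (f _) => a b; case: (g _) => c d.
by rewrite mulN1r.
Qed.

Lemma im_partM f g : im_part (fun z => f z * g z)
  = (fun r => re_part f r * im_part g r + im_part f r * re_part g r).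
Proof.
by apply/funext => r; rewrite /re_part /im_part; case: (f _) => a b; case: (g _).
Qed.

Lemma smooth_on_ext U f g : copen U -> {in U, f =1 g} -> smooth_on U f -> smooth_on U g.
Proof.
move=> oU fg sf k; have [sr si] := sf k; split.
  by apply: Ck_ext sr => // r; rewrite inE => rU; rewrite /re_part fg// inE.
by apply: Ck_ext si => // r; rewrite inE => rU; rewrite /im_part fg// inE.
Qed.

Lemma smooth_on_local U f :
  (forall z, U z -> exists V, [/\ copen V, V z & smooth_on V f]) -> smooth_on U f.
Proof.
move=> loc k; split; apply: Ck_local => r /loc[V [oV Vr sf]];
  by exists (@r2c R n @^-1` V); split => //; have [] := sf k.
Qed.

Lemma smooth_on_cst U (c : C) : smooth_on U (fun=> c).
Proof. by move=> k; split; exact: Ck_cst. Qed.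

Lemma smooth_onD U f g : copen U -> smooth_on U f -> smooth_on U g ->
  smooth_on U (fun z => f z + g z).
Proof.
move=> oU sf sg k; have [sfr sfi] := sf k; have [sgr sgi] := sg k.
by rewrite re_partD im_partD; split; exact: CkD.
Qed.

Lemma smooth_onM U f g : copen U -> smooth_on U f -> smooth_on U g ->
  smooth_on U (fun z => f z * g z).
Proof.
move=> oU sf sg k; have [sfr sfi] := sf k; have [sgr sgi] := sg k.
rewrite re_partM im_partM; split; apply: CkD => //; try exact: CkM.
by apply: CkM => //; [exact: Ck_cst|exact: CkM].
Qed.

Lemma smooth_on_sum U (I : Type) (r : seq I) (P : pred I)
    (F : I -> 'rV[C]_n -> C) : copen U -> (forall i, smooth_on U (F i)) ->
  smooth_on U (fun z => \sum_(i <- r | P i) F i z).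
Proof.
move=> oU sF.
have -> : (fun z => \sum_(i <- r | P i) F i z) = \sum_(i <- r | P i) F i.
  by apply/funext => z; rewrite fct_sumE.
apply: big_ind => [|f g sf sg|i _]; last exact: sF.
- exact: smooth_on_cst.
- exact: smooth_onD.
Qed.

Local Notation e j := (delta_mx 0 j).

Definition is_rderiv (j : 'I_(n + n)) f z (l : C) :=
  is_derive (c2r z) (e j) (re_part f) (complex.Re l) /\
  is_derive (c2r z) (e j) (im_part f) (complex.Im l).

Lemma is_rderivE j f z l : is_rderiv j f z l -> rderiv (e j) f z = l.
Proof. by case=> -[_ dr] [_ di]; rewrite /rderiv dr di; case: l {dr di}. Qed.

(** Existence of the 2n real partial derivatives at the single point z: weaker than
    differentiability, but enough for the sum and product rules of the Wirtinger operators. *)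
Definition cderivable f z := forall j, is_rderiv j f z (rderiv (e j) f z).

Lemma is_rderiv_derivable j f z : derivable (re_part f) (c2r z) (e j) ->
  derivable (im_part f) (c2r z) (e j) -> is_rderiv j f z (rderiv (e j) f z).
Proof. by move=> dr di; split; exact: derivableP. Qed.

Lemma is_rderiv_cderivable f z (l : 'I_(n + n) -> C) :
  (forall j, is_rderiv j f z (l j)) -> cderivable f z.
Proof. by move=> df j; rewrite (is_rderivE (df j)). Qed.

Lemma is_rderiv_cst (c : C) z j : is_rderiv j (fun=> c) z 0.
Proof.
split; first exact: (is_derive_cst (complex.Re c)).
exact: (is_derive_cst (complex.Im c)).
Qed.

Lemma is_rderivD f g z j a b : is_rderiv j f z a -> is_rderiv j g z b ->
  is_rderiv j (fun z => f z + g z) z (a + b).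
Proof.
move=> [fr fi] [gr gi]; split.
  rewrite re_partD; have := is_derive_add fr gr.
  by case: a b {fr fi gr gi} => a1 a2 [b1 b2].
rewrite im_partD; have := is_derive_add fi gi.
by case: a b {fr fi gr gi} => a1 a2 [b1 b2].
Qed.

Lemma is_rderivM f g z j a b : is_rderiv j f z a -> is_rderiv j g z b ->
  is_rderiv j (fun z => f z * g z) z (f z * b + g z * a).
Proof.
move=> [fr fi] [gr gi].
have rf : re_part f (c2r z) = complex.Re (f z) by rewrite /re_part c2rK.
have rg : re_part g (c2r z) = complex.Re (g z) by rewrite /re_part c2rK.
have jf : im_part f (c2r z) = complex.Im (f z) by rewrite /im_part c2rK.
have jg : im_part g (c2r z) = complex.Im (g z) by rewrite /im_part c2rK.
split.
  rewrite re_partM.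
  have := is_derive_add (is_derive_mul fr gr)
    (is_derive_mul (is_derive_cst (-1 : R) (c2r z) (e j)) (is_derive_mul fi gi)).
  rewrite rf rg jf jg => d; apply: is_derive_eq d _.
  case: (f z) (g z) a b {fr fi gr gi rf rg jf jg} => [f1 f2] [g1 g2] [a1 a2] [b1 b2] /=.
  by ring.
rewrite im_partM.
have := is_derive_add (is_derive_mul fr gi) (is_derive_mul fi gr).
rewrite rf rg jf jg => d; apply: is_derive_eq d _.
case: (f z) (g z) a b {fr fi gr gi rf rg jf jg} => [f1 f2] [g1 g2] [a1 a2] [b1 b2] /=.
by ring.
Qed.

Lemma smooth_on_cderivable U f z : smooth_on U f -> U z -> cderivable f z.
Proof.
move=> sf Uz j; have [sr si] := sf 1%N.
by apply: is_rderiv_derivable; [apply: (Ck_derivable sr)|apply: (Ck_derivable si)];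
  rewrite /= c2rK.
Qed.

Lemma cderivable_cst (c : C) z : cderivable (fun=> c) z.
Proof. by apply: is_rderiv_cderivable => j; exact: is_rderiv_cst. Qed.

Lemma cderivableD f g z : cderivable f z -> cderivable g z ->
  cderivable (fun z => f z + g z) z.
Proof. by move=> df dg; apply: is_rderiv_cderivable => j; exact: is_rderivD. Qed.

Lemma cderivableM f g z : cderivable f z -> cderivable g z ->
  cderivable (fun z => f z * g z) z.
Proof. by move=> df dg; apply: is_rderiv_cderivable => j; exact: is_rderivM. Qed.

Lemma cderivable_sum (I : Type) (r : seq I) (P : pred I)
    (F : I -> 'rV[C]_n -> C) z : (forall i, cderivable (F i) z) ->
  cderivable (fun z => \sum_(i <- r | P i) F i z) z.
Proof.
move=> dF.
have -> : (fun z => \sum_(i <- r | P i) F i z) = \sum_(i <- r | P i) F i.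
  by apply/funext => y; rewrite fct_sumE.
apply: (big_ind (fun f => cderivable f z)) => [|f g df dg|i _]; last exact: dF.
- exact: cderivable_cst.
- exact: cderivableD.
Qed.

Lemma copen_near U z (P : 'rV[C]_n -> Prop) : copen U -> U z ->
  (forall y, U y -> P y) -> \forall r \near c2r z, P (r2c r).
Proof.
move=> oU Uz UP.
have : nbhs (c2r z) (@r2c R n @^-1` U).
  by apply: open_nbhs_nbhs; split => //=; rewrite c2rK.
by apply: filterS => r; exact: UP.
Qed.

Lemma rderiv_ext U f g z h : copen U -> U z -> {in U, f =1 g} ->
  rderiv h f z = rderiv h g z.
Proof.
move=> oU Uz fg; rewrite /rderiv.
have nfg : \forall r \near c2r z, f (r2c r) = g (r2c r).
  by apply: (copen_near (P := fun y => f y = g y) oU Uz) => y Uy; apply: fg; rewrite inE.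
congr (_ +i* _)%C; apply: near_eq_derive; apply: filterS nfg => r fgr;
  by rewrite /re_part /im_part fgr.
Qed.

Lemma cderivable_ext U f g z : copen U -> U z -> {in U, f =1 g} ->
  cderivable f z -> cderivable g z.
Proof.
move=> oU Uz fg df j; have [[dr _] [di _]] := df j;
have nfg : \forall r \near c2r z, f (r2c r) = g (r2c r).
  by apply: (copen_near (P := fun y => f y = g y) oU Uz) => y Uy; apply: fg; rewrite inE.
apply: is_rderiv_derivable.
  by apply: near_eq_derivable dr; apply: filterS nfg => r fgr; rewrite /re_part fgr.
by apply: near_eq_derivable di; apply: filterS nfg => r fgr; rewrite /im_part fgr.
Qed.

Lemma rderiv_cst (c : C) z j : rderiv (e j) (fun=> c) z = 0.
Proof. exact/is_rderivE/is_rderiv_cst. Qed.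

Lemma rderivD f g z j : cderivable f z -> cderivable g z ->
  rderiv (e j) (fun z => f z + g z) z = rderiv (e j) f z + rderiv (e j) g z.
Proof. by move=> df dg; apply/is_rderivE/is_rderivD. Qed.

Lemma rderivM f g z j : cderivable f z -> cderivable g z ->
  rderiv (e j) (fun z => f z * g z) z
  = f z * rderiv (e j) g z + g z * rderiv (e j) f z.
Proof. by move=> df dg; apply/is_rderivE/is_rderivM. Qed.

Lemma rderiv_sum (I : Type) (r : seq I) (P : pred I)
    (F : I -> 'rV[C]_n -> C) z j : (forall i, cderivable (F i) z) ->
  rderiv (e j) (fun z => \sum_(i <- r | P i) F i z) z
  = \sum_(i <- r | P i) rderiv (e j) (F i) z.
Proof.
move=> dF; elim: r => [|i r IH].
  under [X in rderiv _ X]funext do rewrite big_nil.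
  by rewrite rderiv_cst big_nil.
rewrite big_cons.
under [X in rderiv _ X]funext do rewrite big_cons.
case: (P i) => //; rewrite -IH rderivD//; exact: cderivable_sum.
Qed.

Lemma smooth_on_rderiv U f j : copen U -> smooth_on U f ->
  smooth_on U (rderiv (e j) f).
Proof.
move=> oU sf k; have [sr si] := sf k.+1; split.
  rewrite (_ : re_part _ = 'D_(e j) (re_part f)); first exact: Ck_derive.
  by apply/funext => r; rewrite /re_part /rderiv r2cK.
rewrite (_ : im_part _ = 'D_(e j) (im_part f)); first exact: Ck_derive.
by apply/funext => r; rewrite /im_part /rderiv r2cK.
Qed.

Lemma rderiv_comm U f z i j : copen U -> smooth_on U f -> U z ->
  rderiv (e i) (rderiv (e j) f) z = rderiv (e j) (rderiv (e i) f) z.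
Proof.
move=> oU sf Uz; have [sr si] := sf 2%N.
have rE k : re_part (rderiv (e k) f) = 'D_(e k) (re_part f).
  by apply/funext => r; rewrite /re_part /rderiv r2cK.
have iE k : im_part (rderiv (e k) f) = 'D_(e k) (im_part f).
  by apply/funext => r; rewrite /im_part /rderiv r2cK.
rewrite [LHS]/rderiv [RHS]/rderiv !rE !iE.
have -> := Ck_schwarz i j oU sr (_ : (@r2c R n @^-1` U) (c2r z)); last by rewrite /= c2rK.
have -> // := Ck_schwarz i j oU si (_ : (@r2c R n @^-1` U) (c2r z)); by rewrite /= c2rK.
Qed.

End ComplexCalculus.

Lemma derive_lineE (R : realType) (V W : normedModType R) (f : V -> W) (x h : V) :
  'D_h f x = 'D_1 (fun t : R => f (t *: h + x)) 0.
Proof.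
rewrite /derive; set g1 := fun t => t^-1 *: _; set g2 := fun t => t^-1 *: _.
suff -> : g1 = g2 by [].
by apply/funext => t; rewrite /g1 /g2 /= addr0 scale0r add0r [t%:A]mulr1.
Qed.

(** The inner map is only derivable along h. Restricted to the line through x it is a differentiable
    function of one variable, and the outer one is totally differentiable by [C1_differentiable]. *)
Lemma is_derive_comp_C1 (R : realType) (N M : nat) (U : set 'rV[R]_M)
    (F : 'rV[R]_M -> R) (G : 'rV[R]_N -> 'rV[R]_M) (x h : 'rV[R]_N)
    (b : 'I_M -> R) :
  open U -> Ck 1 U F -> U (G x) ->
  (forall l, is_derive x h (fun y => G y 0 l) (b l)) ->
  is_derive x h (fun y => F (G y)) (\sum_l b l * 'D_(delta_mx 0 l) F (G x)).
Proof.
move=> oU CF UG dG.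
pose g (t : R) := G (t *: h + x).
have g0 : g 0 = G x by rewrite /g scale0r add0r.
have dGx : derivable G x h.
  by apply/derivable_mxP => i j; rewrite (ord1 i); have [] := dG j.
have dg1 : derivable g 0 1 by have /derivable1P := dGx.
have dg : differentiable g 0 by have /derivable1_diffP := dg1.
have [dF FE] := C1_differentiable oU CF UG.
have dFg0 : differentiable F (g 0) by rewrite g0.
have dFg : differentiable (F \o g) 0 by exact: differentiable_comp.
split; first by apply/derivable1P/derivable1_diffP.
rewrite derive_lineE [LHS](_ : _ = 'D_1 (F \o g) 0)// deriveE// diff_comp//.
rewrite [LHS](_ : _ = 'd F (g 0) ('d g 0 1))// -[in X in 'd F _ X]deriveE// -deriveE//.
rewrite g0 FE; apply: eq_bigr => l _; congr (_ * _).
have -> : 'D_1 g 0 = 'D_h G x by rewrite [RHS]derive_lineE.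
by rewrite (derive_mx dGx) mxE; have [_] := dG l.
Qed.

(** With c = 1/2, the imaginary unit for i gives the rule for [dzbar] and its opposite the rule for
    [dz]. *)
Lemma wirtinger_leibniz (K : comNzRingType) (c i x y a b a' b' : K) :
  c * ((x * a + y * a') + i * (x * b + y * b'))
  = x * (c * (a + i * b)) + y * (c * (a' + i * b')).
Proof. by ring. Qed.

Lemma wirtinger_add (K : comNzRingType) (c i a b a' b' : K) :
  c * ((a + b) + i * (a' + b')) = c * (a + i * a') + c * (b + i * b').
Proof. by ring. Qed.

Lemma wirtinger_scale (K : comNzRingType) (c i a a' b : K) :
  c * (a * b + i * (a' * b)) = c * (a + i * a') * b.
Proof. by ring. Qed.

Lemma wirtinger_holo (K : numFieldType) (i a : K) : i * i = -1 ->
  2^-1 * (a - i * (i * a)) = a.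
Proof. by move=> ii; rewrite mulrA ii; field. Qed.

(** * Wirtinger derivatives and holomorphic functions *)

Section Wirtinger.
Variables (R : realType) (n : nat).
Local Notation C := R[i].
Implicit Types (f g : 'rV[C]_n -> C) (U : set 'rV[C]_n) (z : 'rV[C]_n).
Local Notation e j := (delta_mx 0 j).

Definition holo1 U f := smooth_on U f /\ forall z l, U z -> dzbar l f z = 0.

(** The Cauchy-Riemann equations. They reduce [dz] to a real partial derivative, so that commutation
    of complex derivatives follows from that of real ones. *)
Lemma dzbar0E f z l : dzbar l f z = 0 ->
  rderiv (e (rshift n l)) f z = 'i%C * rderiv (e (lshift n l)) f z /\
  dz l f z = rderiv (e (lshift n l)) f z.
Proof.
move=> /eqP; rewrite /dzbar mulf_eq0 invr_eq0 pnatr_eq0 /= => /eqP.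
set a := rderiv _ _ _; set b := rderiv _ _ _ => ab.
have ii : 'i%C * 'i%C = -1 :> C by rewrite -expr2 sqr_i.
have bE : b = 'i%C * a.
  have : 'i%C * (a + 'i%C * b) = 0 by rewrite ab mulr0.
  by rewrite mulrDr mulrA ii mulN1r => /eqP; rewrite subr_eq0 => /eqP.
by split; rewrite // /dz -/a -/b bE; exact: wirtinger_holo.
Qed.

Lemma dz_ext U f g z k : copen U -> U z -> {in U, f =1 g} -> dz k f z = dz k g z.
Proof. by move=> oU Uz fg; rewrite /dz !(rderiv_ext _ oU Uz fg). Qed.

Lemma dzbar_ext U f g z k : copen U -> U z -> {in U, f =1 g} ->
  dzbar k f z = dzbar k g z.
Proof. by move=> oU Uz fg; rewrite /dzbar !(rderiv_ext _ oU Uz fg). Qed.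

Lemma dz_cst (c : C) z k : dz k (fun=> c) z = 0.
Proof. by rewrite /dz !rderiv_cst mulr0 subr0 mulr0. Qed.

Lemma dzbar_cst (c : C) z k : dzbar k (fun=> c) z = 0.
Proof. by rewrite /dzbar !rderiv_cst mulr0 addr0 mulr0. Qed.

Lemma dzM f g z k : cderivable f z -> cderivable g z ->
  dz k (fun z => f z * g z) z = f z * dz k g z + g z * dz k f z.
Proof. by move=> df dg; rewrite /dz !rderivM// -!mulNr wirtinger_leibniz. Qed.

Lemma dzbarM f g z k : cderivable f z -> cderivable g z ->
  dzbar k (fun z => f z * g z) z = f z * dzbar k g z + g z * dzbar k f z.
Proof. by move=> df dg; rewrite /dzbar !rderivM// wirtinger_leibniz. Qed.

Lemma dzbarD f g z k : cderivable f z -> cderivable g z ->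
  dzbar k (fun z => f z + g z) z = dzbar k f z + dzbar k g z.
Proof. by move=> df dg; rewrite /dzbar !rderivD// wirtinger_add. Qed.

Lemma dz_sum (I : Type) (r : seq I) (P : pred I)
    (F : I -> 'rV[C]_n -> C) z k : (forall i, cderivable (F i) z) ->
  dz k (fun z => \sum_(i <- r | P i) F i z) z = \sum_(i <- r | P i) dz k (F i) z.
Proof.
move=> dF; rewrite /dz !rderiv_sum// mulr_sumr -sumrB mulr_sumr.
by apply: eq_bigr.
Qed.

Lemma dzbar_sum (I : Type) (r : seq I) (P : pred I)
    (F : I -> 'rV[C]_n -> C) z k : (forall i, cderivable (F i) z) ->
  dzbar k (fun z => \sum_(i <- r | P i) F i z) z
  = \sum_(i <- r | P i) dzbar k (F i) z.
Proof.
move=> dF; rewrite /dzbar !rderiv_sum// mulr_sumr -big_split mulr_sumr.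
by apply: eq_bigr.
Qed.

Lemma smooth_on_dz U f k : copen U -> smooth_on U f -> smooth_on U (dz k f).
Proof.
move=> oU sf; apply: smooth_onM => //; first exact: smooth_on_cst.
apply: smooth_onD => //; first exact: smooth_on_rderiv.
rewrite (_ : (fun z => _) = fun z => (- 'i%C) * rderiv (e (rshift n k)) f z).
  by apply: smooth_onM => //; [exact: smooth_on_cst|exact: smooth_on_rderiv].
by apply/funext => z; rewrite mulNr.
Qed.

Lemma is_rderiv_coord z (l : 'I_n) (j : 'I_(n + n)) :
  is_rderiv j (fun z => z 0 l) z (r2c (e j) 0 l).
Proof.
have D (k j' : 'I_(n + n)) (r : 'rV[R]_(n + n)) :
    is_derive r (e j') (fun r : 'rV[R]_(n + n) => r 0 k)
      ((e j' : 'rV[R]_(n + n)) 0 k).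
  have df : differentiable (fun r : 'rV[R]_(n + n) => r 0 k) r.
    exact: differentiable_coord.
  split; first exact: diff_derivable.
  apply/cvg_lim => //; apply: cvg_near_cst; near=> t; rewrite /= !mxE addrK.
  rewrite /GRing.scale/= mulrA mulVf ?mul1r//; near: t; exact: nbhs_dnbhs_neq.
have rE : re_part (fun z => z 0 l) = fun r => r 0 (lshift n l).
  by apply/funext => r; rewrite /re_part mxE.
have iE : im_part (fun z => z 0 l) = fun r => r 0 (rshift n l).
  by apply/funext => r; rewrite /im_part mxE.
rewrite /is_rderiv rE iE; split.
  by have := D (lshift n l) j (c2r z);
    rewrite [complex.Re _](_ : _ = (e j : 'rV[R]_(n + n)) 0 (lshift n l))// mxE.
by have := D (rshift n l) j (c2r z);
  rewrite [complex.Im _](_ : _ = (e j : 'rV[R]_(n + n)) 0 (rshift n l))// mxE.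
Unshelve. all: by end_near. Qed.

Lemma cderivable_coord z (l : 'I_n) : cderivable (fun z => z 0 l) z.
Proof. exact/is_rderiv_cderivable/is_rderiv_coord. Qed.

Lemma dz_coord z (l k : 'I_n) : dz k (fun z => z 0 l) z = (k == l)%:R.
Proof.
rewrite /dz !(is_rderivE (is_rderiv_coord _ _ _)) !mxE !eqxx /=.
rewrite !eq_lshift !eq_rshift eq_rlshift eq_lrshift /= [l == k]eq_sym.
case: (k == l) => /=; last by simpc.
rewrite mulrC; apply/(canLR (mulfK _)); first by rewrite pnatr_eq0.
by rewrite mul1r mulrC -[(0 +i* 1)%C]/'i%C -expr2 sqr_i opprK.
Qed.

(** On U the function [dz k f] is the derivative of f in the k-th real direction, which commutes
    with [dzbar l] by Schwarz's theorem. *)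
Lemma holo1_dz U f k : copen U -> holo1 U f -> holo1 U (dz k f).
Proof.
move=> oU [sf hf]; split; first exact: smooth_on_dz.
move=> z l Uz.
rewrite (@dzbar_ext U _ (rderiv (e (lshift n k)) f))//; last first.
  by move=> y; rewrite inE => Uy; have [_] := dzbar0E (hf _ k Uy).
rewrite /dzbar (rderiv_comm (lshift n l) (lshift n k) oU sf Uz).
rewrite (rderiv_comm (rshift n l) (lshift n k) oU sf Uz).
have sd j : cderivable (rderiv (e j) f) z.
  by apply: smooth_on_cderivable Uz; exact: smooth_on_rderiv.
(* Differentiate the equation [dzbar l f] = 0, valid on all of U, in the k-th real direction. *)
have := rderiv_ext (e (lshift n k)) oU Uz
  (_ : {in U, (fun y => rderiv (e (lshift n l)) f y
       + 'i%C * rderiv (e (rshift n l)) f y) =1 fun=> 0}).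
rewrite rderivD//; last by apply: cderivableM => //; exact: cderivable_cst.
rewrite rderivM//; last exact: cderivable_cst.
rewrite !rderiv_cst mulr0 addr0 => ->; first by rewrite mulr0.
move=> y; rewrite inE => Uy; have := hf _ l Uy => /eqP.
by rewrite /dzbar mulf_eq0 invr_eq0 pnatr_eq0 /= => /eqP.
Qed.

Lemma holo1_dz_comm U f z k l : copen U -> holo1 U f -> U z ->
  dz k (dz l f) z = dz l (dz k f) z.
Proof.
move=> oU hf Uz.
have E i j : dz i (dz j f) z = rderiv (e (lshift n i)) (rderiv (e (lshift n j)) f) z.
  have [_ hj] := holo1_dz j oU hf.
  have [_ ->] := dzbar0E (hj _ i Uz).
  apply: (rderiv_ext _ oU Uz) => y; rewrite inE => Uy.
  by have [_] := dzbar0E (hf.2 _ j Uy).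
by rewrite !E; apply: rderiv_comm Uz => //; case: hf.
Qed.

End Wirtinger.

(** * The chain rule for a holomorphic outer function *)

Section ChainRule.
Variables (R : realType) (p n : nat).
Local Notation C := R[i].

(** By Cauchy-Riemann the derivatives of f in the real and imaginary directions of the l-th
    coordinate combine into complex multiplication by [dz l f]. *)
Lemma is_rderiv_comp (U : set 'rV[C]_n) (f : 'rV[C]_n -> C)
    (g : 'rV[C]_p -> 'rV[C]_n) (z : 'rV[C]_p) (j : 'I_(p + p)) (b : 'I_n -> C) :
  copen U -> holo1 U f -> U (g z) ->
  (forall l, is_rderiv j (fun z => g z 0 l) z (b l)) ->
  is_rderiv j (fun z => f (g z)) z (\sum_l b l * dz l f (g z)).
Proof.
move=> oU [sf hf] Ug dg.
pose G (r : 'rV[R]_(p + p)) := c2r (g (r2c r)).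
pose b' (k : 'I_(n + n)) := match fintype.split k with
   | inl l => complex.Re (b l) | inr l => complex.Im (b l) end.
have dG k : is_derive (c2r z) (delta_mx 0 j) (fun y => G y 0 k) (b' k).
  rewrite /b'; case: splitP => l kl.
    rewrite (_ : (fun y => _) = re_part (fun z => g z 0 l)); first by have [] := dg l.
    apply/funext => r; rewrite /G /c2r (_ : k = lshift n l); last exact/val_inj.
    by rewrite row_mxEl mxE.
  rewrite (_ : (fun y => _) = im_part (fun z => g z 0 l)); first by have [] := dg l.
  apply/funext => r; rewrite /G /c2r (_ : k = rshift n l); last exact/val_inj.
  by rewrite row_mxEr mxE.
have [sr si] := sf 1%N.
have UG : (@r2c R n @^-1` U) (G (c2r z)) by rewrite /G /= !c2rK.
have rE : re_part (fun z => f (g z)) = fun r => re_part f (G r).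
  by apply/funext => r; rewrite /re_part /G c2rK.
have iE : im_part (fun z => f (g z)) = fun r => im_part f (G r).
  by apply/funext => r; rewrite /im_part /G c2rK.
have GE : G (c2r z) = c2r (g z) by rewrite /G c2rK.
have dr := is_derive_comp_C1 oU sr UG dG.
have di := is_derive_comp_C1 oU si UG dG.
have splitl l : fintype.split (lshift n l) = inl l by exact: (unsplitK (inl l)).
have splitr l : fintype.split (rshift n l) = inr l by exact: (unsplitK (inr l)).
have ReS (F : 'I_n -> C) : complex.Re (\sum_l F l) = \sum_l complex.Re (F l).
  by rewrite (big_morph (@complex.Re R) (id1 := 0) (op1 := +%R))// => -[? ?] [? ?].
have ImS (F : 'I_n -> C) : complex.Im (\sum_l F l) = \sum_l complex.Im (F l).
  by rewrite (big_morph (@complex.Im R) (id1 := 0) (op1 := +%R))// => -[? ?] [? ?].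
split.
  rewrite rE; apply: is_derive_eq dr _.
  rewrite big_split_ord /= ReS -big_split; apply: eq_bigr => l _ /=.
  rewrite /b' splitl splitr GE; have [] := dzbar0E (hf _ l Ug).
  rewrite /rderiv => + -> => -[-> _]; case: (b l) => b1 b2 /=; ring.
rewrite iE; apply: is_derive_eq di _.
rewrite big_split_ord /= ImS -big_split; apply: eq_bigr => l _ /=.
rewrite /b' splitl splitr GE; have [] := dzbar0E (hf _ l Ug).
rewrite /rderiv => + -> => -[_ ->]; case: (b l) => b1 b2 /=; ring.
Qed.

Lemma cderivable_comp (U : set 'rV[C]_n) (f : 'rV[C]_n -> C)
    (g : 'rV[C]_p -> 'rV[C]_n) (z : 'rV[C]_p) :
  copen U -> holo1 U f -> U (g z) -> (forall l, cderivable (fun z => g z 0 l) z) ->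
  cderivable (fun z => f (g z)) z.
Proof.
move=> oU hf Ug dg; apply: is_rderiv_cderivable => j.
by apply: (is_rderiv_comp oU hf Ug) => l; exact: dg.
Qed.

Lemma dz_comp (U : set 'rV[C]_n) (f : 'rV[C]_n -> C)
    (g : 'rV[C]_p -> 'rV[C]_n) (z : 'rV[C]_p) k :
  copen U -> holo1 U f -> U (g z) -> (forall l, cderivable (fun z => g z 0 l) z) ->
  dz k (fun z => f (g z)) z = \sum_l dz k (fun z => g z 0 l) z * dz l f (g z).
Proof.
move=> oU hf Ug dg; rewrite /dz.
rewrite !(is_rderivE (is_rderiv_comp oU hf Ug (fun l => dg l _))).
rewrite mulr_sumr -sumrB mulr_sumr; apply: eq_bigr => l _.
by rewrite -/(dz l f (g z)) -!mulNr wirtinger_scale.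
Qed.

End ChainRule.

(** * Polynomials with values in a commutative algebra *)

Local Notation mvar K i := (mpolyX K (mnm1 i)).

Lemma mpoly_gen_ind (K : comNzRingType) (n : nat) (P : mpoly n K -> Prop) :
  (forall c, P (mpolyC n c)) -> (forall i, P (mvar K i)) ->
  (forall p q, P p -> P q -> P (p + q)) ->
  (forall p q, P p -> P q -> P (p * q)) -> forall p, P p.
Proof.
move=> PC PX PD PM p; rewrite (mpolyE p).
elim/big_ind: _ => [||m _]; [by rewrite -(mpolyC0 n) |exact: PD|].
rewrite -mul_mpolyC; apply: (PM) => //; rewrite mpolyXE_id.
elim/big_ind: _ => [||i _]; [by rewrite -(mpolyC1 n) |exact: PM|].
elim: (m i) => [|k IH]; first by rewrite expr0 -(mpolyC1 n).
by rewrite exprS; exact: PM.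
Qed.

Section PolynomialEvaluation.
Variables (K : comNzRingType) (B : comAlgType K) (n : nat).
Implicit Types (p q : mpoly n K) (V : 'I_n -> B).

(** A scalar polynomial at a point with coordinates in B; for the coordinates of Theta this is
    p(Theta). *)
Definition aeval V p : B := mmap (GRing.in_alg B) V p.

Lemma aevalC V c : aeval V (mpolyC n c) = c%:A.
Proof. exact: mmapC. Qed.

Lemma aevalX V i : aeval V (mvar K i) = V i.
Proof. by rewrite /aeval mmapX mmap1U. Qed.

Lemma aevalD V p q : aeval V (p + q) = aeval V p + aeval V q.
Proof. exact: mmapD. Qed.

Lemma aevalM V p q : aeval V (p * q) = aeval V p * aeval V q.
Proof. exact: (rmorphM (mmap (GRing.in_alg B) V)). Qed.

Lemma aeval0 V : aeval V 0 = 0. Proof. exact: mmap0. Qed.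

Lemma aeval_sum V (I : Type) (r : seq I) (P : pred I) (F : I -> mpoly n K) :
  aeval V (\sum_(i <- r | P i) F i) = \sum_(i <- r | P i) aeval V (F i).
Proof. exact: (big_morph (aeval V) (aevalD V) (aeval0 V)). Qed.

Lemma eq_aeval V V' p : V =1 V' -> aeval V p = aeval V' p.
Proof. by move=> VV'; congr (aeval _ p); exact/funext. Qed.

Lemma aeval_comp (k : nat) (lq : k.-tuple (mpoly n K)) (p : mpoly k K) V :
  aeval V (comp_mpoly lq p) = mmap (GRing.in_alg B) (fun i => aeval V (tnth lq i)) p.
Proof.
elim/mpoly_gen_ind: p => [c|i|p q IHp IHq|p q IHp IHq].
- by rewrite comp_mpolyC aevalC mmapC.
- by rewrite comp_mpolyXU mmapX mmap1U -tnth_nth.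
- by rewrite comp_mpolyD aevalD mmapD IHp IHq.
- by rewrite rmorphM/= aevalM IHp IHq rmorphM.
Qed.

(** Modulo the annihilator of x the point V is the scalar point v, hence p(V) is p(v). With x = eps
    this replaces Theta by theta. *)
Lemma aeval_annihilated (x : B) (v : 'I_n -> K) V p :
  (forall i, x * V i = v i *: x) -> x * aeval V p = meval v p *: x.
Proof.
move=> xV; elim/mpoly_gen_ind: p => [c|i|p q IHp IHq|p q IHp IHq].
- by rewrite aevalC mevalC mulr_algr.
- by rewrite aevalX mevalXU.
- by rewrite aevalD mevalD mulrDr IHp IHq scalerDl.
- by rewrite aevalM mevalM mulrA IHp -scalerAl IHq scalerA.
Qed.

End PolynomialEvaluation.

(** * Polynomials determined by their values; derivatives along lines *)

Section VanishingPolynomial.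
Variables (K : numFieldType) (n : nat).
Implicit Types (p q : mpoly n K) (v : 'I_n -> K).

(** In characteristic zero the integers 0, ..., [size P] - 1 are distinct, which is one root more
    than the degree allows. *)
Lemma poly_eq0_horner (P : {poly K}) : (forall t, P.[t] = 0) -> P = 0.
Proof.
move=> P0; apply/eqP; apply/negPn/negP => Pn0.
have := @max_poly_roots K P [seq i%:R | i <- iota 0 (size P)] Pn0.
rewrite size_map size_iota ltnn => H; apply/notF/H.
  by apply/allP => t _; rewrite rootE P0.
rewrite map_inj_uniq ?iota_uniq// => i j /eqP; rewrite eqr_nat => /eqP //.
Qed.

(** p restricted to t |-> v + t w, as a polynomial in t, so that directional derivatives are formal
    ones. *)
Definition on_line v w p : {poly K} :=
  mmap polyC (fun i => (v i)%:P + w i *: 'X) p.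

Lemma on_lineD v w p q : on_line v w (p + q) = on_line v w p + on_line v w q.
Proof. exact: mmapD. Qed.

Lemma on_lineM v w p q : on_line v w (p * q) = on_line v w p * on_line v w q.
Proof. exact: (rmorphM (mmap polyC _)). Qed.

Lemma horner_on_line v w p t :
  (on_line v w p).[t] = meval (fun i => v i + w i * t) p.
Proof.
elim/mpoly_gen_ind: p => [c|i|p q IHp IHq|p q IHp IHq].
- by rewrite /on_line mmapC hornerC mevalC.
- by rewrite /on_line mmapX mmap1U mevalXU hornerD hornerC hornerZ hornerX.
- by rewrite on_lineD hornerD mevalD IHp IHq.
- by rewrite on_lineM hornerM mevalM IHp IHq.
Qed.

Lemma deriv_on_line v w p :
  (on_line v w p)^`() = \sum_j w j *: on_line v w (mderiv j p).
Proof.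
elim/mpoly_gen_ind: p => [c|i|p q IHp IHq|p q IHp IHq].
- rewrite /on_line mmapC derivC big1// => j _.
  by rewrite mderivC mmap0 scaler0.
- rewrite /on_line mmapX mmap1U derivD derivC derivZ derivX add0r (bigD1 i)//=.
  rewrite big1 ?addr0 => [|j ji].
    rewrite mderivX mmapZ mmapX mnm1E eqxx mul1r.
    rewrite (_ : mnm_sub _ _ = @mnm0 n) ?mmap11//.
    by apply/mnmP => k; rewrite mnmBE mnm0E subnn.
  by rewrite mderivX mnm1E eq_sym (negPf ji) scale0r mmap0 scaler0.
- rewrite on_lineD derivD IHp IHq -big_split; apply: eq_bigr => j _.
  by rewrite mderivD on_lineD scalerDr.
- rewrite on_lineM derivM IHp IHq mulr_suml mulr_sumr -big_split.
  apply: eq_bigr => j _ /=.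
  by rewrite mderivM on_lineD !on_lineM scalerDr scalerAl scalerAr.
Qed.

Lemma deriv0_on_line v w p :
  ((on_line v w p)^`()).[0] = \sum_j w j * meval v (mderiv j p).
Proof.
rewrite deriv_on_line -horner_evalE raddf_sum; apply: eq_bigr => j _ /=.
rewrite horner_evalE hornerZ horner_on_line; congr (_ * _).
by apply: meval_eq => i; rewrite mulr0 addr0.
Qed.

(** On the line through v in the j-th direction, p is a polynomial in t with all values zero, so its
    formal derivative vanishes too. *)
Lemma meval_mderiv_eq0 p j : (forall v, meval v p = 0) ->
  forall v, meval v (mderiv j p) = 0.
Proof.
move=> p0 v; have l0 : on_line v (fun i => (j == i)%:R) p = 0.
  by apply: poly_eq0_horner => t; rewrite horner_on_line.
have := deriv0_on_line v (fun i => (j == i)%:R) p.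
rewrite l0 deriv0 horner0 (bigD1 j)//= eqxx mul1r big1 ?addr0// => i ij.
by rewrite eq_sym (negPf ij) mul0r.
Qed.

Lemma meval_fun0 p : meval (fun=> 0) p = mcoeff (@mnm0 n) p.
Proof.
rewrite mevalE [in RHS](mpolyE p) raddf_sum; apply: eq_bigr => m _ /=.
rewrite mcoeffZ mcoeffX; congr (_ * _); have [->|] := eqVneq m (@mnm0 n).
  by rewrite big1// => i _; rewrite mnm0E expr0.
move=> m0; have [i mi] : exists i, m i != 0%N.
  apply/existsP; apply: contraNT m0; rewrite negb_exists => /forallP m0.
  by apply/eqP/mnmP => i; rewrite mnm0E; apply/eqP; have := m0 i; rewrite negbK.
by rewrite (bigD1 i)//= expr0n (negPf mi) mul0r.
Qed.

(** Taylor's formula: all iterated derivatives of p vanish everywhere, and the one of multi-index m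
    at the origin is the coefficient at m times the nonzero factor m!. *)
Lemma mpoly_eq0_meval p : (forall v, meval v p = 0) -> p = 0.
Proof.
move=> p0; apply/mpolyP => m; rewrite mcoeff0.
have : meval (fun=> 0) (mderivm m p) = 0.
  rewrite mderivm_foldr; set s := flatten _.
  suff: forall v, meval v (foldr (fun i => mderiv i) p s) = 0 by exact.
  by elim: s => [|j r IH] //=; exact: meval_mderiv_eq0.
rewrite meval_fun0 mcoeff_mderivm addm0 => /eqP; rewrite mulrn_eq0 => /orP[|/eqP//].
rewrite -leqn0 leqNgt prodn_gt0// => i; first by rewrite ffactnn fact_gt0.
Qed.

End VanishingPolynomial.

(** * The Lie algebra in the chart at the identity *)

Section Charts.
Variables (R : realType) (n : nat) (X : complexManifold R n).
Local Notation C := R[i].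

Lemma chart_img_open i (A : set X) : open A -> A `<=` chart_dom X i ->
  copen (chart X i @` A).
Proof. by move=> oA Ai; have [+ _] := chart_homeo Ai; exact. Qed.

Lemma chart_dom_open i : copen (chart X i @` chart_dom X i).
Proof. by apply: chart_img_open => //; exact: chart_open. Qed.

Lemma chart_preimg_open i (A : set X) : open A ->
  copen (chart X i @` (chart_dom X i `&` A)).
Proof.
move=> oA; apply: chart_img_open; last by move=> x [].
by apply: openI => //; exact: chart_open.
Qed.

End Charts.

Lemma copen_local (R : realType) (N : nat) (U : set 'rV[R[i]]_N) :
  (forall z, U z -> exists V, [/\ copen V, V z & V `<=` U]) -> copen U.
Proof.
move=> loc; rewrite /copen openE => r /= Ur.
have [V [oV Vr VU]] := loc _ Ur.
rewrite /interior nbhsE; exists (@r2c R N @^-1` V); first by split.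
by move=> s; exact: VU.
Qed.

(** * Open subsets of C^p x C^q *)

Section ProductOpen.
Variables (R : realType) (p q : nat).
Local Notation C := R[i].

Lemma contraction_continuous (K : numFieldType) (V W : normedModType K)
    (f : V -> W) : (forall x y, `|f x - f y| <= `|x - y|) -> continuous f.
Proof.
move=> fxy x; apply/cvgrPdist_lt => e e0; apply/nbhs_ballP; exists e => //= y.
by rewrite -ball_normE /=; exact: le_lt_trans.
Qed.

Lemma continuous_reindex (N M : nat) (s : 'I_M -> 'I_N) :
  continuous ((fun r => \row_k r 0 (s k)) : 'rV[R]_N -> 'rV[R]_M).
Proof.
apply: contraction_continuous => r r'; apply: mx_norm_leP => // k; rewrite !mxE.
by have := mx_norm_coord (r - r') (s k); rewrite !mxE.
Qed.

(** In R^(2(p+q)) all real parts precede all imaginary parts, so the projections to the two factors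
    are the reindexings [sl] and [sr] and not block projections. *)
Lemma copen_prod (U : set 'rV[C]_p) (W : set 'rV[C]_q) : copen U -> copen W ->
  copen [set z : 'rV[C]_(p + q) | U (lsubmx z) /\ W (rsubmx z)].
Proof.
move=> oU oW.
pose sl (k : 'I_(p + p)) : 'I_((p + q) + (p + q)) := match fintype.split k with
  | inl l => lshift _ (lshift q l) | inr l => rshift _ (lshift q l) end.
pose sr (k : 'I_(q + q)) : 'I_((p + q) + (p + q)) := match fintype.split k with
  | inl l => lshift _ (rshift p l) | inr l => rshift _ (rshift p l) end.
have cl := continuous_reindex (s := sl).
have cr := continuous_reindex (s := sr).
have spl m (l : 'I_m) : fintype.split (lshift m l) = inl l by exact: (unsplitK (inl l)).
have spr m (l : 'I_m) : fintype.split (rshift m l) = inr l by exact: (unsplitK (inr l)).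
have E : @r2c R (p + q) @^-1` [set z : 'rV[C]_(p + q) | U (lsubmx z) /\ W (rsubmx z)]
  = ((fun r : 'rV[R]_((p + q) + (p + q)) => \row_k r 0 (sl k)) @^-1` (@r2c R p @^-1` U))
   `&` ((fun r : 'rV[R]_((p + q) + (p + q)) => \row_k r 0 (sr k)) @^-1` (@r2c R q @^-1` W)).
  apply/funext => r /=; congr (U _ /\ W _).
    by apply/rowP => k; rewrite !mxE /sl spl spr.
  by apply/rowP => k; rewrite !mxE /sr spl spr.
rewrite /copen E; apply: openI.
  by apply: open_comp => // r _; exact: cl.
by apply: open_comp => // r _; exact: cr.
Qed.

End ProductOpen.

(** * Multiplication and inverse near the identity *)

Section LieGroup.
Variables (R : realType) (m : nat) (G : complexLieGroup R m).
Local Notation C := R[i].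
Local Notation dom := (chart_dom G (echart G)).
Local Notation ch := (chart G (echart G)).
Local Notation inv := (chart_inv G (echart G)).
Local Notation a := (ch (gone G)).

Lemma echart_dom : dom (gone G).
Proof. by rewrite /echart; case: cid. Qed.

Lemma ginv1 : ginv G (gone G) = gone G.
Proof. by rewrite -[LHS]g1mul gmulV. Qed.

(** Spelled as the domain in [holomorphic2] for A = [setT] and the chart at e in all three places,
    hence the conjunct [True]; [inv_set] follows [holomorphic] in the same way. *)
Definition mul_dom : set 'rV[C]_(m + m) :=
  [set z | exists (x y : G), [/\ True, dom x, dom y, dom (gmul G x y)
     & z = row_mx (ch x) (ch y)]].

Definition mul_loc (k : 'I_m) (z : 'rV[C]_(m + m)) : C :=
  ch (gmul G (inv (lsubmx z)) (inv (rsubmx z))) 0 k.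

Lemma mul_loc_holo k : holo1 mul_dom (mul_loc k).
Proof.
have [_ /(_ (echart G) (echart G) (echart G) k)[sm hm]] := gmul_holo G.
by split => // z l; exact: hm.
Qed.

Lemma gmul_nbhs (x y : G) (D : set G) : open D -> D (gmul G x y) ->
  exists A B : set G, [/\ open A, open B, A x, B y &
    forall u v, A u -> B v -> D (gmul G u v)].
Proof.
move=> oD Dxy.
have [+ _] := gmul_holo G => /(_ x y I) cxy.
have : nbhs (gmul G x y) D by exact: open_nbhs_nbhs.
move=> /cxy [[A B] /= [nA nB] AB].
move: nA nB; rewrite !nbhsE => -[A' [oA A'x] A'A] [B' [oB B'y] B'B].
exists A', B'; split => // u v A'u B'v.
by apply: (AB (u, v)); split; [exact: A'A|exact: B'B].
Qed.

Lemma mul_dom_open : copen mul_dom.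
Proof.
apply: copen_local => z [x [y [_ dx dy dxy ->]]].
have [A [B [oA oB Ax By AB]]] := gmul_nbhs (chart_open (echart G)) dxy.
exists [set z | (ch @` (dom `&` A)) (lsubmx z) /\ (ch @` (dom `&` B)) (rsubmx z)].
split; first by apply: copen_prod; exact: chart_preimg_open.
  by rewrite /= row_mxKl row_mxKr; split; [exists x|exists y].
move=> w /= [[u [du Au] uw] [v [dv Bv] vw]]; exists u, v; split => //.
  exact: AB.
by rewrite uw vw hsubmxK.
Qed.

Lemma mul_dom_row (x y : G) : dom x -> dom y -> dom (gmul G x y) ->
  mul_dom (row_mx (ch x) (ch y)).
Proof. by move=> dx dy dxy; exists x, y; split. Qed.

Lemma mul_locE k (x y : G) : dom x -> dom y ->
  mul_loc k (row_mx (ch x) (ch y)) = ch (gmul G x y) 0 k.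
Proof. by move=> dx dy; rewrite /mul_loc row_mxKl row_mxKr !chartK. Qed.

Definition inv_set : set 'rV[C]_m :=
  ch @` (dom `&` setT `&` ginv G @^-1` dom).

Definition inv_loc (k : 'I_m) (z : 'rV[C]_m) : C := ch (ginv G (inv z)) 0 k.

Lemma inv_loc_holo k : holo1 inv_set (inv_loc k).
Proof.
have [_ /(_ (echart G) (echart G) k)[si hi]] := ginv_holo G.
by split => // z l; exact: hi.
Qed.

Lemma inv_set_open : copen inv_set.
Proof.
apply: chart_img_open; last by move=> x [[]].
apply: openI; first by apply: openI; [exact: chart_open|exact: openT].
apply: open_comp; last exact: chart_open.
by move=> x _; have [+ _] := ginv_holo G; exact.
Qed.

Lemma inv_set1 : inv_set a.
Proof. by exists (gone G) => //; split; [split => //|rewrite /= ginv1]; exact: echart_dom. Qed.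

Lemma inv_setP z : inv_set z -> [/\ dom (inv z), dom (ginv G (inv z)) & ch (inv z) = z].
Proof. by move=> [x [[dx _] dix] <-]; rewrite chartK. Qed.

(** [d1] and [d2] are the matrix entries of the differential of the multiplication in its left and
    in its right factor. *)
Definition d1 (l k : 'I_m) : 'rV[C]_(m + m) -> C := dz (lshift m l) (mul_loc k).
Definition d2 (l k : 'I_m) : 'rV[C]_(m + m) -> C := dz (rshift m l) (mul_loc k).

Lemma d1_holo l k : holo1 mul_dom (d1 l k).
Proof. by apply: holo1_dz; [exact: mul_dom_open|exact: mul_loc_holo]. Qed.

Lemma d2_holo l k : holo1 mul_dom (d2 l k).
Proof. by apply: holo1_dz; [exact: mul_dom_open|exact: mul_loc_holo]. Qed.

End LieGroup.

(** * The adjoint action in coordinates and the structure constants *)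

Section LieBracket.
Variables (R : realType) (m : nat) (G : complexLieGroup R m).
Local Notation C := R[i].
Local Notation dom := (chart_dom G (echart G)).
Local Notation ch := (chart G (echart G)).
Local Notation inv := (chart_inv G (echart G)).
Local Notation a := (ch (gone G)).
Local Notation mul_loc := (mul_loc G).
Local Notation d1 := (d1 G).
Local Notation d2 := (d2 G).

Lemma cderivable_row_mx (n p : nat) (g h : 'rV[C]_n -> 'rV[C]_p) (z : 'rV[C]_n) :
  (forall l, cderivable (fun z => g z 0 l) z) ->
  (forall l, cderivable (fun z => h z 0 l) z) ->
  forall l, cderivable (fun z => row_mx (g z) (h z) 0 l) z.
Proof.
move=> dg dh l; case: (split_ordP l) => j ->.
  have -> : (fun z => row_mx (g z) (h z) 0 (lshift p j)) = (fun z => g z 0 j).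
    by apply/funext => y; rewrite row_mxEl.
  exact: dg.
have -> : (fun z => row_mx (g z) (h z) 0 (rshift p j)) = (fun z => h z 0 j).
  by apply/funext => y; rewrite row_mxEr.
exact: dh.
Qed.

Lemma dz_row_mx (n p : nat) (U : set 'rV[C]_(p + p)) (f : 'rV[C]_(p + p) -> C)
    (g h : 'rV[C]_n -> 'rV[C]_p) (z : 'rV[C]_n) k :
  copen U -> holo1 U f -> U (row_mx (g z) (h z)) ->
  (forall l, cderivable (fun z => g z 0 l) z) ->
  (forall l, cderivable (fun z => h z 0 l) z) ->
  dz k (fun z => f (row_mx (g z) (h z))) z =
  \sum_l dz k (fun z => g z 0 l) z * dz (lshift p l) f (row_mx (g z) (h z)) +
  \sum_l dz k (fun z => h z 0 l) z * dz (rshift p l) f (row_mx (g z) (h z)).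
Proof.
move=> oU hf Uz dg dh.
rewrite (dz_comp (g := fun z => row_mx (g z) (h z)) k oU hf Uz); last first.
  exact: cderivable_row_mx.
rewrite big_split_ord; apply: (congr2 +%R); apply: eq_bigr => l _;
  apply: (congr1 (fun F => dz k F z * _)); apply/funext => y.
  exact: row_mxEl.
exact: row_mxEr.
Qed.

Lemma sum_delta (n : nat) (k : 'I_n) (F : 'I_n -> C) :
  \sum_l (k == l)%:R * F l = F k.
Proof.
rewrite (bigD1 k)//= eqxx mul1r big1 ?addr0// => l lk.
by rewrite eq_sym (negPf lk) mul0r.
Qed.

Lemma sum_dz_coord (n : nat) (z : 'rV[C]_n) (k : 'I_n) (F : 'I_n -> C) :
  \sum_l dz k (fun z => z 0 l) z * F l = F k.
Proof. by under eq_bigr do rewrite dz_coord; exact: sum_delta. Qed.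

Lemma sum_dz_cst (n p : nat) (z : 'rV[C]_n) (k : 'I_n) (w : 'rV[C]_p) (F : 'I_p -> C) :
  \sum_l dz k (fun=> w 0 l) z * F l = 0.
Proof. by apply: big1 => l _; rewrite dz_cst mul0r. Qed.

Lemma chart_img1 : (ch @` dom) a.
Proof. by exists (gone G) => //; exact: echart_dom. Qed.

Lemma echart_img_open : copen (ch @` dom).
Proof. exact: chart_dom_open. Qed.

Lemma mul_dom_r1 z : (ch @` dom) z -> mul_dom G (row_mx z a).
Proof.
by move=> [x dx <-]; apply: mul_dom_row; rewrite ?gmul1//; exact: echart_dom.
Qed.

Lemma mul_dom_l1 z : (ch @` dom) z -> mul_dom G (row_mx a z).
Proof.
by move=> [x dx <-]; apply: mul_dom_row; rewrite ?g1mul//; exact: echart_dom.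
Qed.

Lemma mul_loc_r1 k z : (ch @` dom) z -> mul_loc k (row_mx z a) = z 0 k.
Proof. by move=> [x dx <-]; rewrite mul_locE ?gmul1//; exact: echart_dom. Qed.

Lemma mul_loc_l1 k z : (ch @` dom) z -> mul_loc k (row_mx a z) = z 0 k.
Proof. by move=> [x dx <-]; rewrite mul_locE ?g1mul//; exact: echart_dom. Qed.

Lemma dz_row_l (U : set 'rV[C]_(m + m)) f (w z : 'rV[C]_m) k :
  copen U -> holo1 U f -> U (row_mx z w) ->
  dz k (fun z => f (row_mx z w)) z = dz (lshift m k) f (row_mx z w).
Proof.
move=> oU hf Uz; rewrite (dz_row_mx (g := id) (h := fun=> w) k oU hf)//; last 2 first.
- by move=> l; exact: cderivable_coord.
- by move=> l; exact: cderivable_cst.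
by rewrite [X in X + _]sum_dz_coord [X in _ + X]sum_dz_cst addr0.
Qed.

Lemma dz_row_r (U : set 'rV[C]_(m + m)) f (w z : 'rV[C]_m) k :
  copen U -> holo1 U f -> U (row_mx w z) ->
  dz k (fun z => f (row_mx w z)) z = dz (rshift m k) f (row_mx w z).
Proof.
move=> oU hf Uz; rewrite (dz_row_mx (g := fun=> w) (h := id) k oU hf)//; last 2 first.
- by move=> l; exact: cderivable_cst.
- by move=> l; exact: cderivable_coord.
by rewrite [X in X + _]sum_dz_cst [X in _ + X]sum_dz_coord add0r.
Qed.

(** Right multiplication by e is the identity, hence so is its differential; [a] is the coordinate
    vector of e. *)
Lemma d1_r1 l k z : (ch @` dom) z -> d1 l k (row_mx z a) = (l == k)%:R.
Proof.
move=> Uz; rewrite /d1 -(dz_row_l _ (@mul_dom_open _ _ G) (mul_loc_holo G k)).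
  rewrite -(dz_coord z k l).
  apply: (dz_ext _ echart_img_open Uz) => y; rewrite inE => Uy.
  exact: mul_loc_r1.
exact: mul_dom_r1.
Qed.

Lemma d2_l1 l k z : (ch @` dom) z -> d2 l k (row_mx a z) = (l == k)%:R.
Proof.
move=> Uz; rewrite /d2 -(dz_row_r _ (@mul_dom_open _ _ G) (mul_loc_holo G k)).
  rewrite -(dz_coord z k l).
  apply: (dz_ext _ echart_img_open Uz) => y; rewrite inE => Uy.
  exact: mul_loc_l1.
exact: mul_dom_l1.
Qed.

(** [d1] is constant along the points (z, e). This removes the pure second derivatives of the
    multiplication from the bracket. *)
Lemma d1d1_11 b l k : dz (lshift m b) (d1 l k) (row_mx a a : 'rV[C]_(m + m)) = 0.
Proof.
rewrite -(dz_row_l _ (@mul_dom_open _ _ G) (d1_holo G l k)).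
  rewrite -[RHS](dz_cst (l == k)%:R a b).
  apply: (dz_ext _ echart_img_open chart_img1) => y; rewrite inE => Uy.
  exact: d1_r1.
exact/mul_dom_r1/chart_img1.
Qed.

Definition inv_row (z : 'rV[C]_m) : 'rV[C]_m := ch (ginv G (inv z)).

Lemma inv_row1 : inv_row a = a.
Proof. by rewrite /inv_row chartK ?ginv1//; exact: echart_dom. Qed.

Lemma mul_dom_inv z : inv_set G z -> mul_dom G (row_mx z (inv_row z)).
Proof.
move=> /inv_setP[dz' diz zE]; rewrite -{1}zE; apply: mul_dom_row => //.
by rewrite gmulV; exact: echart_dom.
Qed.

Lemma mul_loc_inv k z : inv_set G z -> mul_loc k (row_mx z (inv_row z)) = a 0 k.
Proof.
by move=> /inv_setP[dz' diz zE]; rewrite -{1}zE mul_locE// gmulV.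
Qed.

Lemma cderivable_inv_row z l : inv_set G z -> cderivable (fun z => inv_row z 0 l) z.
Proof. by move=> iz; apply: smooth_on_cderivable iz; case: (inv_loc_holo G l). Qed.

(** Differentiate z z^-1 = e at e, where both partial differentials of the multiplication are the
    identity. *)
Lemma dz_inv_row1 b k : dz b (fun z => inv_row z 0 k) a = - (b == k)%:R.
Proof.
have ia := inv_set1 G.
have : dz b (fun z => mul_loc k (row_mx z (inv_row z))) a = 0.
  rewrite -[RHS](dz_cst (a 0 k) a b).
  apply: (dz_ext _ (@inv_set_open _ _ G) ia) => y; rewrite inE => Uy.
  exact: mul_loc_inv.
rewrite (dz_row_mx (g := id) _ (@mul_dom_open _ _ G) (mul_loc_holo G k)); first last.
- by move=> l; exact: cderivable_inv_row.
- by move=> l; exact: cderivable_coord.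
- exact: mul_dom_inv.
rewrite [X in X + _]sum_dz_coord inv_row1 -/(d1 b k) d1_r1; last exact: chart_img1.
under eq_bigr => l _.
  rewrite -/(d2 l k) d2_l1; last exact: chart_img1.
  rewrite mulrC eq_sym; over.
by rewrite sum_delta => /eqP; rewrite addrC addr_eq0 => /eqP.
Qed.

Lemma gmul_preimg_open x (D : set G) : open D -> open [set y | D (gmul G x y)].
Proof.
move=> oD; rewrite openE => y /= Dxy; rewrite /interior nbhsE.
have [A [B [oA oB Ax By AB]]] := gmul_nbhs oD Dxy.
by exists B => // u Bu; exact: AB.
Qed.

(* Chain rule for w |-> (z w) z^-1 at the identity. *)
Lemma Ad_locE z Y k : inv_set G z -> Ad (inv z) Y 0 k =
  \sum_c Y 0 c * \sum_l d2 c l (row_mx z a) * d1 l k (row_mx z (inv_row z)).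
Proof.
move=> iz; have [dz' diz zE] := inv_setP iz.
have Uz : (ch @` dom) z by rewrite -zE; exists (inv z).
rewrite /Ad mxE; apply: eq_bigr => c _; congr (_ * _); rewrite mxE.
pose g w := \row_l mul_loc l (row_mx z w) : 'rV[C]_m.
(* Conjugation factors through the chart for those w such that z w lies in its domain: an open
   condition, satisfied at e. *)
have oW : copen (ch @` (dom `&` [set y | dom (gmul G (inv z) y)])).
  by apply: chart_preimg_open; apply: gmul_preimg_open; exact: chart_open.
have Wa : (ch @` (dom `&` [set y | dom (gmul G (inv z) y)])) a.
  by exists (gone G) => //; split; [exact: echart_dom|rewrite /= gmul1].
rewrite (dz_ext (g := fun w => mul_loc k (row_mx (g w) (inv_row z))) _ oW Wa); last first.
  move=> w; rewrite inE => -[y [dy dzy] <-] /=; rewrite chartK//.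
  have -> : g (ch y) = ch (gmul G (inv z) y).
    by apply/rowP => l; rewrite mxE -{1}zE mul_locE.
  by rewrite mul_locE.
have ga : g a = z by apply/rowP => l; rewrite mxE mul_loc_r1.
have gE l : (fun w => g w 0 l) = (fun w => mul_loc l (row_mx z w)).
  by apply/funext => w; rewrite mxE.
have dgl l : cderivable (fun w => g w 0 l) a.
  rewrite gE; apply: (cderivable_comp (f := mul_loc l) (g := fun w => row_mx z w)
    (@mul_dom_open _ _ G) (mul_loc_holo G l)).
    exact: mul_dom_r1.
  apply: cderivable_row_mx => j; [exact: cderivable_cst|exact: cderivable_coord].
rewrite (dz_row_mx (h := fun=> inv_row z) _ (@mul_dom_open _ _ G) (mul_loc_holo G k)); first last.
- by move=> l; exact: cderivable_cst.
- exact: dgl.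
- by rewrite ga; exact: mul_dom_inv.
rewrite ga [X in _ + X]sum_dz_cst addr0.
apply: eq_bigr => l _; congr (_ * _); rewrite gE.
by rewrite (dz_row_r _ (@mul_dom_open _ _ G) (mul_loc_holo G l))//; exact: mul_dom_r1.
Qed.

Lemma Ad1 Y : Ad (gone G) Y = Y.
Proof.
have ia := inv_set1 G.
apply/rowP => k; have := Ad_locE Y k ia; rewrite chartK; last exact: echart_dom.
move=> ->; rewrite inv_row1.
under eq_bigr => c _.
  under eq_bigr => l _ do rewrite (d2_l1 _ _ chart_img1) (d1_r1 _ _ chart_img1).
  rewrite sum_delta mulrC eq_sym; over.
by rewrite sum_delta.
Qed.

(* [lie] is the differential of z |-> Ad z at the identity; as the inverse has
   derivative -1 there, only these mixed second derivatives of the multiplication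
   survive.  Antisymmetry is then Schwarz's theorem. *)
Definition lie_coef (b c k : 'I_m) : C :=
  dz (lshift m b) (d2 c k) (row_mx a a) - dz (rshift m b) (d1 c k) (row_mx a a).

Lemma lie_coef_antisym b c k : lie_coef c b k = - lie_coef b c k.
Proof.
have aa : mul_dom G (row_mx a a) by exact/mul_dom_r1/chart_img1.
rewrite /lie_coef /d1 /d2 opprB.
have comm i j := holo1_dz_comm i j (@mul_dom_open _ _ G) (mul_loc_holo G k) aa.
by rewrite (comm (lshift m c) (rshift m b)) (comm (rshift m c) (lshift m b)).
Qed.

Lemma cderivable_d2_loc c l z : (ch @` dom) z ->
  cderivable (fun z => d2 c l (row_mx z a)) z.
Proof.
move=> Uz; apply: (cderivable_comp (g := fun z => row_mx z a) (@mul_dom_open _ _ G)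
  (d2_holo G c l)); first exact: mul_dom_r1.
by apply: cderivable_row_mx => j; [exact: cderivable_coord|exact: cderivable_cst].
Qed.

Lemma cderivable_d1_loc c l z : inv_set G z ->
  cderivable (fun z => d1 c l (row_mx z (inv_row z))) z.
Proof.
move=> iz; apply: (cderivable_comp (g := fun z => row_mx z (inv_row z))
  (@mul_dom_open _ _ G) (d1_holo G c l)); first exact: mul_dom_inv.
by apply: cderivable_row_mx => j; [exact: cderivable_coord|exact: cderivable_inv_row].
Qed.

Lemma cderivable_Ad1 Y k : cderivable (fun z => Ad (inv z) Y 0 k) a.
Proof.
have ia := inv_set1 G.
apply: (cderivable_ext (f := fun z => \sum_c Y 0 c * \sum_l d2 c l (row_mx z a) *
   d1 l k (row_mx z (inv_row z))) (@inv_set_open _ _ G) ia).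
  by move=> z; rewrite inE => iz; rewrite Ad_locE.
apply: cderivable_sum => c; apply: cderivableM; first exact: cderivable_cst.
apply: cderivable_sum => l; apply: cderivableM.
  exact/cderivable_d2_loc/chart_img1.
exact: cderivable_d1_loc.
Qed.

(** In the chain rule the left factor contributes nothing by [d1d1_11], and the right one carries
    the derivative -1 of the inverse. *)
Lemma dz_d1_inv1 b l k : dz b (fun z => d1 l k (row_mx z (inv_row z))) a
  = - dz (rshift m b) (d1 l k) (row_mx a a).
Proof.
have ia := inv_set1 G.
rewrite (dz_row_mx (g := id) _ (@mul_dom_open _ _ G) (d1_holo G l k)); first last.
- by move=> j; exact: cderivable_inv_row.
- by move=> j; exact: cderivable_coord.
- exact: mul_dom_inv.
rewrite inv_row1 [X in X + _]sum_dz_coord [X in X + _]d1d1_11 add0r.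
under eq_bigr do rewrite dz_inv_row1 mulNr.
by rewrite sumrN sum_delta.
Qed.

(** Product rule for [Ad_locE] at e: in each term one of [d1] and [d2] is a Kronecker delta and the
    other is differentiated, which leaves [lie_coef] as structure constants. *)
Lemma lieE Y Z k :
  lie G Y Z 0 k = \sum_b \sum_c Y 0 b * Z 0 c * lie_coef b c k.
Proof.
have ia := inv_set1 G.
have Ua := chart_img1.
rewrite /lie mxE; apply: eq_bigr => b _; rewrite mxE.
under [RHS]eq_bigr do rewrite -mulrA.
rewrite -mulr_sumr; congr (_ * _).
rewrite (dz_ext (g := fun z => \sum_c Z 0 c * \sum_l d2 c l (row_mx z a) *
   d1 l k (row_mx z (inv_row z))) _ (@inv_set_open _ _ G) ia); last first.
  by move=> z; rewrite inE => iz; rewrite Ad_locE.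
have cs c : cderivable (fun z => \sum_l d2 c l (row_mx z a) *
   d1 l k (row_mx z (inv_row z))) a.
  apply: cderivable_sum => l; apply: cderivableM; first exact: cderivable_d2_loc.
  exact: cderivable_d1_loc.
rewrite dz_sum; last by move=> c; apply: cderivableM => //; exact: cderivable_cst.
apply: eq_bigr => c _; rewrite dzM//; last exact: cderivable_cst.
rewrite dz_cst mulr0 addr0; congr (_ * _).
rewrite dz_sum; last first.
  move=> l; apply: cderivableM; first exact: cderivable_d2_loc.
  exact: cderivable_d1_loc.
under eq_bigr => l _.
  rewrite dzM; [|exact: cderivable_d2_loc|exact: cderivable_d1_loc].
  rewrite inv_row1 (d2_l1 _ _ Ua) (d1_r1 _ _ Ua) dz_d1_inv1.
  rewrite (dz_row_l _ (@mul_dom_open _ _ G) (d2_holo G c l) (mul_dom_r1 Ua)).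
  rewrite [l == k]eq_sym; over.
by rewrite big_split /= !sum_delta /lie_coef addrC.
Qed.

End LieBracket.

Lemma leibniz_comm (K : comNzRingType) (l p q p' q' : K) :
  p * (l * q') + q * (l * p') = l * (p' * q + p * q').
Proof. by ring. Qed.

(** * Derivatives of polynomials in complex-valued functions *)

Section PolynomialCalculus.
Variables (R : realType) (n m : nat).
Local Notation C := R[i].
Implicit Types (f : 'I_m -> 'rV[C]_n -> C) (p : mpoly m C).

Lemma is_rderiv_meval f p z j (l : 'I_m -> C) :
  (forall c, is_rderiv j (f c) z (l c)) ->
  is_rderiv j (fun z => meval (fun c => f c z) p) z
    (\sum_c l c * meval (fun c => f c z) (mderiv c p)).
Proof.
move=> df; elim/mpoly_gen_ind: p => [a|i|p q IHp IHq|p q IHp IHq].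
- under [X in is_rderiv _ X]funext do rewrite mevalC.
  rewrite big1; first exact: is_rderiv_cst.
  by move=> c _; rewrite mderivC meval0 mulr0.
- under [X in is_rderiv _ X]funext do rewrite mevalXU.
  rewrite (bigD1 i)//= big1 ?addr0 => [|c ci].
    rewrite mderivX mevalZ mnm1E eqxx mul1r mevalX big1 ?mulr1// => k _.
    by rewrite mnmBE subnn.
  by rewrite mderivX mevalZ mnm1E eq_sym (negPf ci) mul0r mulr0.
- under [X in is_rderiv _ X]funext do rewrite mevalD.
  have := is_rderivD IHp IHq; rewrite -big_split /=.
  congr (is_rderiv _ _ _ _); apply: eq_bigr => c _.
  by rewrite mderivD mevalD mulrDr.
- under [X in is_rderiv _ X]funext do rewrite mevalM.
  have := is_rderivM IHp IHq; rewrite !mulr_sumr -big_split /=.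
  congr (is_rderiv _ _ _ _); apply: eq_bigr => c _.
  by rewrite mderivM mevalD !mevalM leibniz_comm.
Qed.

Lemma cderivable_meval f p z : (forall c, cderivable (f c) z) ->
  cderivable (fun z => meval (fun c => f c z) p) z.
Proof.
move=> df; apply: is_rderiv_cderivable => j.
by apply: is_rderiv_meval => c; exact: df.
Qed.

Lemma rderiv_meval f p z j : (forall c, cderivable (f c) z) ->
  rderiv (delta_mx 0 j) (fun z => meval (fun c => f c z) p) z
  = \sum_c rderiv (delta_mx 0 j) (f c) z * meval (fun c => f c z) (mderiv c p).
Proof.
by move=> df; apply/is_rderivE/is_rderiv_meval => c; exact: df.
Qed.

Lemma dz_meval f p z k : (forall c, cderivable (f c) z) ->
  dz k (fun z => meval (fun c => f c z) p) z
  = \sum_c dz k (f c) z * meval (fun c => f c z) (mderiv c p).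
Proof.
move=> df; rewrite /dz !rderiv_meval// mulr_sumr -sumrB mulr_sumr.
by apply: eq_bigr => c _; rewrite -!mulNr wirtinger_scale.
Qed.

Lemma dzbar_meval f p z k : (forall c, cderivable (f c) z) ->
  dzbar k (fun z => meval (fun c => f c z) p) z
  = \sum_c dzbar k (f c) z * meval (fun c => f c z) (mderiv c p).
Proof.
move=> df; rewrite /dzbar !rderiv_meval// mulr_sumr -big_split mulr_sumr.
by apply: eq_bigr => c _; rewrite wirtinger_scale.
Qed.

Lemma smooth_on_meval f p U : copen U -> (forall c, smooth_on U (f c)) ->
  smooth_on U (fun z => meval (fun c => f c z) p).
Proof.
move=> oU sf; elim/mpoly_gen_ind: p => [a|i|p q IHp IHq|p q IHp IHq].
- under [X in smooth_on _ X]funext do rewrite mevalC.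
  exact: smooth_on_cst.
- have -> : (fun z => meval (f^~ z) (mpolyX C (mnm1 i))) = f i; last exact: sf.
  by apply/funext => z; rewrite mevalXU.
- under [X in smooth_on _ X]funext do rewrite mevalD.
  exact: smooth_onD.
- under [X in smooth_on _ X]funext do rewrite mevalM.
  exact: smooth_onM.
Qed.

End PolynomialCalculus.

(** * Invariant polynomials *)

Section InvariantPolynomials.
Variables (R : realType) (m : nat) (G : complexLieGroup R m).
Local Notation C := R[i].
Implicit Types (Y Z v : 'rV[C]_m).

Lemma lie0l Z : lie G 0 Z = 0.
Proof. exact: mul0mx. Qed.

Lemma lie_linearl Z : linear (lie G ^~ Z).
Proof. by move=> t Y Y'; rewrite /lie mulmxDl scalemxAl. Qed.

Lemma lie_antisym Y Z : lie G Z Y = - lie G Y Z.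
Proof.
apply/rowP => k; rewrite lieE [RHS]mxE lieE exchange_big /= -sumrN.
apply: eq_bigr => b _; rewrite -sumrN; apply: eq_bigr => c _.
by rewrite lie_coef_antisym mulrN [Z 0 c * _]mulrC.
Qed.

(** Linearity in the left argument is built into the matrix product defining [lie]; antisymmetry
    carries it to the right one. *)
Lemma lie_linearr Y : linear (lie G Y).
Proof.
by move=> t Z Z'; rewrite lie_antisym lie_linearl opprD -scalerN -!(lie_antisym _ Y).
Qed.

Lemma AdD g Y Z : @Ad R m G g (Y + Z) = Ad g Y + Ad g Z.
Proof. exact: mulmxDl. Qed.

Lemma AdZ g t Y : @Ad R m G g (t *: Y) = t *: Ad g Y.
Proof. by rewrite /Ad scalemxAl. Qed.

Lemma Ad0 g : @Ad R m G g 0 = 0. Proof. exact: mul0mx. Qed.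

Lemma Ad_coord g Y k : Ad g Y 0 k = \sum_c Y 0 c * @Ad R m G g (delta_mx 0 c) 0 k.
Proof.
rewrite /Ad mxE; apply: eq_bigr => c _; congr (_ * _).
by rewrite -rowE [RHS]mxE.
Qed.

Variable p : mpoly m C.
Hypothesis pinv : invariant_poly G p.

(* Differentiate p (Ad g v) = p v in g at the identity. *)
Lemma dpoly_lie_l Y v : dpoly p (lie G Y v) v = 0.
Proof.
pose a := chart G (echart G) (gone G).
pose F (c : 'I_m) z := Ad (chart_inv G (echart G) z) v 0 c.
have F1 c : F c a = v 0 c.
  by rewrite /F /a chartK ?Ad1//; exact: echart_dom.
have dF c : cderivable (F c) a by exact: cderivable_Ad1.
have E k : \sum_c dz k (F c) a * meval (v 0) (mderiv c p) = 0.
  rewrite -[RHS](dz_cst (meval (v 0) p) a k).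
  under eq_bigr do rewrite -(meval_eq _ F1).
  rewrite -(dz_meval p k dF); apply: (congr1 (fun h => dz k h a)); apply/funext => z.
  exact: pinv.
rewrite /dpoly.
under eq_bigr => c _ do rewrite /lie mxE mulr_suml.
rewrite exchange_big big1 // => k _.
under eq_bigr => c _ do rewrite mxE -mulrA.
by rewrite -mulr_sumr E mulr0.
Qed.

Lemma dpoly_lie_r Y v : dpoly p (lie G v Y) v = 0.
Proof.
rewrite lie_antisym /dpoly; under eq_bigr do rewrite mxE mulNr.
by rewrite sumrN -/(dpoly p _ v) dpoly_lie_l oppr0.
Qed.

(** p takes the same values along v + t Y and along its image under Ad(g), so the two restrictions
    are one polynomial in t, with one derivative at 0. *)
Lemma dpoly_Ad g Y v : dpoly p (@Ad R m G g Y) (@Ad R m G g v) = dpoly p Y v.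
Proof.
have line : on_line (@Ad R m G g v 0) (@Ad R m G g Y 0) p = on_line (v 0) (Y 0) p.
  apply/eqP; rewrite -subr_eq0; apply/eqP; apply: poly_eq0_horner => t.
  rewrite hornerD hornerN !horner_on_line; apply/eqP; rewrite subr_eq0; apply/eqP.
  have := pinv g (v + t *: Y); rewrite AdD AdZ => E; apply: etrans (etrans _ E) _.
    by apply: meval_eq => i; rewrite !mxE mulrC.
  by apply: meval_eq => i; rewrite !mxE mulrC.
by rewrite /dpoly -!deriv0_on_line line.
Qed.

Variable B : comAlgType C.
Implicit Types (V W : 'I_m -> B).

(** Invariance at all scalar points is the identity of polynomials p = p o Ad(g), which may be
    evaluated in B. It makes p(Theta) independent of the trivialisation. *)
Lemma aeval_Ad g V :
  aeval (fun k => \sum_c @Ad R m G g (delta_mx 0 c) 0 k *: V c) p = aeval V p.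
Proof.
pose lq := [tuple \sum_c @Ad R m G g (delta_mx 0 c) 0 k *: mpolyX C (mnm1 c) | k < m].
have pE : p = comp_mpoly lq p.
  apply/eqP; rewrite -subr_eq0; apply/eqP; apply: mpoly_eq0_meval => v.
  rewrite mevalB comp_mpoly_meval; apply/eqP; rewrite subr_eq0; apply/eqP.
  have E := pinv g (\row_k v k).
  rewrite -[LHS](_ : meval ((\row_k v k) 0) p = _); last first.
    by apply: meval_eq => k; rewrite mxE.
  rewrite -E; apply: meval_eq => k; rewrite tnth_mktuple Ad_coord raddf_sum.
  by apply: eq_bigr => c _; rewrite mxE /= mevalZ mevalXU mulrC.
rewrite [in RHS]pE aeval_comp; congr (mmap _ _ p); apply/funext => k.
rewrite tnth_mktuple aeval_sum; apply: eq_bigr => c _.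
by rewrite -mul_mpolyC aevalM aevalC aevalX mulr_algl.
Qed.

(* By linearity in W this is a family of identities between scalar polynomials in V,
   which may be checked on scalar points. *)
Lemma aeval_lie V W :
  \sum_k (\sum_b \sum_c lie_coef G b c k *: (V b * W c)) * aeval V (mderiv k p) = 0.
Proof.
(* [q c] is the polynomial v |-> (d p)([v, e_c] (x) v^(d-1)), with e_c the c-th basis vector. *)
pose q c := \sum_k (\sum_b lie_coef G b c k *: mpolyX C (mnm1 b)) * mderiv k p.
have q0 c : q c = 0.
  apply: mpoly_eq0_meval => v; rewrite -(dpoly_lie_r (delta_mx 0 c) (\row_k v k)).
  rewrite /dpoly raddf_sum; apply: eq_bigr => k _ /=.
  rewrite mevalM; congr (_ * _); last by apply: meval_eq => i; rewrite mxE.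
  rewrite lieE raddf_sum; apply: eq_bigr => b _ /=.
  rewrite mevalZ mevalXU (bigD1 c)//= !mxE !eqxx mulr1 big1 ?addr0 1?mulrC// => c' cc'.
  by rewrite !mxE eqxx (negPf cc') mulr0 mul0r.
have E c : \sum_k (\sum_b lie_coef G b c k *: V b) * aeval V (mderiv k p) = 0.
  rewrite -[RHS](aeval0 V) -(q0 c) aeval_sum; apply: eq_bigr => k _.
  rewrite aevalM; apply: (congr1 (fun x => x * _)); rewrite aeval_sum.
  apply: eq_bigr => b _.
  by rewrite -mul_mpolyC aevalM aevalC aevalX mulr_algl.
under eq_bigr => k _ do rewrite exchange_big mulr_suml /=.
rewrite exchange_big big1 //= => c _.
transitivity (W c * \sum_k (\sum_b lie_coef G b c k *: V b) * aeval V (mderiv k p)).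
  rewrite big_distrr; apply: eq_bigr => k _; rewrite [RHS]mulrA.
  apply: (congr1 (fun x => x * _)); rewrite big_distrr; apply: eq_bigr => b _ /=.
  by rewrite -scalerAr [W c * _]mulrC.
by rewrite E mulr0.
Qed.

End InvariantPolynomials.

(** * Homogeneous polynomial functions *)

Section HomogeneousFunctions.
Variables (K : comNzRingType) (n : nat).
Implicit Types (f g : 'rV[K]_n -> K).

(** The condition of [A0s_poly], as a property of functions that can be propagated through sums and
    products. *)
Definition homog_fun d f :=
  exists2 q : mpoly n K, q \is ishomog1 d mdeg & forall v, f v = meval (v 0) q.

Lemma homog_fun0 d : homog_fun d (fun=> 0).
Proof. by exists 0; [exact: dhomog0|move=> v; rewrite meval0]. Qed.

Lemma homog_fun_cst c : homog_fun 0 (fun=> c).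
Proof.
exists (mpolyC n c); last by move=> v; rewrite mevalC.
by rewrite -alg_mpolyC; apply: dhomogZ; exact: dhomog1.
Qed.

Lemma homog_funD d f g : homog_fun d f -> homog_fun d g ->
  homog_fun d (fun v => f v + g v).
Proof.
move=> [q hq fq] [q' hq' gq']; exists (q + q'); first exact: dhomogD.
by move=> v; rewrite mevalD fq gq'.
Qed.

Lemma homog_funZ d c f : homog_fun d f -> homog_fun d (fun v => c * f v).
Proof.
move=> [q hq fq]; exists (c *: q); first exact: dhomogZ.
by move=> v; rewrite mevalZ fq.
Qed.

Lemma homog_funM d e f g : homog_fun d f -> homog_fun e g ->
  homog_fun (d + e) (fun v => f v * g v).
Proof.
move=> [q hq fq] [q' hq' gq']; exists (q * q'); first exact: dhomogM.
by move=> v; rewrite mevalM fq gq'.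
Qed.

Lemma homog_fun_sum d (I : Type) (r : seq I) (P : pred I) (F : I -> 'rV[K]_n -> K) :
  (forall i, P i -> homog_fun d (F i)) ->
  homog_fun d (fun v => \sum_(i <- r | P i) F i v).
Proof.
move=> hF; have -> : (fun v => \sum_(i <- r | P i) F i v) = \sum_(i <- r | P i) F i.
  by apply/funext => v; rewrite fct_sumE.
by apply: big_ind => //; [exact: homog_fun0|exact: homog_funD].
Qed.

Lemma homog_fun_coord l : homog_fun 1 (fun v => v 0 l).
Proof.
exists (mpolyX K (mnm1 l)); last by move=> v; rewrite mevalXU.
by rewrite dhomogX /= mdeg1.
Qed.

Lemma homog_fun_linear f : (forall c u v, f (c *: u + v) = c * f u + f v) ->
  homog_fun 1 f.
Proof.
move=> lf; have f0 : f 0 = 0.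
  by have := lf (-1) 0 0; rewrite scaler0 addr0 mulN1r addrC subrr.
have -> : f = fun v => \sum_l f (delta_mx 0 l) * v 0 l.
  apply/funext => v; rewrite {1}(row_sum_delta v).
  rewrite (big_morph f (op1 := +%R) (id1 := 0))//; last first.
    by move=> x y; have := lf 1 x y; rewrite scale1r mul1r.
  apply: eq_bigr => l _; have := lf (v 0 l) (delta_mx 0 l) 0.
  by rewrite addr0 f0 addr0 mulrC.
by apply: homog_fun_sum => l _; apply: homog_funZ; exact: homog_fun_coord.
Qed.

End HomogeneousFunctions.

(** * Functions with values in an algebra *)

Section VectorValued.
Variables (K : comNzRingType) (T : Type) (B : comAlgType K).
Implicit Types (P Q S : (T -> K) -> Prop) (F G : T -> B).

(* This replaces coordinates in a basis of B. *)
Definition span_of P F := exists (I : finType) (f : I -> T -> K) (b : I -> B),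
  (forall s, P (f s)) /\ forall z, F z = \sum_s f s z *: b s.

Lemma span_of1 P f b : P f -> span_of P (fun z => f z *: b).
Proof.
move=> Pf; exists unit, (fun=> f), (fun=> b); split => // z.
by rewrite (big_pred1 tt)//; case.
Qed.

Lemma span_ofD P F G : span_of P F -> span_of P G -> span_of P (fun z => F z + G z).
Proof.
move=> [I [f [b [Pf Ff]]]] [J [g [c [Pg Gg]]]].
exists (I + J)%type, (fun s => match s with inl i => f i | inr j => g j end),
  (fun s => match s with inl i => b i | inr j => c j end).
by split=> [[]//|z]; rewrite big_sumType Ff Gg.
Qed.

Lemma span_ofM P Q S F G : (forall f g, P f -> Q g -> S (fun z => f z * g z)) ->
  span_of P F -> span_of Q G -> span_of S (fun z => F z * G z).
Proof.
move=> PQS [I [f [b [Pf Ff]]]] [J [g [c [Qg Gg]]]].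
exists (I * J)%type, (fun s z => f s.1 z * g s.2 z), (fun s => b s.1 * c s.2).
split=> [s|z]; first exact: PQS.
rewrite Ff Gg big_distrlr pair_big; apply: eq_bigr => -[i j] _ /=.
by rewrite -scalerAl -scalerAr scalerA.
Qed.

(** Brings a property of a B-valued function back to scalars; P is either homogeneity or
    smoothness. *)
Lemma span_of_functional P F (l : {scalar B}) : (P (fun=> 0)) ->
  (forall f g, P f -> P g -> P (fun z => f z + g z)) ->
  (forall c f, P f -> P (fun z => c * f z)) ->
  span_of P F -> P (fun z => l (F z)).
Proof.
move=> P0 PD PZ [I [f [b [Pf Ff]]]].
have -> : (fun z => l (F z)) = \sum_s (fun z => l (b s) * f s z).
  apply/funext => z; rewrite Ff raddf_sum fct_sumE; apply: eq_bigr => s _.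
  by rewrite [LHS](scalarZ l) mulrC.
by apply: big_ind => // s _; exact: PZ.
Qed.

End VectorValued.

(** Every monomial of p has degree d and is evaluated at coordinates of degree 1 in v. This places
    lam(p(Theta)) in the d-th symmetric power. *)
Lemma homog_fun_aeval (K : comNzRingType) (n m d : nat) (B : comAlgType K)
    (V : 'I_m -> 'rV[K]_n -> B) (p : mpoly m K) (l : {scalar B}) :
  p \is ishomog1 d mdeg -> (forall c, span_of (homog_fun 1) (V c)) ->
  homog_fun d (fun v => l (aeval (fun c => V c v) p)).
Proof.
move=> /dhomogP hp hV.
have hX k c : span_of (homog_fun k) (fun v => V c v ^+ k).
  elim: k => [|k IH].
    have -> : (fun v => V c v ^+ 0) = fun=> 1%:A by apply/funext => v; rewrite expr0 scale1r.
    by apply: span_of1; exact: homog_fun_cst.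
  have -> : (fun v => V c v ^+ k.+1) = fun v => V c v * V c v ^+ k.
    by apply/funext => v; rewrite exprS.
  by apply: span_ofM (hV c) IH => f g; rewrite -[k.+1]add1n; exact: homog_funM.
have hM mu : span_of (homog_fun (mdeg mu)) (fun v => mmap1 (fun c => V c v) mu).
  rewrite mdegE /mmap1; elim: (index_enum _) => [|i r IH].
    have -> : (fun v => \prod_(i <- [::]) V i v ^+ mu i) = fun=> 1%:A.
      by apply/funext => v; rewrite big_nil scale1r.
    by rewrite big_nil; apply: span_of1; exact: homog_fun_cst.
  have -> : (fun v => \prod_(j <- i :: r) V j v ^+ mu j)
    = fun v => V i v ^+ mu i * \prod_(j <- r) V j v ^+ mu j.
    by apply/funext => v; rewrite big_cons.
  by rewrite big_cons; apply: span_ofM (hX _ _) IH => f g; exact: homog_funM.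
have -> : (fun v => l (aeval (fun c => V c v) p)) =
    fun v => \sum_(mu <- msupp p) mcoeff mu p * l (mmap1 (fun c => V c v) mu).
  apply/funext => v; rewrite /aeval /mmap raddf_sum; apply: eq_bigr => mu _ /=.
  by rewrite mulr_algl [LHS](scalarZ l).
(* Homogeneity of p gives the degree only for monomials in its support, so membership is kept in the
   sum. *)
under [X in homog_fun _ X]funext do rewrite big_seq.
apply: homog_fun_sum => mu mup; apply: homog_funZ.
have := hM mu; rewrite (hp _ mup); apply: span_of_functional.
- exact: homog_fun0.
- by move=> f g; exact: homog_funD.
- by move=> c f; exact: homog_funZ.
Qed.

Lemma aeval_regular (K : comNzRingType) (m : nat) (V : 'I_m -> K) (p : mpoly m K) :
  aeval (V : 'I_m -> K^o) p = meval V p.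
Proof.
elim/mpoly_gen_ind: p => [c|i|p q IHp IHq|p q IHp IHq].
- by rewrite aevalC mevalC [LHS]mulr1.
- by rewrite aevalX mevalXU.
- by rewrite aevalD mevalD IHp IHq.
- by rewrite aevalM mevalM IHp IHq.
Qed.

(** The case B = K, with the identity as functional. *)
Lemma homog_fun_meval (K : comNzRingType) (n m d : nat) (q : mpoly m K)
    (f : 'I_m -> 'rV[K]_n -> K) : q \is ishomog1 d mdeg ->
  (forall c, homog_fun 1 (f c)) -> homog_fun d (fun v => meval (fun c => f c v) q).
Proof.
move=> hq hf.
have h1 c : span_of (B := K^o) (homog_fun 1) (f c).
  have -> : f c = fun v => f c v *: (1 : K^o) by apply/funext => v; rewrite [RHS]mulr1.
  exact: span_of1.
pose l : {scalar K^o} := HB.pack (@idfun K^o)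
  (GRing.isLinear.Build K K^o K *%R idfun (fun a u v => erefl (a * u + v))).
have := homog_fun_aeval l hq h1; congr (homog_fun d _); apply/funext => v.
exact: aeval_regular.
Qed.

Lemma leibniz_mul (K : comNzRingType) (l p q p' q' : K) :
  l * p' * q + p * (l * q') = l * (p' * q + p * q').
Proof. by ring. Qed.

(** * The operator dbar along one direction, for scalar and algebra-valued functions *)

Section DbarDir.
Variables (R : realType) (n : nat).
Local Notation C := R[i].
Implicit Types (f g : 'rV[C]_n -> C) (u z : 'rV[C]_n).

Lemma dbar_dir_ext (U : set 'rV[C]_n) u f g z : copen U -> U z -> {in U, f =1 g} ->
  dbar_dir u f z = dbar_dir u g z.
Proof.
by move=> oU Uz fg; apply: eq_bigr => k _; rewrite (dzbar_ext k oU Uz fg).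
Qed.

Lemma dbar_dir_cst u c z : dbar_dir u (fun=> c) z = 0.
Proof. by rewrite /dbar_dir big1// => k _; rewrite dzbar_cst mulr0. Qed.

Lemma dbar_dirD u f g z : cderivable f z -> cderivable g z ->
  dbar_dir u (fun z => f z + g z) z = dbar_dir u f z + dbar_dir u g z.
Proof.
move=> df dg; rewrite /dbar_dir -big_split; apply: eq_bigr => k _ /=.
by rewrite dzbarD// mulrDr.
Qed.

Lemma dbar_dirM u f g z : cderivable f z -> cderivable g z ->
  dbar_dir u (fun z => f z * g z) z = f z * dbar_dir u g z + g z * dbar_dir u f z.
Proof.
move=> df dg; rewrite /dbar_dir !mulr_sumr -big_split; apply: eq_bigr => k _ /=.
by rewrite dzbarM// mulrDr !(mulrCA (f z)) !(mulrCA (g z)).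
Qed.

Lemma dbar_dirZ u c f z : cderivable f z ->
  dbar_dir u (fun z => c * f z) z = c * dbar_dir u f z.
Proof.
move=> df; rewrite dbar_dirM//; last exact: cderivable_cst.
by rewrite dbar_dir_cst mulr0 addr0.
Qed.

Lemma dbar_dir_sum (I : Type) (r : seq I) (Q : pred I)
    (F : I -> 'rV[C]_n -> C) u z : (forall i, cderivable (F i) z) ->
  dbar_dir u (fun z => \sum_(i <- r | Q i) F i z) z
  = \sum_(i <- r | Q i) dbar_dir u (F i) z.
Proof.
move=> dF; rewrite /dbar_dir exchange_big; apply: eq_bigr => k _ /=.
by rewrite dzbar_sum// mulr_sumr.
Qed.

Lemma dbar_dir_meval (m : nat) (f : 'I_m -> 'rV[C]_n -> C) (p : mpoly m C) u z :
  (forall c, cderivable (f c) z) ->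
  dbar_dir u (fun z => meval (fun c => f c z) p) z
  = \sum_c dbar_dir u (f c) z * meval (fun c => f c z) (mderiv c p).
Proof.
move=> df; rewrite /dbar_dir.
under eq_bigr => k _ do rewrite dzbar_meval// mulr_sumr.
rewrite exchange_big; apply: eq_bigr => c _ /=.
by rewrite mulr_suml; apply: eq_bigr => k _; rewrite mulrA.
Qed.

Variables (B : comAlgType C).
Implicit Types (F H : 'rV[C]_n -> B).

(** B is a bare algebra, so F is differentiated through a finite decomposition into scalar functions
    with coefficients in B. By [has_dbar_functional] every functional of F' is determined by F. *)
Definition has_dbar u z F (F' : B) :=
  exists (I : finType) (f : I -> 'rV[C]_n -> C) (b : I -> B),
  [/\ forall s, cderivable (f s) z, forall y, F y = \sum_s f s y *: b s
    & F' = \sum_s dbar_dir u (f s) z *: b s].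

Lemma has_dbar1 u z f b : cderivable f z ->
  has_dbar u z (fun z => f z *: b) (dbar_dir u f z *: b).
Proof.
move=> df; exists unit, (fun=> f), (fun=> b); split => // [y|];
  by rewrite (big_pred1 tt)//; case.
Qed.

Lemma has_dbarD u z F H (F' H' : B) : has_dbar u z F F' -> has_dbar u z H H' ->
  has_dbar u z (fun z => F z + H z) (F' + H').
Proof.
move=> [I [f [b [df Ff ->]]]] [J [g [c [dg Hg ->]]]].
exists (I + J)%type, (fun s => match s with inl i => f i | inr j => g j end),
  (fun s => match s with inl i => b i | inr j => c j end).
by split=> [[]//|y|]; rewrite big_sumType ?Ff ?Hg.
Qed.

Lemma has_dbarM u z F H (F' H' : B) : has_dbar u z F F' -> has_dbar u z H H' ->
  has_dbar u z (fun z => F z * H z) (F' * H z + F z * H').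
Proof.
move=> [I [f [b [df Ff ->]]]] [J [g [c [dg Hg ->]]]].
exists (I * J)%type, (fun s z => f s.1 z * g s.2 z), (fun s => b s.1 * c s.2); split.
- by move=> s; exact: cderivableM.
- move=> y; rewrite Ff Hg big_distrlr pair_big; apply: eq_bigr => -[i j] _ /=.
  by rewrite -scalerAl -scalerAr scalerA.
- rewrite Ff Hg !big_distrlr !pair_big -big_split; apply: eq_bigr => -[i j] _ /=.
  rewrite dbar_dirM// scalerDl addrC -!scalerAl -!scalerAr !scalerA.
  by rewrite [g j z * _]mulrC.
Qed.

Lemma has_dbar_cst u z b : has_dbar u z (fun=> b) 0.
Proof.
have := has_dbar1 u b (cderivable_cst (1 : C) z).
by rewrite dbar_dir_cst scale0r scale1r.
Qed.

Lemma has_dbar_aeval (m : nat) u z (V : 'I_m -> 'rV[C]_n -> B) (V' : 'I_m -> B)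
    (p : mpoly m C) : (forall c, has_dbar u z (V c) (V' c)) ->
  has_dbar u z (fun z => aeval (fun c => V c z) p)
    (\sum_c V' c * aeval (fun c => V c z) (mderiv c p)).
Proof.
move=> dV; elim/mpoly_gen_ind: p => [a|i|p q IHp IHq|p q IHp IHq].
- under [X in has_dbar _ _ X]funext do rewrite aevalC.
  rewrite big1; first exact: has_dbar_cst.
  by move=> c _; rewrite mderivC aeval0 mulr0.
- have -> : (fun z => aeval (V^~ z) (mpolyX C (mnm1 i))) = V i.
    by apply/funext => y; rewrite aevalX.
  rewrite (bigD1 i)//= big1 ?addr0 => [|c ci].
    rewrite mderivX mnm1E eqxx scale1r (_ : mnm_sub _ _ = @mnm0 m).
      by rewrite mpolyX0 -mpolyC1 aevalC scale1r mulr1.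
    by apply/mnmP => k; rewrite mnmBE mnm0E subnn.
  by rewrite mderivX mnm1E eq_sym (negPf ci) scale0r aeval0 mulr0.
- under [X in has_dbar _ _ X]funext do rewrite aevalD.
  have := has_dbarD IHp IHq; rewrite -big_split /=.
  congr (has_dbar _ _ _ _); apply: eq_bigr => c _.
  by rewrite mderivD aevalD mulrDr.
- under [X in has_dbar _ _ X]funext do rewrite aevalM.
  have := has_dbarM IHp IHq; rewrite mulr_suml mulr_sumr -big_split /=.
  congr (has_dbar _ _ _ _); apply: eq_bigr => c _.
  by rewrite mderivM aevalD !aevalM leibniz_mul.
Qed.

Lemma has_dbar_functional u z F (F' : B) (l : {scalar B}) : has_dbar u z F F' ->
  dbar_dir u (fun z => l (F z)) z = l F'.
Proof.
move=> [I [f [b [df Ff ->]]]].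
have -> : (fun z => l (F z)) = fun z => \sum_s l (b s) * f s z.
  apply/funext => y; rewrite Ff raddf_sum; apply: eq_bigr => s _.
  by rewrite [LHS](scalarZ l) mulrC.
rewrite dbar_dir_sum; last by move=> s; apply: cderivableM => //; exact: cderivable_cst.
rewrite raddf_sum; apply: eq_bigr => s _; rewrite dbar_dirZ// [RHS](scalarZ l).
exact: mulrC.
Qed.

Lemma smooth_on_aeval (m : nat) (U : set 'rV[C]_n) (V : 'I_m -> 'rV[C]_n -> B)
    (p : mpoly m C) (l : {scalar B}) : copen U ->
  (forall c, span_of (smooth_on U) (V c)) ->
  smooth_on U (fun z => l (aeval (fun c => V c z) p)).
Proof.
move=> oU sV; apply: (span_of_functional (P := smooth_on U)).
- exact: smooth_on_cst.
- by move=> f g; exact: smooth_onD.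
- by move=> c f sf; apply: smooth_onM => //; exact: smooth_on_cst.
elim/mpoly_gen_ind: p => [a|i|p q IHp IHq|p q IHp IHq].
- under [X in span_of _ X]funext do rewrite aevalC.
  by apply: (span_of1 (f := fun=> a)); exact: smooth_on_cst.
- have -> : (fun z => aeval (V^~ z) (mpolyX C (mnm1 i))) = V i; last exact: sV.
  by apply/funext => y; rewrite aevalX.
- under [X in span_of _ X]funext do rewrite aevalD.
  exact: span_ofD.
- under [X in span_of _ X]funext do rewrite aevalM.
  by apply: span_ofM IHp IHq => f g; exact: smooth_onM.
Qed.

End DbarDir.

(** * Forms on X *)

Section Forms.
Variables (R : realType) (n m : nat) (X : complexManifold R n).
Variables (G : complexLieGroup R m) (P : principalBundle X G).
Local Notation C := R[i].
Implicit Types (Phi Psi : adform P) (x : X) (w v : seq 'rV[C]_n).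

Lemma adform_linE a Phi Psi i j x w v :
  (a *: Phi + Psi) i j x w v = a *: Phi i j x w v + Psi i j x w v.
Proof. by []. Qed.

Lemma adformP Phi Psi : (forall i j x w v, Phi i j x w v = Psi i j x w v) -> Phi = Psi.
Proof.
move=> E; apply/funext => i; apply/funext => j; apply/funext => x.
by apply/funext => w; apply/funext => v.
Qed.

Lemma adform_sumE (I : Type) (r : seq I) (Q : pred I) (F : I -> adform P) i j x w v :
  (\sum_(s <- r | Q s) F s) i j x w v = \sum_(s <- r | Q s) F s i j x w v.
Proof. exact: (big_morph (fun Phi : adform P => Phi i j x w v)). Qed.

Lemma copen_triv i j : copen (chart X i @` (chart_dom X i `&` triv_dom P j)).
Proof. by apply: chart_preimg_open; exact: triv_open. Qed.

Lemma A0_zero p q : A0 p q (0 : adform P).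
Proof.
split => //.
- by move=> i j x v l1 l2 a y z; rewrite scaler0 addr0.
- by move=> i j x w l1 l2 a y z; rewrite scaler0 addr0.
- move=> i j w v c.
  have -> : (fun z => (0 : adform P) i j (chart_inv X i z) w v 0 c) = fun=> 0.
    by apply/funext => z; exact: mxE.
  exact: smooth_on_cst.
- by move=> *; rewrite Ad0.
Qed.

Lemma A0_lin p q a Phi Psi : A0 p q Phi -> A0 p q Psi -> A0 p q (a *: Phi + Psi).
Proof.
move=> hF hG; split.
- by move=> i j x w v o; rewrite adform_linE (A0_supp hF)// (A0_supp hG)// scaler0 addr0.
- move=> i j x v l1 l2 b y z; rewrite !adform_linE.
  rewrite (A0_antilinear hF) (A0_antilinear hG) !scalerDr !scalerA mulrC.
  by rewrite !addrA; congr (_ + _); rewrite addrAC.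
- move=> i j x w l1 l2 b y z; rewrite !adform_linE.
  rewrite (A0_linear hF) (A0_linear hG) !scalerDr !scalerA mulrC.
  by rewrite !addrA; congr (_ + _); rewrite addrAC.
- by move=> i j x v l1 l2 l3 y; rewrite adform_linE (A0_alt_bar hF) (A0_alt_bar hG) scaler0 addr0.
- by move=> i j x w l1 l2 l3 y; rewrite adform_linE (A0_alt hF) (A0_alt hG) scaler0 addr0.
- move=> i j w v c; have oU := @copen_triv i j.
  have -> : (fun z => (a *: Phi + Psi) i j (chart_inv X i z) w v 0 c) =
    (fun z => a * Phi i j (chart_inv X i z) w v 0 c + Psi i j (chart_inv X i z) w v 0 c).
    by apply/funext => z; rewrite adform_linE !mxE.
  apply: smooth_onD => //; last exact: (A0_smooth hG).
  by apply: smooth_onM => //; [exact: smooth_on_cst|exact: (A0_smooth hF)].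
- move=> i i' j j' x w v di di' dj dj'; rewrite !adform_linE AdD AdZ.
  by rewrite (A0_glue hF _ _ di di' dj dj') (A0_glue hG _ _ di di' dj dj').
Qed.

Lemma higgs_deg_zero k : @higgs_deg R n m X G P k 0.
Proof.
by exists (fun=> 0); split=> [p _|]; [exact: A0_zero|rewrite big1].
Qed.

Lemma higgs_deg_lin k a Phi Psi : higgs_deg k Phi -> higgs_deg k Psi ->
  higgs_deg k (a *: Phi + Psi).
Proof.
move=> [s [sA ->]] [t [tA ->]]; exists (fun p => a *: s p + t p); split.
  by move=> p pk; apply: A0_lin; [exact: sA|exact: tA].
by rewrite scaler_sumr -big_split.
Qed.

Lemma higgs_deg_sum k (r : nat) (a : 'I_r -> C) (F : 'I_r -> adform P) :
  (forall s, higgs_deg k (F s)) -> higgs_deg k (\sum_s a s *: F s).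
Proof.
move=> hF; elim/big_ind: _ => [|Phi Psi hPhi hPsi|s _].
- exact: higgs_deg_zero.
- by rewrite -[Phi]scale1r; exact: higgs_deg_lin.
- by rewrite -[_ *: _]addr0; apply: higgs_deg_lin => //; exact: higgs_deg_zero.
Qed.

(** Summands of different bidegree live on lists of different lengths, so restricting the lengths
    recovers the summand of type (p, k - p). *)
Lemma higgs_deg_component k p Phi : higgs_deg k Phi -> (p <= k)%N ->
  A0 p (k - p) (component p (k - p) Phi).
Proof.
move=> [s [sA ->]] pk; suff -> : component p (k - p) (\sum_(p < k.+1) s p) = s p.
  exact: sA.
apply: adformP => i j x w v; rewrite /component.
have [/andP[/eqP sw /eqP sv]|nsz] := boolP ((size w == (k - p)%N) && (size v == p)).
  rewrite adform_sumE (bigD1 (Ordinal (_ : (p < k.+1)%N)))//= big1 ?addr0// => l lp.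
  rewrite (A0_supp (sA l _))// => [|[_ _ _ lv]]; first by rewrite -ltnS.
  by move/eqP: lp; apply; apply: val_inj; rewrite /= -lv sv.
rewrite (A0_supp (sA p pk))// => -[_ _ sw sv].
by move/negP: nsz; apply; rewrite sw sv !eqxx.
Qed.

Lemma higgs_deg_size k Phi i j x w v : higgs_deg k Phi ->
  (size w + size v != k)%N -> Phi i j x w v = 0.
Proof.
move=> [s [sA ->]] sz; rewrite adform_sumE big1// => l _.
have lk : (l <= k)%N by rewrite -ltnS.
apply: (A0_supp (sA l lk)) => -[_ _ sw sv].
by move/eqP: sz; apply; rewrite sw sv subnK.
Qed.

Lemma higgs_deg_smooth k Phi i j w v c : higgs_deg k Phi ->
  smooth_on (chart X i @` (chart_dom X i `&` triv_dom P j))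
    (fun z => Phi i j (chart_inv X i z) w v 0 c).
Proof.
move=> [s [sA ->]].
have -> : (fun z => (\sum_(p < k.+1) s p) i j (chart_inv X i z) w v 0 c) =
   fun z => \sum_(p < k.+1) s p i j (chart_inv X i z) w v 0 c.
  by apply/funext => z; rewrite adform_sumE summxE.
apply: smooth_on_sum => [|l]; first exact: copen_triv.
by apply: A0_smooth; apply: sA; rewrite -ltnS.
Qed.

Lemma higgs_deg_cderivable k Phi i j x w v c : higgs_deg k Phi ->
  chart_dom X i x -> triv_dom P j x ->
  cderivable (fun z => Phi i j (chart_inv X i z) w v 0 c) (chart X i x).
Proof.
move=> hPhi di dj; apply: smooth_on_cderivable (higgs_deg_smooth i j w v c hPhi) _.
by exists x.
Qed.

Lemma dbarE Phi i j x w v c : chart_dom X i x -> triv_dom P j x ->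
  dbar Phi i j x w v 0 c = \sum_(l < size w) (-1) ^+ l *
    dbar_dir (nth 0 w l) (fun z => Phi i j (chart_inv X i z) (remove_nth l w) v 0 c)
      (chart X i x).
Proof. by move=> di dj; rewrite /dbar; case: asboolP => [_|[]//]; rewrite mxE. Qed.

(** [dbar] differentiates with v fixed; a form may thus be exchanged for its component of type (1,
    .) when only single vectors v are inserted. *)
Lemma eq_dbar Phi Psi v : (forall i j x w, Phi i j x w v = Psi i j x w v) ->
  forall i j x w, dbar Phi i j x w v = dbar Psi i j x w v.
Proof.
move=> E i j x w.
(* [dbar] with v frozen, as a function of the remaining data, so that extensionality applies to
   those data. *)
pose F (g : chart_index X -> triv_index P -> X -> seq 'rV[C]_n -> 'rV[C]_m) :=
  if `[< chart_dom X i x /\ triv_dom P j x >] then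
    \row_c \sum_(l < size w) (-1) ^+ l * dbar_dir (nth 0 w l)
      (fun z => g i j (chart_inv X i z) (remove_nth l w) 0 c) (chart X i x)
  else 0.
have D (Theta : adform P) :
  dbar Theta i j x w v = F (fun i j x w => Theta i j x w v) by [].
rewrite !D; apply: (congr1 F); apply/funext => i'; apply/funext => j'.
by apply/funext => x'; apply/funext => w'.
Qed.

Lemma dbar_out Phi i j x w v : ~ (chart_dom X i x /\ triv_dom P j x) ->
  dbar Phi i j x w v = 0.
Proof. by move=> o; rewrite /dbar; case: asboolP. Qed.

(** [adform] also contains expressions that are not smooth, whose derivatives need not add up; hence
    the degree hypotheses. *)
Lemma dbar_lin k a Phi Psi : higgs_deg k Phi -> higgs_deg k Psi ->
  dbar (a *: Phi + Psi) = a *: dbar Phi + dbar Psi.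
Proof.
move=> hPhi hPsi; apply: adformP => i j x w v; rewrite adform_linE.
have [[di dj]|o] := pselect (chart_dom X i x /\ triv_dom P j x); last first.
  by rewrite !dbar_out// scaler0 addr0.
apply/rowP => c; rewrite [LHS]dbarE//.
transitivity (a * dbar Phi i j x w v 0 c + dbar Psi i j x w v 0 c); last first.
  by rewrite [RHS]mxE; apply: (congr1 (fun y => y + _)); rewrite [RHS]mxE.
rewrite (dbarE Phi)// (dbarE Psi)// mulr_sumr -big_split.
apply: eq_bigr => l _ /=.
have dPhi := higgs_deg_cderivable (remove_nth l w) v c hPhi di dj.
have dPsi := higgs_deg_cderivable (remove_nth l w) v c hPsi di dj.
have -> : (fun z => (a *: Phi + Psi) i j (chart_inv X i z) (remove_nth l w) v 0 c) =
  (fun z => a * Phi i j (chart_inv X i z) (remove_nth l w) v 0 c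
          + Psi i j (chart_inv X i z) (remove_nth l w) v 0 c).
  by apply/funext => z; rewrite adform_linE !mxE.
rewrite dbar_dirD//; last by apply: cderivableM => //; exact: cderivable_cst.
by rewrite dbar_dirZ// mulrDr mulrCA.
Qed.

Lemma form_bracket_linr a Theta Phi Psi :
  form_bracket Theta (a *: Phi + Psi) =
  a *: form_bracket Theta Phi + form_bracket Theta Psi.
Proof.
apply: adformP => i j x w v; rewrite adform_linE /form_bracket.
rewrite scaler_sumr -big_split; apply: eq_bigr => t _ /=.
rewrite scaler_sumr -big_split; apply: eq_bigr => b _ /=.
by rewrite adform_linE lie_linearr scalerDr !scalerA mulrC.
Qed.

Lemma shuffle_inv_false (k : nat) : shuffle_inv (nseq k false) = 0%N.
Proof. by elim: k => //= k ->; rewrite count_nseq. Qed.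

Lemma big_tuple1 (V : nmodType) (F : 1.-tuple bool -> V) :
  \sum_t F t = F [tuple true] + F [tuple false].
Proof.
rewrite (bigD1 [tuple true])//= (bigD1 [tuple false])//= big1 ?addr0//.
move=> t /andP[t1 t0]; exfalso; case/tupleP: t t1 t0 => b t; rewrite (tuple0 t).
by case: b; rewrite -!val_eqE.
Qed.

Lemma big_nseq_false (V : nmodType) (k : nat) (F : k.-tuple bool -> V) :
  (forall t : k.-tuple bool, count id t != 0%N -> F t = 0) ->
  \sum_t F t = F [tuple of nseq k false].
Proof.
move=> F0; rewrite (bigD1 [tuple of nseq k false])//= big1 ?addr0// => t tf.
apply: F0; apply: contra tf => /eqP t0; apply/eqP/val_inj => /=.
have /all_pred1P : all (pred1 false) t.
  by move: t0; elim: (tval t) => //= -[]//.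
by rewrite size_tuple.
Qed.

(** For Theta of type (1,0) only the shuffle giving u to Theta and all of w to Phi survives; the
    sign is the cost of moving the one-form Theta past the (0, [size w])-part of Phi. *)
Lemma form_bracket_holo Theta Phi i j x w u : A0 1 0 Theta ->
  form_bracket Theta Phi i j x w [:: u]
  = (-1) ^+ size w *: lie G (Theta i j x [::] [:: u]) (Phi i j x w [::]).
Proof.
move=> hT; rewrite /form_bracket big_nseq_false; last first.
  move=> t t0; rewrite big1// => b _; rewrite (A0_supp hT) ?lie0l ?scaler0//.
  move=> [_ _ + _]; rewrite size_mask ?size_tuple// => sz.
  by case/eqP: t0.
rewrite big_tuple1 /= mask_false map_nseq mask_true// shuffle_inv_false.
rewrite (A0_supp hT (v := [::])); last by move=> [].
by rewrite lie0l scaler0 addr0 count_nseq !add0n addn0 !mul1n.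
Qed.

(** Of the four shuffles, those giving both vectors or none to Phi vanish by degree. In the second
    remaining term the (1,0)-part of Phi passes the (0,1)-part of Psi, hence its sign. *)
Lemma form_bracket_11 Phi Psi i j x (w0 v0 : 'rV[C]_n) : higgs_deg 1 Phi -> higgs_deg 1 Psi ->
  form_bracket Phi Psi i j x [:: w0] [:: v0] =
  lie G (Phi i j x [:: w0] [::]) (Psi i j x [::] [:: v0]) -
  lie G (Phi i j x [::] [:: v0]) (Psi i j x [:: w0] [::]).
Proof.
move=> hPhi hPsi; rewrite /form_bracket big_tuple1.
rewrite [X in X + _]big_tuple1 [X in _ + X]big_tuple1 /=.
rewrite (higgs_deg_size _ _ _ (w := [:: w0]) (v := [:: v0]) hPhi)//.
rewrite (higgs_deg_size _ _ _ (w := [::]) (v := [::]) hPhi)//.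
rewrite !lie0l !scaler0 addr0 add0r.
by rewrite expr0 scale1r expr1 scaleN1r.
Qed.

End Forms.

(** * Forms with values in symmetric powers of the cotangent bundle *)

Lemma symformP (R : realType) (n : nat) (X : complexManifold R n)
    (tau tau' : symform X) :
  (forall i x w v, tau i x w v = tau' i x w v) -> tau = tau'.
Proof.
move=> E; apply/funext => i; apply/funext => x.
by apply/funext => w; apply/funext => v.
Qed.

Section SymmetricForms.
Variables (R : realType) (n : nat) (X : complexManifold R n).
Local Notation C := R[i].
Implicit Types (tau : symform X).

Lemma symform_linE a tau tau' i x w v :
  (a *: tau + tau') i x w v = a * tau i x w v + tau' i x w v.
Proof. by []. Qed.

(** The glueing conditions change chart and trivialisation together; this isolates a change of
    trivialisation. *)
Lemma transfer_id i x (v : 'rV[C]_n) : chart_dom X i x -> transfer i i x v = v.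
Proof.
move=> di; rewrite /transfer (_ : jac _ _ = 1%:M) ?mulmx1//.
apply/matrixP => k l; rewrite !mxE -(dz_coord (chart X i x) l k).
have Ux : (chart X i @` chart_dom X i) (chart X i x) by exists x.
apply: (dz_ext k (@chart_dom_open _ _ X i) Ux) => z; rewrite inE => -[y dy <-].
by rewrite chartK.
Qed.

Lemma A0_sym_zero d q : A0_sym d q (0 : symform X).
Proof.
split => //.
- by move=> i x v l1 l2 a y z; rewrite scaler0 addr0.
- move=> i x w; exists 0 => [|v]; first exact: dhomog0.
  by rewrite meval0.
- by move=> i w v; exact: smooth_on_cst.
Qed.

Lemma A0_sym_lin d q a tau tau' : A0_sym d q tau -> A0_sym d q tau' ->
  A0_sym d q (a *: tau + tau').
Proof.
move=> ht ht'; split.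
- by move=> i x w v o; rewrite symform_linE (A0s_supp ht)// (A0s_supp ht')// mulr0 addr0.
- move=> i x v l1 l2 b y z; rewrite !symform_linE.
  rewrite (A0s_antilinear ht) (A0s_antilinear ht') /GRing.scale/= !mulrDr.
  by rewrite [a * (_ * _)]mulrCA !addrA; congr (_ + _); rewrite addrAC.
- move=> i x v l1 l2 l3 y; rewrite symform_linE (A0s_alt_bar ht) (A0s_alt_bar ht').
  by rewrite mulr0 addr0.
- move=> i x w; have hf := A0s_poly ht i x w; have hf' := A0s_poly ht' i x w.
  exact: (homog_funD (homog_funZ a hf) hf').
- move=> i w v; apply: smooth_onD; first exact: chart_dom_open.
    apply: smooth_onM; [exact: chart_dom_open|exact: smooth_on_cst|].
    exact: (A0s_smooth ht).
  exact: (A0s_smooth ht').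
- by move=> i i' x w v di di'; rewrite !symform_linE (A0s_glue ht)// (A0s_glue ht').
Qed.

Lemma sym_dbar_lin d q a tau tau' : A0_sym d q tau -> A0_sym d q tau' ->
  sym_dbar (a *: tau + tau') = a *: sym_dbar tau + sym_dbar tau'.
Proof.
move=> ht ht'; apply: symformP => i x w v; rewrite symform_linE /sym_dbar.
case: asboolP => [di|_]; last by rewrite mulr0 addr0.
rewrite mulr_sumr -big_split; apply: eq_bigr => l _ /=.
have Ux : (chart X i @` chart_dom X i) (chart X i x) by exists x.
have dt := smooth_on_cderivable (A0s_smooth ht i (remove_nth l w) v) Ux.
have dt' := smooth_on_cderivable (A0s_smooth ht' i (remove_nth l w) v) Ux.
rewrite [dbar_dir _ _ _](_ : _ = a * dbar_dir (nth 0 w l)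
   (fun z => tau i (chart_inv X i z) (remove_nth l w) v) (chart X i x) +
   dbar_dir (nth 0 w l)
   (fun z => tau' i (chart_inv X i z) (remove_nth l w) v) (chart X i x)).
  by rewrite mulrDr mulrCA.
rewrite -dbar_dirZ// -dbar_dirD//.
by apply: cderivableM => //; exact: cderivable_cst.
Qed.

End SymmetricForms.

(** * The map s |-> (d p)(s (x) theta^(d-1)) on forms *)

Section InvariantForms.
Variables (R : realType) (n m : nat) (X : complexManifold R n).
Variables (G : complexLieGroup R m) (P : principalBundle X G).
Variables (theta : adform P) (htheta : higgs_field theta).
Variables (d : nat) (p : mpoly m R[i]) (hp : p \is ishomog1 d mdeg).
Hypothesis pinv : invariant_poly G p.
Local Notation C := R[i].
Local Notation dp := (dpoly_form theta p).

Lemma dpoly0 v : dpoly p (0 : 'rV[C]_m) v = 0.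
Proof. by rewrite /dpoly big1// => c _; rewrite mxE mul0r. Qed.

Lemma dpoly_lin a (Y Z v : 'rV[C]_m) :
  dpoly p (a *: Y + Z) v = a * dpoly p Y v + dpoly p Z v.
Proof.
rewrite /dpoly mulr_sumr -big_split; apply: eq_bigr => c _ /=.
by rewrite !mxE mulrDl mulrA.
Qed.

Lemma dpoly_form_lin a (Phi Psi : adform P) : dp (a *: Phi + Psi) = a *: dp Phi + dp Psi.
Proof. by apply: symformP => i x w v; rewrite symform_linE -dpoly_lin. Qed.

Lemma eq_dpoly_form (Phi Psi : adform P) :
  (forall i j x w v, Phi i j x w [:: v] = Psi i j x w [:: v]) -> dp Phi = dp Psi.
Proof. by move=> E; apply: symformP => i x w v; rewrite /dpoly_form /= E. Qed.

Lemma triv_atP x : triv_dom P (triv_at P x) x.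
Proof. by rewrite /triv_at; case: cid. Qed.

Lemma theta_A0 : A0 1 0 theta. Proof. by case: htheta. Qed.

Lemma theta_cderivable i j x w v c : chart_dom X i x -> triv_dom P j x ->
  cderivable (fun z => theta i j (chart_inv X i z) w v 0 c) (chart X i x).
Proof.
by move=> di dj; apply: smooth_on_cderivable (A0_smooth theta_A0 i j w v c) _; exists x.
Qed.

Lemma dbar_dir_theta i j x u v c : chart_dom X i x -> triv_dom P j x ->
  dbar_dir u (fun z => theta i j (chart_inv X i z) [::] [:: v] 0 c) (chart X i x) = 0.
Proof.
move=> di dj; have [_ dbar0 _] := htheta.
have := congr1 (fun Phi : adform P => Phi i j x [:: u] [:: v] 0 c) dbar0.
by rewrite dbarE//= big_ord1 /= expr0 mul1r => ->; rewrite mxE.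
Qed.

(** [triv_at] chooses a trivialisation point by point, with no regularity in x. Invariance of p
    allows a fixed one on a whole open set, where the form can be differentiated. *)
Lemma dpoly_form_triv q (s : adform P) i j x w v : A0 1 q s -> chart_dom X i x ->
  triv_dom P j x ->
  dp s i x w v = dpoly p (s i j x w [:: v]) (theta i j x [::] [:: v]).
Proof.
move=> hs di dj; set j0 := triv_at P x.
have dj0 : triv_dom P j0 x := triv_atP x.
have tE (l : seq 'rV[C]_n) : map (transfer i i x) l = l.
  by rewrite -[RHS]map_id; apply: eq_map => y; exact: transfer_id.
have := A0_glue hs w [:: v] di di dj0 dj; rewrite !tE => ->.
have := A0_glue theta_A0 [::] [:: v] di di dj0 dj; rewrite !tE => ->.
by rewrite dpoly_Ad.
Qed.

Lemma dpoly_form_near q (s : adform P) i j w v : A0 1 q s ->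
  {in chart X i @` (chart_dom X i `&` triv_dom P j),
    (fun z => dp s i (chart_inv X i z) w v) =1
    fun z => \sum_c s i j (chart_inv X i z) w [:: v] 0 c *
      meval (fun c => theta i j (chart_inv X i z) [::] [:: v] 0 c) (mderiv c p)}.
Proof.
move=> hs z; rewrite inE => -[y [dy djy] <-].
by rewrite (dpoly_form_triv (j := j) _ _ hs) ?chartK.
Qed.

Lemma A0_line_linear q (s : adform P) i j x w c : A0 1 q s ->
  homog_fun 1 (fun v => s i j x w [:: v] 0 c).
Proof.
move=> hs; apply: homog_fun_linear => a u v.
by have := A0_linear hs i j x w [::] [::] a u v; rewrite /= => ->; rewrite !mxE.
Qed.

Lemma dhomog_mderiv k (q : mpoly m C) c : q \is ishomog1 k.+1 mdeg ->
  mderiv c q \is ishomog1 k mdeg.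
Proof.
move=> /dhomogP hq; apply/dhomogP => mu.
rewrite mcoeff_msupp mcoeff_mderiv => h.
have : mnm_add mu (mnm1 c) \in msupp q.
  by rewrite mcoeff_msupp; apply: contra h => /eqP ->; rewrite mul0rn.
by move=> /hq /=; rewrite mdegD mdeg1 addn1 => -[].
Qed.

Lemma dhomog0_mderiv (q : mpoly m C) c : q \is ishomog1 0 mdeg -> mderiv c q = 0.
Proof.
move=> /dhomogP hq; apply/mpolyP => mu; rewrite mcoeff_mderiv mcoeff0.
rewrite memN_msupp_eq0 ?mul0rn//; apply/negP => /hq /=.
by rewrite mdegD mdeg1 addn1.
Qed.

Lemma A0_sym_dpoly_form q (s : adform P) : A0 1 q s -> A0_sym d q (dp s).
Proof.
move=> hs; split.
- move=> i x w v o; rewrite /dpoly_form /= (A0_supp hs) ?dpoly0//.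
  by move=> [di _ sw _]; apply: o.
- move=> i x v l1 l2 a y z; rewrite /dpoly_form /=.
  by rewrite (A0_antilinear hs) dpoly_lin.
- by move=> i x v l1 l2 l3 y; rewrite /dpoly_form /= (A0_alt_bar hs) dpoly0.
- move=> i x w; rewrite /dpoly_form /dpoly /=; set j := triv_at P x.
  have hth c := A0_line_linear i j x [::] c theta_A0.
  have hsc c := A0_line_linear i j x w c hs.
  (* For d = 0 there is no degree d - 1, but then all derivatives of p vanish. *)
  case: d hp => [hp0|k hpk].
    apply: (homog_fun_sum (d := 0)) => c _.
    have -> : (fun v => s i j x w [:: v] 0 c * meval (theta i j x [::] [:: v] 0) (mderiv c p))
       = fun=> 0.
      by apply/funext => v; rewrite dhomog0_mderiv// meval0 mulr0.
    exact: homog_fun0.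
  apply: (homog_fun_sum (d := k.+1)) => c _.
  rewrite -add1n; apply: homog_funM => //.
  apply: (homog_fun_meval (f := fun c v => theta i j x [::] [:: v] 0 c)) => //.
  exact: dhomog_mderiv.
- move=> i w v; apply: smooth_on_local => z [x dx xz].
  pose j := triv_at P x.
  exists (chart X i @` (chart_dom X i `&` triv_dom P j)); split.
  + exact: copen_triv.
  + by exists x => //; split => //; exact: triv_atP.
  have oU := copen_triv (i := i) (j := j).
  apply: (smooth_on_ext (f := fun z => \sum_c s i j (chart_inv X i z) w [:: v] 0 c *
      meval (fun c => theta i j (chart_inv X i z) [::] [:: v] 0 c) (mderiv c p))) => //.
    by move=> y yU; rewrite (dpoly_form_near _ _ hs yU).
  apply: smooth_on_sum => // c; apply: smooth_onM => //; first exact: (A0_smooth hs).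
  apply: (smooth_on_meval (f := fun c z => theta i j (chart_inv X i z) [::] [:: v] 0 c)) => // c'.
  exact: (A0_smooth theta_A0).
- move=> i i' x w v di di'; set j := triv_at P x.
  have dj : triv_dom P j x := triv_atP x.
  rewrite /dpoly_form /= -/j.
  rewrite -[[:: transfer i i' x v]]/(map (transfer i i' x) [:: v]).
  rewrite (A0_glue hs w [:: v] di di' dj dj).
  rewrite -[[::] in X in dpoly _ _ X]/(map (transfer i i' x) [::]).
  by rewrite (A0_glue theta_A0 [::] [:: v] di di' dj dj) dpoly_Ad.
Qed.

(** theta is holomorphic, so in the Leibniz rule only the derivatives of s survive. *)
Lemma sym_dbar_dpoly_form q (s : adform P) : A0 1 q s ->
  sym_dbar (dp s) = dp (dbar s).
Proof.
move=> hs; apply: symformP => i x w v; rewrite /sym_dbar.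
case: asboolP => [di|ndi]; last first.
  by rewrite /dpoly_form /= dbar_out ?dpoly0// => -[].
rewrite /dpoly_form; cbv zeta; set j := triv_at P x.
have dj : triv_dom P j x := triv_atP x.
rewrite /dpoly.
under [RHS]eq_bigr => c _ do rewrite dbarE// mulr_suml.
rewrite exchange_big; apply: eq_bigr => l _ /=.
under eq_bigr => c _ do rewrite -mulrA.
rewrite -mulr_sumr; congr (_ * _).
have Ux : (chart X i @` (chart_dom X i `&` triv_dom P j)) (chart X i x) by exists x.
have ds c : cderivable (fun z => s i j (chart_inv X i z) (remove_nth l w) [:: v] 0 c) (chart X i x).
  by apply: smooth_on_cderivable (A0_smooth hs i j _ _ c) Ux.
have dth c := theta_cderivable [::] [:: v] c di dj.
have dme c : cderivable (fun z =>
    meval (fun c => theta i j (chart_inv X i z) [::] [:: v] 0 c) (mderiv c p)) (chart X i x).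
  exact: (cderivable_meval (f := fun c z => theta i j (chart_inv X i z) [::] [:: v] 0 c)).
rewrite (dbar_dir_ext (nth 0 w l) (copen_triv (i := i) (j := j)) Ux (dpoly_form_near _ _ hs)).
rewrite dbar_dir_sum; last by move=> c; exact: cderivableM.
apply: eq_bigr => c _; rewrite dbar_dirM// chartK//.
rewrite (dbar_dir_meval (f := fun c z => theta i j (chart_inv X i z) [::] [:: v] 0 c))//.
rewrite big1 ?mulr0 ?add0r; last by move=> c' _; rewrite dbar_dir_theta// mul0r.
by rewrite mulrC.
Qed.

(** On a single vector v the bracket is, up to sign, [theta(v), -], and it is paired with powers of
    the same theta(v): this is infinitesimal invariance of p. *)
Lemma dpoly_form_bracket (Phi : adform P) : dp (form_bracket theta Phi) = 0.
Proof.
apply: symformP => i x w v; rewrite /dpoly_form /= (form_bracket_holo _ _ _ _ _ _ theta_A0).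
by rewrite -[_ *: _]addr0 dpoly_lin dpoly0 addr0 dpoly_lie_r// mulr0.
Qed.

(** In total degree k, inserting exactly one (1,0)-vector already selects the component of type (1,
    k - 1); [dpoly_form] performs this projection by itself. *)
Lemma component_line k (s : adform P) i j x w v : higgs_deg k s -> (0 < k)%N ->
  component 1 (k - 1) s i j x w [:: v] = s i j x w [:: v].
Proof.
move=> hs k0; rewrite /component /= eqxx andbT; case: eqP => // sw.
by rewrite (higgs_deg_size _ _ _ hs)//= addn1; apply/eqP => E; apply: sw; rewrite -E subn1.
Qed.

Lemma A0_sym_higgs_deg k (s : adform P) : higgs_deg k.+1 s -> A0_sym d k (dp s).
Proof.
move=> hs; have := A0_sym_dpoly_form (higgs_deg_component hs (ltn0Sn k)).
rewrite subn1 /=; congr (A0_sym _ _ _); apply: eq_dpoly_form => i j x w v.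
by rewrite -(component_line _ _ _ _ _ hs)// subn1.
Qed.

Lemma sym_dbar_higgs_deg k (s : adform P) : higgs_deg k.+1 s ->
  sym_dbar (dp s) = dp (dbar s).
Proof.
move=> hs.
have cE i j x w v : component 1 (k.+1 - 1) s i j x w [:: v] = s i j x w [:: v].
  exact: component_line.
have <- : dp (component 1 (k.+1 - 1) s) = dp s by exact: eq_dpoly_form.
rewrite (sym_dbar_dpoly_form (higgs_deg_component hs (ltn0Sn k))).
by apply: eq_dpoly_form => i j x w v; exact: eq_dbar.
Qed.

End InvariantForms.

(** * The form lam(p(Theta)) for an algebra-valued (1,0)-form Theta *)

Section AlgebraValuedForms.
Variables (R : realType) (n m : nat) (X : complexManifold R n).
Variables (G : complexLieGroup R m) (P : principalBundle X G).
Variables (d : nat) (p : mpoly m R[i]) (hp : p \is ishomog1 d mdeg).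
Hypothesis pinv : invariant_poly G p.
Local Notation C := R[i].
Variables (I : finType) (Phi : I -> adform P) (hPhi : forall s, A0 1 0 (Phi s)).
Variables (B : comAlgType C) (beta : I -> B) (lam : {scalar B}).

(** The c-th coordinate of Theta(v), where Theta is the sum of the [Phi s] (x) [beta s]. *)
Definition alg_form i j x v (c : 'I_m) : B :=
  \sum_s Phi s i j x [::] [:: v] 0 c *: beta s.

(** The guards enforce the support condition of a (0,0)-form: for d = 0 the value p(0) need not
    vanish where the forms [Phi s] do. *)
Definition poly_form : symform X := fun i x w v =>
  if `[< chart_dom X i x >] && (w == [::]) then
    lam (aeval (alg_form i (triv_at P x) x v) p)
  else 0.

Lemma alg_form_glue i i' j j' x v c :
  chart_dom X i x -> chart_dom X i' x -> triv_dom P j x -> triv_dom P j' x ->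
  alg_form i' j' x (transfer i i' x v) c =
  \sum_k @Ad R m G (transition j' j x) (delta_mx 0 k) 0 c *: alg_form i j x v k.
Proof.
move=> di di' dj dj'; rewrite /alg_form.
under [RHS]eq_bigr => k _ do rewrite scaler_sumr.
rewrite exchange_big; apply: eq_bigr => s _ /=.
have := A0_glue (hPhi s) [::] [:: v] di di' dj dj' => /= ->.
rewrite Ad_coord scaler_suml; apply: eq_bigr => k _.
by rewrite scalerA mulrC.
Qed.

Lemma aeval_alg_form_glue i i' j j' x v :
  chart_dom X i x -> chart_dom X i' x -> triv_dom P j x -> triv_dom P j' x ->
  aeval (alg_form i' j' x (transfer i i' x v)) p = aeval (alg_form i j x v) p.
Proof.
move=> di di' dj dj'; rewrite -(aeval_Ad pinv (transition j' j x) (alg_form i j x v)).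
by apply: eq_aeval => c; exact: alg_form_glue.
Qed.

Lemma poly_form_near i j v :
  {in chart X i @` (chart_dom X i `&` triv_dom P j),
    (fun z => poly_form i (chart_inv X i z) [::] v) =1
    fun z => lam (aeval (fun c => alg_form i j (chart_inv X i z) v c) p)}.
Proof.
move=> z; rewrite inE => -[y [dy djy] <-]; rewrite chartK// /poly_form eqxx andbT.
rewrite asboolT//; congr (lam _).
have := aeval_alg_form_glue v dy dy djy (triv_atP P y).
by rewrite transfer_id.
Qed.

Lemma poly_form_A0_sym : A0_sym d 0 poly_form.
Proof.
have cons0 i x (l1 l2 : seq 'rV[C]_n) y v : poly_form i x (l1 ++ y :: l2) v = 0.
  by rewrite /poly_form; case: l1 => [|? ?]; rewrite andbF.
split.
- move=> i x w v o; rewrite /poly_form; case: andP => // -[/asboolP di /eqP w0].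
  by case: o; rewrite w0.
- by move=> i x v l1 l2 a y z; rewrite !cons0 scaler0 addr0.
- by move=> i x v l1 l2 l3 y; rewrite cons0.
- move=> i x w; rewrite /poly_form; case: andP => _; last exact: homog_fun0.
  apply: (homog_fun_aeval (V := fun c v => alg_form i (triv_at P x) x v c)) => // c.
  exists I, (fun s v => Phi s i (triv_at P x) x [::] [:: v] 0 c), beta; split => // s.
  exact: A0_line_linear.
- move=> i [|w0 w] v; last first.
    have -> : (fun z => poly_form i (chart_inv X i z) (w0 :: w) v) = fun=> 0.
      by apply/funext => z; exact: (cons0 _ _ [::]).
    exact: smooth_on_cst.
  apply: smooth_on_local => z [x dx xz]; pose j := triv_at P x.
  have oU := copen_triv (i := i) (j := j).
  exists (chart X i @` (chart_dom X i `&` triv_dom P j)); split => //.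
    by exists x => //; split => //; exact: triv_atP.
  apply: (smooth_on_ext (f := fun z =>
    lam (aeval (fun c => alg_form i j (chart_inv X i z) v c) p))) => //.
    by move=> y yU; rewrite (poly_form_near v yU).
  apply: (smooth_on_aeval (V := fun c z => alg_form i j (chart_inv X i z) v c)) => // c.
  exists I, (fun s z => Phi s i j (chart_inv X i z) [::] [:: v] 0 c), beta; split => // s.
  exact: (A0_smooth (hPhi s)).
- move=> i i' x w v di di'; rewrite /poly_form !asboolT//=.
  case: w => [|w0 w] //=; congr (lam _).
  exact: (aeval_alg_form_glue v di di' (triv_atP P x) (triv_atP P x)).
Qed.

Lemma sym_dbar_poly_form i x w0 v : chart_dom X i x ->
  sym_dbar poly_form i x [:: w0] v =
  lam (\sum_c (\sum_s dbar (Phi s) i (triv_at P x) x [:: w0] [:: v] 0 c *: beta s)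
        * aeval (alg_form i (triv_at P x) x v) (mderiv c p)).
Proof.
move=> di; set j := triv_at P x; have dj : triv_dom P j x := triv_atP P x.
have Ux : (chart X i @` (chart_dom X i `&` triv_dom P j)) (chart X i x) by exists x.
rewrite /sym_dbar asboolT//= big_ord1 /= expr0 mul1r.
rewrite (dbar_dir_ext w0 (copen_triv (i := i) (j := j)) Ux (poly_form_near v)).
have dV c : has_dbar w0 (chart X i x) (fun z => alg_form i j (chart_inv X i z) v c)
    (\sum_s dbar (Phi s) i j x [:: w0] [:: v] 0 c *: beta s).
  exists I, (fun s z => Phi s i j (chart_inv X i z) [::] [:: v] 0 c), beta; split => //.
    by move=> s; apply: smooth_on_cderivable Ux; exact: (A0_smooth (hPhi s)).
  apply: eq_bigr => s _; congr (_ *: _).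
  by rewrite dbarE//= big_ord1 /= expr0 mul1r.
have := has_dbar_functional lam (has_dbar_aeval p dV).
by rewrite chartK.
Qed.

Lemma sym_dbar_poly_form_size i x w v : size w != 1%N ->
  sym_dbar poly_form i x w v = 0.
Proof.
move=> w1; rewrite /sym_dbar; case: asboolP => // di; rewrite big1// => l _.
have -> : (fun z => poly_form i (chart_inv X i z) (remove_nth l w) v) = fun=> 0.
  apply/funext => z; rewrite /poly_form; case: eqP => [E|]; last by rewrite andbF.
  have := congr1 size E; rewrite /remove_nth size_cat size_take size_drop ltn_ord.
  case: l {E} => l /= lw; rewrite subnS => /eqP; rewrite addn_eq0 => /andP[/eqP l0 /eqP].
  by move: w1 lw; rewrite l0 subn0; case: (size w) => [|[|k]].
by rewrite dbar_dir_cst mulr0.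
Qed.

End AlgebraValuedForms.

Section CommutativeFalgebra.
Variables (K : fieldType) (B : falgType K) (hB : forall a b : B, a * b = b * a).

(** In a [falgType] commutativity is only a hypothesis, while [aeval] requires it in the type. The
    carrier is the same, so elements of B are also elements of [com_falg]. *)
Definition com_falg : comAlgType K :=
  HB.pack (Falgebra.sort B) (GRing.PzSemiRing_hasCommutativeMul.Build B hB).

End CommutativeFalgebra.

(** * Obstructions *)

Section TensorEvaluation.
Variables (K : fieldType) (L : lmodType K) (B : falgType K).
Variables (phi : L -> K).
Hypothesis phi_lin : forall a x y, phi (a *: x + y) = a * phi x + phi y.

(** The map phi (x) id from L (x) B to B; phi will be the value of a form at fixed arguments. *)
Definition tensor_eval (u : tensor L B) : B :=
  \sum_k phi (u k) *: (vbasis {:B})`_k.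

Lemma phi0 : phi 0 = 0.
Proof. by have := phi_lin (-1) 0 0; rewrite scaler0 addr0 mulN1r addrC subrr. Qed.

Lemma phiD x y : phi (x + y) = phi x + phi y.
Proof. by have := phi_lin 1 x y; rewrite scale1r mul1r. Qed.

Lemma phiZ a x : phi (a *: x) = a * phi x.
Proof. by have := phi_lin a x 0; rewrite !addr0 phi0 addr0. Qed.

Lemma tensor_evalD u v : tensor_eval (u + v) = tensor_eval u + tensor_eval v.
Proof.
rewrite /tensor_eval -big_split; apply: eq_bigr => k _.
by rewrite ffunE phiD scalerDl.
Qed.

Lemma tensor_evalZ a u : tensor_eval (a *: u) = a *: tensor_eval u.
Proof.
rewrite /tensor_eval scaler_sumr; apply: eq_bigr => k _.
by rewrite ffunE phiZ scalerA.
Qed.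

Lemma tensor_eval0 : tensor_eval 0 = 0.
Proof. by rewrite /tensor_eval big1// => k _; rewrite ffunE phi0 scale0r. Qed.

Lemma tensor_eval_sum (I : Type) (r : seq I) (F : I -> tensor L B) :
  tensor_eval (\sum_(s <- r) F s) = \sum_(s <- r) tensor_eval (F s).
Proof. exact: (big_morph tensor_eval tensor_evalD tensor_eval0). Qed.

Lemma tensor_eval_pure l a : tensor_eval (pure l a) = phi l *: a.
Proof.
rewrite [a in RHS](coord_vbasis (memvf a)) scaler_sumr; apply: eq_bigr => k _.
by rewrite ffunE phiZ scalerA mulrC.
Qed.

End TensorEvaluation.

Section Functional.
Variables (K : fieldType) (B : falgType K) (hB : forall a b : B, a * b = b * a).

(** Take a coordinate that is nonzero on eps and divide it by its value there. *)
Lemma exists_functional (eps : B) : eps != 0 ->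
  exists lam : {scalar com_falg hB}, lam eps = 1.
Proof.
move=> eps0; have [k ck] : exists k, coord (vbasis {:B}) k eps != 0.
  apply/existsP; apply: contraNT eps0; rewrite negb_exists => /forallP c0.
  rewrite (coord_vbasis (memvf eps)) big1// => k _.
  by have := c0 k; rewrite negbK => /eqP ->; rewrite scale0r.
pose l (x : com_falg hB) : K :=
  (coord (vbasis {:B}) k eps)^-1 * coord (vbasis {:B}) k (x : B).
have ll : forall a x y, l (a *: x + y) = a * l x + l y.
  move=> a x y; have E := linearP (coord (vbasis {:B}) k) a (x : B) (y : B).
  by apply: etrans (congr1 ( *%R _) E) _; rewrite mulrDr mulrCA.
pose lam : {scalar com_falg hB} :=
  HB.pack l (GRing.isLinear.Build K (com_falg hB) K *%R l ll).
by exists lam; rewrite /= /l mulVf.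
Qed.

End Functional.

Lemma big_unit (V : nmodType) (F : unit -> V) : \sum_s F s = F tt.
Proof. by rewrite (big_pred1 tt)//; case. Qed.

Lemma scaler_mul3 (K : comPzRingType) (A : algType K) (a b c : K) (u v : A) :
  (a * b * c) *: (u * v) = c *: (a *: u * (b *: v)).
Proof. by rewrite -scalerAl -scalerAr !scalerA mulrC mulrA. Qed.

Section LieSum.
Variables (R : realType) (m : nat) (G : complexLieGroup R m).
Local Notation C := R[i].
Variables (B : comAlgType C).

(** The B-bilinear extension of the bracket: the left side is how it arises from [tensor_bracket],
    the right side is the shape to which [aeval_lie] applies. *)
Lemma lie_sum (I J : finType) (y : I -> 'rV[C]_m) (z : J -> 'rV[C]_m)
    (b : I -> B) (b' : J -> B) c :
  \sum_k \sum_l lie G (y k) (z l) 0 c *: (b k * b' l) =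
  \sum_a \sum_e lie_coef G a e c *:
    ((\sum_k y k 0 a *: b k) * (\sum_l z l 0 e *: b' l)).
Proof.
under [RHS]eq_bigr => a _ do under eq_bigr => e _ do
  rewrite big_distrlr scaler_sumr /=.
under [RHS]eq_bigr => a _ do rewrite exchange_big /=.
rewrite [RHS]exchange_big; apply: eq_bigr => k _ /=.
under [RHS]eq_bigr => a _ do under eq_bigr => e _ do rewrite scaler_sumr.
under [RHS]eq_bigr => a _ do rewrite exchange_big /=.
rewrite [RHS]exchange_big; apply: eq_bigr => l _ /=.
rewrite lieE scaler_suml; apply: eq_bigr => a _.
rewrite scaler_suml; apply: eq_bigr => e _.
exact: scaler_mul3.
Qed.

(** Antisymmetry of the extended bracket, for which commutativity of B is used. *)
Lemma lie_coef_sum_swap (Y W : 'I_m -> B) c :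
  \sum_a \sum_e lie_coef G a e c *: (Y a * W e) =
  - \sum_a \sum_e lie_coef G a e c *: (W a * Y e).
Proof.
rewrite exchange_big -sumrN; apply: eq_bigr => a _ /=.
rewrite -sumrN; apply: eq_bigr => e _.
by rewrite lie_coef_antisym scaleNr mulrC.
Qed.

End LieSum.

Section Obstruction.
Variables (R : realType) (n m : nat) (X : complexManifold R n).
Variables (G : complexLieGroup R m) (P : principalBundle X G).
Variables (theta : adform P) (htheta : higgs_field theta).
Variables (d : nat) (p : mpoly m R[i]) (hp : p \is ishomog1 d mdeg).
Hypothesis pinv : invariant_poly G p.
Local Notation C := R[i].
Local Notation dp := (dpoly_form theta p).
Local Notation L := (higgs_dgla theta).

Definition form_eval i j x w v c (Phi : adform P) : C := Phi i j x w v 0 c.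

Lemma form_eval_lin i j x w v c a Phi Psi :
  form_eval i j x w v c (a *: Phi + Psi) =
  a * form_eval i j x w v c Phi + form_eval i j x w v c Psi.
Proof. by rewrite /form_eval adform_linE !mxE. Qed.

Lemma higgs_deg_theta : higgs_deg 1 theta.
Proof.
exists (fun l => if l == 1%N then theta else 0); split=> [[|[|l]]//= _|].
- exact: A0_zero.
- exact: theta_A0.
- by rewrite big_ord_recl big_ord1 /= add0r.
Qed.

Variables (B : falgType C) (hB : forall a b : B, a * b = b * a).
Variables (eps : B) (x' : tensor L B) (o : L).
Hypothesis hx' : tensor_max 1 x'.
Hypothesis heps : forall b, max_ideal B b -> b * eps = 0.
Hypothesis hcurv : curvature x' = pure o eps.
Local Notation b k := ((vbasis {:B})`_k : com_falg hB).

Lemma tensor_max_deg k : higgs_deg 1 (x' k : adform P).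
Proof.
have [r [l [a [la ->]]]] := hx'.
have -> : (\sum_(s < r) pure (l s) (a s)) k =
   \sum_(s < r) coord (vbasis {:B}) k (a s) *: (l s : adform P).
  by rewrite sum_ffunE; apply: eq_bigr => s _; rewrite ffunE.
by apply: higgs_deg_sum => s; have [] := la s.
Qed.

(** The basis of B is not adapted to its maximal ideal. Membership in m_B is visible only in a
    presentation of x' by pure tensors, hence the passage through [tensor_eval]. *)
Lemma tensor_max_eps i j x w v c :
  (eps : com_falg hB) * (\sum_k (x' k : adform P) i j x w v 0 c *: b k) = 0.
Proof.
have [r [l [a [la E]]]] := hx'.
have -> : \sum_k (x' k : adform P) i j x w v 0 c *: b k
  = \sum_s form_eval i j x w v c (l s) *: (a s : com_falg hB).
  rewrite -[LHS]/(tensor_eval (form_eval i j x w v c) x') E tensor_eval_sum//; last first.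
    exact: form_eval_lin.
  apply: eq_bigr => s _; rewrite tensor_eval_pure//; exact: form_eval_lin.
rewrite mulr_sumr big1// => s _; rewrite -scalerAr.
have [_ as'] := la s.
rewrite (_ : (eps : com_falg hB) * (a s : com_falg hB) = (a s : B) * eps).
  by rewrite heps// scaler0.
exact: hB.
Qed.

(* The k-th coordinate, in the basis of B, of Theta = theta + x'^{1,0}. *)
Definition total_form k : adform P :=
  coord (vbasis {:B}) k 1 *: theta + component 1 0 (x' k : adform P).

Lemma total_form_A0 k : A0 1 0 (total_form k).
Proof.
apply: A0_lin; first exact: theta_A0.
exact: (higgs_deg_component (tensor_max_deg k) (leqnn 1)).
Qed.

Lemma total_form_line k i j x w v :
  total_form k i j x w [:: v] =
  (coord (vbasis {:B}) k 1 *: theta + (x' k : adform P)) i j x w [:: v].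
Proof.
rewrite /total_form !adform_linE; congr (_ + _).
exact: (component_line _ _ _ _ _ (tensor_max_deg k)).
Qed.

Lemma dbar_total_form k i j x w v :
  dbar (total_form k) i j x w [:: v] = dbar (x' k : adform P) i j x w [:: v].
Proof.
rewrite (eq_dbar (Psi := coord (vbasis {:B}) k 1 *: theta + (x' k : adform P))).
  rewrite (dbar_lin _ higgs_deg_theta (tensor_max_deg k)) adform_linE.
  by case: htheta => _ -> _; rewrite scaler0 add0r.
by move=> *; exact: total_form_line.
Qed.

Lemma alg_form_total i j x v c :
  alg_form total_form (fun k => b k) i j x v c =
  theta i j x [::] [:: v] 0 c *: 1 +
  \sum_k (x' k : adform P) i j x [::] [:: v] 0 c *: b k.
Proof.
rewrite /alg_form [1 in RHS](coord_vbasis (memvf (1 : B))) scaler_sumr -big_split.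
apply: eq_bigr => k _ /=.
by rewrite total_form_line adform_linE !mxE scalerDl scalerA mulrC.
Qed.

(* The (1,1)-part of the curvature equation, dbar Theta = o eps - [Theta, x'^{0,1}];
   as forms, [Theta, x'^{0,1}](w0; v) = - [Theta(v), x'^{0,1}(w0)]. *)
Lemma curvature_eval i j x w0 v c :
  \sum_k dbar (x' k : adform P) i j x [:: w0] [:: v] 0 c *: b k =
  (o : adform P) i j x [:: w0] [:: v] 0 c *: (eps : com_falg hB) +
  \sum_a \sum_e lie_coef G a e c *:
    (alg_form total_form (fun k => b k) i j x v a *
     \sum_k (x' k : adform P) i j x [:: w0] [::] 0 e *: b k).
Proof.
pose D : com_falg hB := \sum_k dbar (x' k : adform P) i j x [:: w0] [:: v] 0 c *: b k.
pose Y e : com_falg hB := \sum_k (x' k : adform P) i j x [:: w0] [::] 0 e *: b k.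
pose W e : com_falg hB := \sum_k (x' k : adform P) i j x [::] [:: v] 0 e *: b k.
pose ev (u : tensor L B) : com_falg hB :=
  tensor_eval (form_eval i j x [:: w0] [:: v] c) u.
have evD u u' : ev (u + u') = ev u + ev u' :=
  tensor_evalD (form_eval_lin i j x [:: w0] [:: v] c) u u'.
have evZ a u : ev (a *: u) = a *: ev u :=
  tensor_evalZ (form_eval_lin i j x [:: w0] [:: v] c) a u.
have evP l a : ev (pure l a) = form_eval i j x [:: w0] [:: v] c l *: (a : com_falg hB) :=
  tensor_eval_pure (form_eval_lin i j x [:: w0] [:: v] c) l a.
have evS (I : Type) (r : seq I) (F : I -> tensor L B) :
    ev (\sum_(s <- r) F s) = \sum_(s <- r) ev (F s) :=
  tensor_eval_sum (form_eval_lin i j x [:: w0] [:: v] c) r F.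
(* [Y] and [W] are the coordinates of x'^{0,1}(w0) and x'^{1,0}(v). [T] and [S] are the c-th
   coordinates of [theta(v), Y] and [W, Y], which add up to [Theta(v), Y]. *)
pose T : com_falg hB := \sum_a \sum_e lie_coef G a e c *:
   ((theta i j x [::] [:: v] 0 a *: 1) * Y e).
pose S : com_falg hB := \sum_a \sum_e lie_coef G a e c *: (W a * Y e).
have E1 : ev (tensor_diff x') = D - T.
  have -> : T = \sum_k lie G (theta i j x [::] [:: v])
      ((x' k : adform P) i j x [:: w0] [::]) 0 c *: b k.
    have := lie_sum G (fun=> theta i j x [::] [:: v])
      (fun k => (x' k : adform P) i j x [:: w0] [::]) (fun _ : unit => 1 : com_falg hB)
      (fun k => b k) c.
    rewrite big_unit; under eq_bigr do rewrite mul1r.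
    move=> ->; apply: eq_bigr => a _; apply: eq_bigr => e _.
    by rewrite big_unit.
  rewrite /D -sumrB; apply: eq_bigr => k _; rewrite ffunE -scalerBl; congr (_ *: _).
  have -> : @Defs.diff _ L (x' k) =
      dbar (x' k : adform P) + form_bracket theta (x' k : adform P) by [].
  rewrite /form_eval -[dbar _ in RHS]scale1r.
  rewrite -[X in (X + _) i]scale1r adform_linE !scale1r.
  rewrite (form_bracket_holo (x' k : adform P) i j x [:: w0] v (theta_A0 htheta)).
  by rewrite expr1 scaleN1r [LHS]mxE [X in _ + X = _]mxE.
have mulE (a a' : B) : (a * a' : B) = (a : com_falg hB) * (a' : com_falg hB) by [].
(* The two mixed terms of [x', x'] agree by antisymmetry; the factor 2 cancels the 1/2 of the
   curvature. *)
have E2 : ev (tensor_bracket x' x') = - (2%:R *: S).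
  rewrite /tensor_bracket evS.
  under eq_bigr => k _.
    rewrite evS; under eq_bigr => l _.
      rewrite evP mulE /form_eval
        -[dg_bracket _ _]/(form_bracket (x' k : adform P) (x' l : adform P)).
      rewrite form_bracket_11; [|exact: tensor_max_deg|exact: tensor_max_deg].
      rewrite mxE [X in _ + X]mxE scalerBl; over.
    rewrite sumrB; over.
  rewrite sumrB.
  have Q1 := lie_sum G (fun k => (x' k : adform P) i j x [:: w0] [::])
    (fun k => (x' k : adform P) i j x [::] [:: v]) (fun k => b k) (fun k => b k) c.
  have Q2 := lie_sum G (fun k => (x' k : adform P) i j x [::] [:: v])
    (fun k => (x' k : adform P) i j x [:: w0] [::]) (fun k => b k) (fun k => b k) c.
  apply: etrans (congr2 (fun s t => s - t) Q1 Q2) _.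
  rewrite -/(Y _) -/(W _).
  have -> : \sum_a \sum_e lie_coef G a e c *: (Y a * W e) = - S :> com_falg hB.
    exact: lie_coef_sum_swap.
  by rewrite scaler_nat mulr2n opprD.
have := congr1 ev hcurv; rewrite /curvature evD evZ evP E1 E2.
rewrite scalerN scalerA mulVf ?scale1r ?pnatr_eq0// => E.
rewrite -[LHS]/D -[D](subrK T) -[D - T](subrK S) E -addrA; congr (_ + _).
rewrite /S /T -big_split; apply: eq_bigr => a _ /=; rewrite -big_split.
apply: eq_bigr => e _ /=.
by rewrite -scalerDr -mulrDl alg_form_total addrC.
Qed.

Hypothesis eps0 : eps != 0.
Hypothesis ho : higgs_deg 2 (o : adform P).

Lemma obstruction_form :
  exists2 tau, A0_sym d 0 tau & sym_dbar tau = dp (o : adform P).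
Proof.
have [lam lam1] := exists_functional hB eps0.
exists (poly_form p total_form (fun k => b k) lam).
  exact: (poly_form_A0_sym hp pinv total_form_A0).
apply: symformP => i x w v.
have hdp : A0_sym d 1 (dp (o : adform P)) := A0_sym_higgs_deg htheta hp pinv ho.
have [w1|w1] := eqVneq (size w) 1%N; last first.
  rewrite sym_dbar_poly_form_size// (A0s_supp hdp)// => -[_ w1'].
  by rewrite w1' in w1.
have [dx|dx] := pselect (chart_dom X i x); last first.
  by rewrite (A0s_supp hdp)/sym_dbar ?asboolF// => -[].
case: w w1 => [|w0 [|? ?]]// _.
rewrite (sym_dbar_poly_form pinv total_form_A0)// /dpoly_form /dpoly /=.
set j := triv_at P x.
have -> : \sum_c (\sum_s dbar (total_form s) i j x [:: w0] [:: v] 0 c *: b s) *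
    aeval (alg_form total_form (fun k => b k) i j x v) (mderiv c p) =
    (\sum_c (o : adform P) i j x [:: w0] [:: v] 0 c *
      meval (theta i j x [::] [:: v] 0) (mderiv c p)) *: (eps : com_falg hB).
  under eq_bigr => c _.
    under eq_bigr => s _ do rewrite dbar_total_form.
    rewrite curvature_eval mulrDl -scalerAl.
    (* By [alg_form_total] the coordinates of Theta are those of theta plus elements killed by
       eps. *)
    rewrite (@aeval_annihilated _ _ _ _ (theta i j x [::] [:: v] 0)); last first.
      by move=> a; rewrite alg_form_total mulrDr tensor_max_eps addr0 mulr_algr.
    rewrite scalerA; over.
  rewrite big_split /= scaler_suml -[RHS]addr0; congr (_ + _).
  exact: (aeval_lie pinv (alg_form total_form (fun k => b k) i j x v)
    (fun e => \sum_k (x' k : adform P) i j x [:: w0] [::] 0 e *: b k)).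
by rewrite linearZ lam1; exact: mulr1.
Qed.

End Obstruction.

(** * The induced map on cohomology and its values on obstructions *)

Section ObstructionMap.
Variables (R : realType) (n m : nat) (X : complexManifold R n).
Variables (G : complexLieGroup R m) (P : principalBundle X G).
Variables (theta : adform P) (htheta : higgs_field theta).
Local Notation L := (higgs_dgla theta).

Lemma higgs_diff_lin k a Phi Psi : higgs_deg k Phi -> higgs_deg k Psi ->
  @Defs.diff _ L (a *: Phi + Psi) = a *: @Defs.diff _ L Phi + @Defs.diff _ L Psi.
Proof.
move=> hPhi hPsi; rewrite /= (dbar_lin _ hPhi hPsi) form_bracket_linr.
by rewrite scalerDr addrACA.
Qed.

Lemma higgs_diff0 : @Defs.diff _ L 0 = 0.
Proof.
have h0 := @higgs_deg_zero R n m X G P 0.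
have := higgs_diff_lin (-1) h0 h0.
by rewrite scaler0 addr0 scaleN1r addNr.
Qed.

Lemma higgs_cocycle_sum k r (a : 'I_r -> R[i]) (F : 'I_r -> L) :
  (forall s, cocycle L k (F s)) -> cocycle L k (\sum_s a s *: F s).
Proof.
move=> hF; elim/big_ind: _ => [|Phi Psi [hPhi dPhi] [hPsi dPsi]|s _].
- by split; [exact: higgs_deg_zero|exact: higgs_diff0].
- rewrite -[Phi]scale1r; split; first exact: higgs_deg_lin.
  by rewrite (higgs_diff_lin _ hPhi hPsi) dPhi dPsi scaler0 addr0.
- have [hs ds] := hF s; have h0 := @higgs_deg_zero R n m X G P k.
  rewrite -[_ *: _]addr0; split; first exact: higgs_deg_lin.
  by rewrite (higgs_diff_lin _ hs h0) ds higgs_diff0 scaler0 addr0.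
Qed.

Variables (d : nat) (p : mpoly m R[i]) (hp : p \is ishomog1 d mdeg).
Hypothesis pinv : invariant_poly G p.
Local Notation dp := (dpoly_form theta p).
Local Notation D := (dolbeault X d).

Lemma dolbeault_coboundary_lin a (b c : D) : coboundary D 1 b -> coboundary D 1 c ->
  coboundary D 1 (a *: b + c).
Proof.
move=> [u hu ->] [v hv ->]; exists (a *: u + v); first exact: A0_sym_lin.
by rewrite /= (sym_dbar_lin _ hu hv).
Qed.

Lemma dolbeault_coboundary0 : coboundary D 1 0.
Proof.
exists 0; first exact: A0_sym_zero.
have h0 := @A0_sym_zero R n X d 0.
have := sym_dbar_lin (-1) h0 h0.
by rewrite /= scaler0 addr0 scaleN1r addNr.
Qed.

Lemma dolbeault_class_eq (y y' : D) : coboundary D 1 (y - y') ->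
  coh_class D 1 y = coh_class D 1 y'.
Proof.
move=> hy; apply/seteqP; split=> z [hz hzy]; split=> //.
- have := dolbeault_coboundary_lin 1 hzy hy.
  by rewrite scale1r addrA subrK.
- have := dolbeault_coboundary_lin (-1) hy hzy.
  by rewrite scaleN1r opprB addrC subrKA.
Qed.

Lemma dpoly_form_component (s : adform P) : higgs_deg 2 s ->
  dp (component 1 1 s) = dp s.
Proof. by move=> hs; apply: eq_dpoly_form => *; exact: (component_line _ _ _ _ _ hs). Qed.

(** The chain map property: the bracket with theta is killed, and dbar is respected. Cocycles and
    coboundaries are then preserved. *)
Lemma dpoly_form_diff k (s : adform P) : higgs_deg k.+1 s ->
  dp (@Defs.diff _ L s) = sym_dbar (dp s).
Proof.
move=> hs; rewrite (sym_dbar_higgs_deg htheta pinv hs) /=.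
have := dpoly_form_lin theta p 1 (dbar s) (form_bracket theta s).
by rewrite !scale1r dpoly_form_bracket// addr0.
Qed.

Lemma dpoly_form_cocycle (s : L) : cocycle L 2 s -> cocycle D 1 (dp s).
Proof.
move=> [hs ds]; split; first exact: (A0_sym_higgs_deg htheta hp pinv hs).
rewrite /= -(dpoly_form_diff hs) ds -[0](subrr (0 : adform P)) -scaleN1r addrC dpoly_form_lin.
by rewrite scaleN1r addNr.
Qed.

Lemma dpoly_form_coboundary (s : L) : coboundary L 2 s -> coboundary D 1 (dp s).
Proof.
move=> [u hu ->]; exists (dp u); first exact: (A0_sym_higgs_deg htheta hp pinv hu).
exact: (dpoly_form_diff hu).
Qed.

Lemma obstruction_coboundary (o : L) : obstruction_cocycle o -> coboundary D 1 (dp o).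
Proof.
move=> [[ho _] [B [A [f [eps [x [x' [[hB _] hse _ [hx' _] hc]]]]]]]].
have [tau htau E] := obstruction_form htheta hp pinv (art_comm hB) hx' (pse_small hse)
  hc (pse_neq0 hse) ho.
by exists tau.
Qed.

Lemma obstruction_sum_coboundary r (a : 'I_r -> R[i]) (o : 'I_r -> L) :
  (forall s, obstruction_cocycle (o s)) -> coboundary D 1 (dp (\sum_s a s *: o s)).
Proof.
have dp0 : dp 0 = 0.
  by rewrite -[0 in LHS](subrr (0 : adform P)) -scaleN1r addrC dpoly_form_lin scaleN1r addNr.
move=> ho; elim/big_ind: _ => [|Phi Psi hPhi hPsi|s _].
- by rewrite dp0; exact: dolbeault_coboundary0.
- by rewrite -[Phi]scale1r dpoly_form_lin; exact: dolbeault_coboundary_lin.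
- rewrite -[_ *: _]addr0 dpoly_form_lin dp0; apply: dolbeault_coboundary_lin.
    exact: obstruction_coboundary.
  exact: dolbeault_coboundary0.
Qed.

(** A cocycle lies in its own class, so equal classes make s - s' a coboundary. The map on classes
    is thereby independent of representatives. *)
Lemma dpoly_form_class (s s' : L) : cocycle L 2 s -> coh_class L 2 s = coh_class L 2 s' ->
  coh_class D 1 (dp s) = coh_class D 1 (dp s').
Proof.
move=> hs E; apply: dolbeault_class_eq.
have : coh_class L 2 s' s.
  rewrite -E; split=> //; rewrite subrr; exists 0; first exact: higgs_deg_zero.
  by rewrite higgs_diff0.
move=> [_ /dpoly_form_coboundary].
by rewrite addrC -scaleN1r dpoly_form_lin scaleN1r addrC.
Qed.

End ObstructionMap.

Theorem theoremA (R : realType) (n m : nat)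
    (X : complexManifold R n) (hX : compact [set: X])
    (G : complexLieGroup R m) (hG : reductive G)
    (E : Type) (d : E -> nat) (p : E -> mpoly m R[i])
    (hp : homogeneous_generators G d p)
    (P : principalBundle X G) (theta : adform P) (htheta : higgs_field theta) :
  let L := higgs_dgla theta in
  let D (i : E) := dolbeault X (d i) in
  let dp (i : E) (s : L) : D i := dpoly_form theta (p i) (component 1 1 s) in
  exists h : forall i : E, set L -> set (D i),
    (forall (i : E) (s : L), cocycle L 2 s ->
       cocycle (D i) 1 (dp i s) /\
       h i (coh_class L 2 s) = coh_class (D i) 1 (dp i s)) /\
    obstruction_space L `<=` [set c | forall i : E, h i c = coh_class (D i) 1 0].
Proof.
move=> L D dp; have [hom pinv _] := hp.
(* On arguments that are not classes of cocycles, h i is empty. *)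
pose h i c : set (D i) := [set y | exists s : L,
  [/\ cocycle L 2 s, coh_class L 2 s = c & coh_class (D i) 1 (dpoly_form theta (p i) s) y]].
have hE i (s : L) : cocycle L 2 s ->
    h i (coh_class L 2 s) = coh_class (D i) 1 (dpoly_form theta (p i) s).
  move=> hs; apply/seteqP; split=> [y [s' [hs' Es]]|y hy]; last by exists s.
  by rewrite (dpoly_form_class htheta (hom i) (pinv i) hs' Es).
exists h; split=> [i s hs|c [r [a [obs [hobs ->]]]] i].
  rewrite /dp dpoly_form_component; last by case: hs.
  by split; [exact: dpoly_form_cocycle|exact: hE].
rewrite hE; last by apply: higgs_cocycle_sum => s; case: (hobs s).
apply: dolbeault_class_eq; rewrite subr0.
exact: (obstruction_sum_coboundary htheta (hom i) (pinv i)).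
Qed.
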